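(* Let $k$ be a number field and let $E_0$ be an elliptic curve over $k$ given by $y^2z=x^3+Axz^2+Bz^3$ with $A\neq0$, and let $F_0$ be the elliptic curve defined by the equation $$F_0:\ \delta_{E_0}y^2z=x^3-\delta_{E_0}xz^2-2B\delta_{E_0}z^3,$$ where $\delta_{E_0}=4A^3+27B^2$. Let $\mathcal{F}_t$ be the pencil of cubic curves given by $$\mathcal{F}_t:\ (\delta_{E_0}y^2z-x^3+\delta_{E_0}xz^2+2B\delta_{E_0}z^3)+t\,(-3x^2z-18Bxz^2+3xy^2-\delta_{E_0}z^3)=0.$$ Then the map $$\phi:(x:y:z)\mapsto\bigl(-y(3Ax^2+9Bxz-A^2z^2):Az(3x^2+Az^2):3xyz\bigr)$$ gives an anti-symplectic isomorphism $E_0[3]\to\mathcal{F}_t[3]$ for each $t$ such that $\mathcal{F}_t$ is an elliptic curve. Any elliptic curve $F$ over $k$ with an anti-symplectic isomorphism $E_0[3]\to F[3]$ is a member of $\mathcal{F}_t$.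
   Context: The curve $E_0$ is a plane cubic with origin $O=(0:1:0)$, an inflection point, so that its $3$-torsion points are its inflection points. For an elliptic curve $E$ over $k$, $E[3]$ denotes the group of $3$-torsion points of $E(\bar k)$, regarded as a $\mathrm{Gal}(\bar k/k)$-module, and $e_{E,3}$ denotes its Weil pairing. An isomorphism of Galois modules $\psi:E_0[3]\to E[3]$ is called anti-symplectic if $e_{E,3}(\psi(P),\psi(Q))=e_{E_0,3}(P,Q)^{-1}$ for all $P,Q\in E_0[3]$.
   Formalization: The first coordinate of φ is corrected to −y(−3Ax²+9Bxz−3A²z²), as the printed one does not map E_0[3] into F_t; φ(O)=O is set separately since the formula vanishes there; the pencil includes its member at t=∞, and membership is up to k-isomorphism. *)

(* Defs.v *)
From mathcomp Require Import all_boot all_order all_algebra all_field.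
From mathcomp Require Import mpoly.
From Stdlib Require Import ClassicalEpsilon.

Set Implicit Arguments.
Unset Strict Implicit.
Unset Printing Implicit Defensive.

Import GRing.Theory.
Local Open Scope ring_scope.

(** * The projective plane *)

Definition vec3 (K : fieldType) (a b c : K) : 'rV[K]_3 :=
  \row_i [:: a; b; c]`_i.

(* Some nonzero coordinate (chosen from the support of v only, hence invariant
   under scaling) is made equal to 1. *)
Definition pnormal (K : fieldType) (v : 'rV[K]_3) : 'rV[K]_3 :=
  if [pick i | v 0 i != 0] is Some i then (v 0 i)^-1 *: v else 0.

(* Points of P^2(K), each given by its normalised representative, so that
   Leibniz equality is equality of points. *)
Definition P2 (K : fieldType) :=
  {v : 'rV[K]_3 | (v != 0) && (pnormal v == v)}.

Lemma vec3_010_subproof (K : fieldType) :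
  (vec3 (0 : K) 1 0 != 0) && (pnormal (vec3 (0 : K) 1 0) == vec3 0 1 0).
Proof.
have h1 : vec3 (0 : K) 1 0 0 1 = 1 by rewrite mxE.
apply/andP; split.
  by apply/eqP => /rowP/(_ 1); rewrite h1 mxE; apply/eqP; rewrite oner_eq0.
rewrite /pnormal; case: pickP => [i|/(_ 1)]; last by rewrite h1 oner_eq0.
by rewrite mxE; case: i => [[|[|[|]]] //= ?]; rewrite ?eqxx // invr1 scale1r.
Qed.

(* The point (0 : 1 : 0). *)
Definition pt010 (K : fieldType) : P2 K :=
  exist _ (vec3 0 1 0) (vec3_010_subproof K).

(* The point with homogeneous coordinates v; junk value when v = 0. *)
Definition pt (K : fieldType) (v : 'rV[K]_3) : P2 K :=
  insubd (pt010 K) (pnormal v).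

Definition map_pt (K L : fieldType) (f : {rmorphism K -> L}) (P : P2 K) : P2 L :=
  pt (map_mx f (val P)).

(** * Pointed plane cubics and the chord-tangent law *)

Record pcubic (K : fieldType) :=
  PCubic { form : {mpoly K[3]}; orig : P2 K }.

Definition base_change (K L : fieldType) (f : {rmorphism K -> L})
    (C : pcubic K) : pcubic L :=
  PCubic (map_mpoly f (form C)) (map_pt f (orig C)).

Section Geometry.
Variables (K : fieldType) (C : pcubic K).

Definition on_curve (P : P2 K) : bool := (form C).@[val P 0] == 0.

(* As a linear form in v, this is the equation of the tangent line at P. *)
Definition tangent (P : P2 K) (v : 'rV[K]_3) : K :=
  \sum_i ((form C)^`M(i)).@[val P 0] * v 0 i.

Definition cross (u v : 'rV[K]_3) : 'rV[K]_3 :=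
  vec3 (u 0 1 * v 0 2%:R - u 0 2%:R * v 0 1)
       (u 0 2%:R * v 0 0 - u 0 0 * v 0 2%:R)
       (u 0 0 * v 0 1 - u 0 1 * v 0 0).

(* For a smooth point P of C, a vector which together with val P spans the
   tangent line at P: one of the three vectors grad(P) x e_i will do. *)
Definition tangent_vec (P : P2 K) : 'rV[K]_3 :=
  let T i := cross (\row_j ((form C)^`M(j)).@[val P 0]) (delta_mx 0 i) in
  if [pick i | cross (T i) (val P) != 0] is Some i then T i else 0.

(* The third intersection point of C with the line PQ (the tangent line if
   P = Q).  With G the cubic form, on C one has
     G (s P + u Q) = s u (s (grad G(P) . Q) + u (grad G(Q) . P)),
   and for T on the tangent line at P
     G (s P + u T) = u^2 (s (grad G(T) . P) + u G(T)). *)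
Definition third (P Q : P2 K) : P2 K :=
  if P != Q then
    pt (tangent Q (val P) *: val P - tangent P (val Q) *: val Q)
  else
    let T := tangent_vec P in
    pt ((form C).@[T 0] *: val P
        - (\sum_i ((form C)^`M(i)).@[T 0] * val P 0 i) *: T).

Definition addp (P Q : P2 K) : P2 K := third (orig C) (third P Q).
Definition oppp (P : P2 K) : P2 K := third P (third (orig C) (orig C)).

Definition torsion3 : pred (P2 K) :=
  [pred P | on_curve P & addp (addp P P) P == orig C].

(* When the origin is an inflection point and T is a 3-torsion point, this is a
   rational function with divisor 3(T) - 3(O); in both places where it is
   used it is evaluated at v through a quotient, so its scaling is immaterial. *)
Definition fT (T X : P2 K) : K :=
  tangent T (val X) / tangent (orig C) (val X).

(* R avoids the zeros and poles of the functions in the definition below. *)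
Definition weil_admissible (S T R : P2 K) : bool :=
  [&& on_curve R,
      all (fun X => (tangent S (val X) != 0) && (tangent (orig C) (val X) != 0))
          [:: addp T R; R]
    & all (fun X => (tangent T (val X) != 0) && (tangent (orig C) (val X) != 0))
          [:: addp S (oppp R); oppp R]].

(* The Weil pairing
     e_3(S, T) = (f_S(T + R) / f_S(R)) / (f_T(S - R) / f_T(-R)),
   i.e. f_S(D_T) / f_T(D_S) with D_T = (T + R) - (R), D_S = (S - R) - (-R).
   Any admissible auxiliary point R gives the same value. *)
Definition weil3 (S T : P2 K) : K :=
  let R := epsilon (inhabits (orig C)) (fun R => weil_admissible S T R) in
  (fT S (addp T R) / fT S R) / (fT T (addp S (oppp R)) / fT T (oppp R)).

End Geometry.

(** * Elliptic curves over a number field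

   The algebraic closure of the number field k is algC, through an embedding
   iota : k -> algC.  Every elliptic curve over k is a smooth plane cubic over k
   with a k-rational inflection point as origin. *)

Section NumberField.
Variables (k : fieldExtType rat) (iota : {rmorphism k -> algC}).

Definition geom (C : pcubic k) : pcubic algC := base_change iota C.

Definition smooth (C : pcubic algC) : Prop :=
  forall v : 'rV[algC]_3, v != 0 -> (form C).@[v 0] = 0 ->
    exists i, ((form C)^`M(i)).@[v 0] != 0.

Definition elliptic (C : pcubic k) : Prop :=
  [/\ form C \is 3.-homog, smooth (geom C),
      on_curve (geom C) (orig (geom C))
    & third (geom C) (orig (geom C)) (orig (geom C)) = orig (geom C)].

(* Ring endomorphisms of algC are automorphisms, so sigma ranges over
   Gal(kbar/k). *)
Definition galois_equivariant (E : pcubic algC) (psi : P2 algC -> P2 algC) :=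
  forall sigma : {rmorphism algC -> algC},
    (forall a : k, sigma (iota a) = iota a) ->
  forall P, P \in torsion3 E -> psi (map_pt sigma P) = map_pt sigma (psi P).

(* psi restricts to an isomorphism of Galois modules E[3] -> F[3]; its values
   outside E[3] are irrelevant. *)
Definition torsion3_iso (E F : pcubic k) (psi : P2 algC -> P2 algC) : Prop :=
  [/\ forall P, P \in torsion3 (geom E) -> psi P \in torsion3 (geom F),
      {in torsion3 (geom E) &, injective psi},
      forall Q, Q \in torsion3 (geom F) ->
        exists2 P, P \in torsion3 (geom E) & psi P = Q,
      {in torsion3 (geom E) &, forall P Q,
        psi (addp (geom E) P Q) = addp (geom F) (psi P) (psi Q)}
    & galois_equivariant (geom E) psi].

Definition antisymplectic_iso (E F : pcubic k) (psi : P2 algC -> P2 algC) :=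
  torsion3_iso E F psi /\
  {in torsion3 (geom E) &, forall P Q,
    weil3 (geom F) (psi P) (psi Q) = (weil3 (geom E) P Q)^-1}.

(* Isomorphism over k of elliptic curves.  Since the origins are inflection
   points, the plane embeddings are given by |3 O|, and isomorphisms are the
   projective linear ones. *)
Definition isomorphic (C D : pcubic k) : Prop :=
  exists M : 'M[k]_3, exists c : k,
    [/\ M \in unitmx, c != 0,
        form D \mPo [tuple \sum_j M j i *: 'X_j | i < 3] = c *: form C
      & pt (val (orig C) *m M) = orig D].

(** * The curves and the map of the theorem *)

Local Notation x := ('X_0 : {mpoly k[3]}).
Local Notation y := ('X_1 : {mpoly k[3]}).
Local Notation z := ('X_(2%:R) : {mpoly k[3]}).

Variables A B : k.

Definition delta : k := 4%:R * A ^+ 3 + 27%:R * B ^+ 2.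

Definition E0 : pcubic k :=
  PCubic (y ^+ 2 * z - (x ^+ 3 + A *: (x * z ^+ 2) + B *: z ^+ 3)) (pt010 k).

Definition F0_form : {mpoly k[3]} :=
  delta *: (y ^+ 2 * z)
  - (x ^+ 3 - delta *: (x * z ^+ 2) - (2%:R * B * delta) *: z ^+ 3).

Definition F0 : pcubic k := PCubic F0_form (pt010 k).

Definition Finf_form : {mpoly k[3]} :=
  - (3%:R *: (x ^+ 2 * z)) - (18%:R * B) *: (x * z ^+ 2)
  + 3%:R *: (x * y ^+ 2) - delta *: z ^+ 3.

(* The members of the pencil, t in P^1(k); None is the point at infinity. *)
Definition Ft (t : option k) : pcubic k :=
  PCubic (if t is Some t then F0_form + t *: Finf_form else Finf_form)
         (pt010 k).

(* The cubic expressions vanish simultaneously at the origin (0 : 1 : 0), which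
   phi sends to the origin (0 : 1 : 0).  At any other inflection point (x : y : 1)
   of E0, with tangent of slope m (so that m^2 = 3 x), the formula is
   phi (x : y : 1) = (delta / (3 y^2) : 2 A / m : 1). *)
Definition phi (P : P2 algC) : P2 algC :=
  let a := iota A in
  let b := iota B in
  let X := val P 0 0 in
  let Y := val P 0 1 in
  let Z := val P 0 2%:R in
  if P == pt010 algC then pt010 algC else
  pt (vec3
    (- Y * (- (3%:R * a * X ^+ 2) + 9%:R * b * X * Z - 3%:R * a ^+ 2 * Z ^+ 2))
    (a * Z * (3%:R * X ^+ 2 + a * Z ^+ 2))
    (3%:R * X * Y * Z)).

End NumberField.

(* Main.v *)
Require Import Defs.
From HB Require Import structures.
From mathcomp Require Import all_boot all_order all_algebra all_field.
From mathcomp Require Import mpoly ring.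
From Stdlib Require Import ClassicalEpsilon.
Set Implicit Arguments.
Unset Strict Implicit.
Unset Printing Implicit Defensive.
Import Order.TTheory GRing.Theory Num.Theory Defs.
Local Open Scope ring_scope.

(** Over the algebraic closure every smooth cubic with a flex as origin becomes,
    by a linear change of coordinates (a Hesse model), a Hesse cubic
    a (x^3 + y^3 + z^3) + b x y z with origin (0 : 1 : -1).  The 3-torsion points
    are the flexes ([torsion3_flexP]), and for all Hesse cubics these are the same
    nine points, indexed by F_3^2 ([torsion3_hesse]).  Adding the point of index s
    is a fixed linear map, an element of the Heisenberg group, so the group law on
    the torsion is addition in F_3^2 ([addp_hesse]); the Weil pairing is w ^ det
    for a primitive cube root of unity w ([hesse_weil]).  Both facts hold verbatim
    for every curve with a Hesse model ([model_addp], [model_weil]).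

    One explicit matrix [to_weier] gives a Hesse model of E_0, and one explicit
    matrix [to_pencil] carries the whole Hesse pencil onto the pencil F_t
    ([pencil0_hesse], [pencil_inf_hesse]).  In these coordinates phi is the map
    (i, j) -> (i, -j) on indices ([phi_torsion]).  It is additive of determinant
    -1, hence anti-symplectic; it commutes with the Galois group because its
    coefficients lie in k ([phi_antisymplectic]).  The smoothness of F_0 is read off
    its partial derivatives ([F0_smooth]).

    Conversely let psi be an anti-symplectic isomorphism from E_0[3] to F[3].
    Then phi o psi^-1 is symplectic: on indices it is an element of SL_2(F_3).
    Every such element is induced by a projective transformation of the plane
    permuting the nine points ([realizable_sl2]), so some matrix M carries each
    psi (P) to phi (P).  The cubics through the nine points are the members of the
    Hesse pencil ([cubic_through_tor]), hence M carries F to a member of the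
    pencil F_t over the closure ([transfer_matrix]).  A Galois conjugate of M does
    the same to the nine points, and a projective transformation fixing all nine
    is trivial ([fixes_tor_scalar]); so M is invariant up to scalars
    ([transfer_galois]) and a multiple of it has entries in k
    ([matrix_descent]).  Then the parameter of the pencil also lies in k
    ([antisymplectic_member]). *)

(** * Vectors and points of the projective plane *)

Section Vectors.
Variable K : fieldType.
Implicit Types (u v w : 'rV[K]_3) (M N : 'M[K]_3).

Lemma vec30 (a b c : K) : vec3 a b c 0 0 = a. Proof. by rewrite mxE. Qed.
Lemma vec31 (a b c : K) : vec3 a b c 0 1 = b. Proof. by rewrite mxE. Qed.
Lemma vec32 (a b c : K) : vec3 a b c 0 2%:R = c. Proof. by rewrite mxE. Qed.
Definition vec3E := (vec30, vec31, vec32).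

Lemma ord3P (P : 'I_3 -> Prop) : P 0 -> P 1 -> P 2%:R -> forall i, P i.
Proof.
move=> P0 P1 P2 [[|[|[|//]]] h].
- by rewrite (_ : Ordinal h = 0) //; apply: val_inj.
- by rewrite (_ : Ordinal h = 1) //; apply: val_inj.
- by rewrite (_ : Ordinal h = 2%:R) //; apply: val_inj.
Qed.

Lemma row3P u v :
  u 0 0 = v 0 0 -> u 0 1 = v 0 1 -> u 0 2%:R = v 0 2%:R -> u = v.
Proof. by move=> h0 h1 h2; apply/rowP; apply: ord3P. Qed.

Lemma vec3K v : vec3 (v 0 0) (v 0 1) (v 0 2%:R) = v.
Proof. by apply: row3P; rewrite vec3E. Qed.

Lemma sum3 (V : nmodType) (F : 'I_3 -> V) : \sum_i F i = F 0 + F 1 + F 2%:R.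
Proof.
rewrite !big_ord_recl big_ord0 addr0 addrA.
by congr (F _ + F _ + F _); apply: val_inj.
Qed.

Lemma prod3 (R : comNzRingType) (F : 'I_3 -> R) : \prod_i F i = F 0 * F 1 * F 2%:R.
Proof.
rewrite !big_ord_recl big_ord0 mulr1 mulrA.
by congr (F _ * F _ * F _); apply: val_inj.
Qed.

Lemma mulmx3 v M j :
  (v *m M) 0 j = v 0 0 * M 0 j + v 0 1 * M 1 j + v 0 2%:R * M 2%:R j.
Proof. by rewrite mxE sum3. Qed.

Lemma vec3_eq0 (a b c : K) : (vec3 a b c == 0) = [&& a == 0, b == 0 & c == 0].
Proof.
apply/eqP/and3P => [h|[/eqP-> /eqP-> /eqP->]].
  have := (congr1 (fun u : 'rV_3 => (u 0 0, u 0 1, u 0 2%:R)) h).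
  by rewrite !(vec3E, mxE) => -[-> -> ->]; rewrite eqxx.
by apply: row3P; rewrite !mxE.
Qed.

Lemma row_neq0P v : v != 0 -> exists i, v 0 i != 0.
Proof.
move=> nz; apply/existsP; rewrite -negb_forall; apply: contra nz => /forallP z.
by apply/eqP/rowP => j; rewrite mxE; apply/eqP.
Qed.

Lemma crossZl (c : K) u v : cross (c *: u) v = c *: cross u v.
Proof. by apply: row3P; rewrite /cross !(vec3E, mxE) /=; ring. Qed.

Lemma cross_antisym u v : cross u v = - cross v u.
Proof. by apply: row3P; rewrite /cross !(vec3E, mxE) /=; ring. Qed.

Lemma crossvv u : cross u u = 0.
Proof. by apply: row3P; rewrite /cross !(vec3E, mxE) /=; ring. Qed.

Lemma cross_eq0 u v : v != 0 -> cross u v = 0 -> exists c, u = c *: v.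
Proof.
move=> nz /rowP h; have := (h 0, h 1, h 2%:R); rewrite /cross !(vec3E, mxE) /=.
move=> [] [] /eqP h0 /eqP h1 /eqP h2; rewrite !subr_eq0 in h0 h1 h2.
move: h0 h1 h2 => /eqP h0 /eqP h1 /eqP h2.
move: nz; rewrite -(vec3K v) vec3_eq0 !negb_and.
move=> /orP[nz|/orP[nz|nz]].
- exists (u 0 0 / v 0 0); apply: row3P; rewrite !(vec3E, mxE) /=.
  + by rewrite mulfVK.
  + by rewrite mulrAC h2 mulfK.
  + by rewrite mulrAC -h1 mulfK.
- exists (u 0 1 / v 0 1); apply: row3P; rewrite !(vec3E, mxE) /=.
  + by rewrite mulrAC -h2 mulfK.
  + by rewrite mulfVK.
  + by rewrite mulrAC h0 mulfK.
- exists (u 0 2%:R / v 0 2%:R); apply: row3P; rewrite !(vec3E, mxE) /=.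
  + by rewrite mulrAC h1 mulfK.
  + by rewrite mulrAC -h0 mulfK.
  + by rewrite mulfVK.
Qed.

(** The determinant of the three rows, kept as an explicit polynomial. *)
Definition triple u v w : K :=
  cross u v 0 0 * w 0 0 + cross u v 0 1 * w 0 1 + cross u v 0 2%:R * w 0 2%:R.

Lemma cramer u v w x : triple u v w *: x =
  triple x v w *: u + triple u x w *: v + triple u v x *: w.
Proof.
by rewrite /triple /cross; apply: row3P; rewrite !(vec3E, mxE) /=; ring.
Qed.

Lemma triple_ex u v : cross u v != 0 -> exists w, triple u v w != 0.
Proof.
rewrite {1}/cross vec3_eq0 !negb_and /triple /cross !vec3E.
move=> /orP[nz|/orP[nz|nz]].
- by exists (vec3 1 0 0); rewrite !vec3E mulr1 !mulr0 !addr0.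
- by exists (vec3 0 1 0); rewrite !vec3E mulr1 !mulr0 addr0 add0r.
- by exists (vec3 0 0 1); rewrite !vec3E mulr1 !mulr0 !add0r.
Qed.

Lemma cross_lincomb0 u v (s t : K) : cross u v != 0 -> s *: u + t *: v = 0 ->
  s = 0 /\ t = 0.
Proof.
move=> nz h.
have e1 : s *: cross u v = 0.
  rewrite -crossZl; have /eqP := h; rewrite addr_eq0 => /eqP ->.
  rewrite -scaleNr crossZl crossvv scaler0 //.
have e2 : t *: cross u v = 0.
  rewrite cross_antisym scalerN -crossZl; have /eqP := h.
  rewrite addrC addr_eq0 => /eqP ->.
  by rewrite -scaleNr crossZl crossvv scaler0 oppr0.
by move/eqP: e1; move/eqP: e2; rewrite !scaler_eq0 (negPf nz) !orbF => /eqP -> /eqP ->.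
Qed.

Lemma cross_nz_sym u v : (cross u v != 0) = (cross v u != 0).
Proof. by rewrite cross_antisym oppr_eq0. Qed.

Lemma pnormalZ (c : K) v : c != 0 -> pnormal (c *: v) = pnormal v.
Proof.
move=> nz; rewrite /pnormal.
have -> : [pick i | (c *: v) 0 i != 0] = [pick i | v 0 i != 0].
  by apply: eq_pick => i; rewrite mxE mulf_eq0 (negPf nz).
case: pickP => // i nzi; rewrite mxE invfM scalerA; congr (_ *: _).
by rewrite mulrAC mulVf ?mul1r.
Qed.

Lemma pnormalE v : v != 0 -> exists2 c, c != 0 & pnormal v = c *: v.
Proof.
move=> nz; rewrite /pnormal; case: pickP => [i nzi|h].
  by exists (v 0 i)^-1; rewrite ?invr_eq0.
by case/negP: nz; apply/eqP/rowP => i; rewrite mxE; apply/eqP; rewrite -[_ == _]negbK h.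
Qed.

Lemma ptE v : v != 0 -> val (pt v) = pnormal v.
Proof.
move=> nz; have [c nzc e] := pnormalE nz.
rewrite /pt val_insubd ifT // e scaler_eq0 negb_or nzc nz /=.
by rewrite pnormalZ // e.
Qed.

Lemma val_pt v : v != 0 -> exists2 c, c != 0 & val (pt v) = c *: v.
Proof. by move=> nz; rewrite ptE //; apply: pnormalE. Qed.

Lemma ptZ (c : K) v : c != 0 -> pt (c *: v) = pt v.
Proof. by move=> nz; rewrite /pt pnormalZ. Qed.

Lemma ptN v : pt (- v) = pt v.
Proof. by rewrite -scaleN1r ptZ // oppr_eq0 oner_eq0. Qed.

Lemma pt_0 : pt (0 : 'rV[K]_3) = pt010 K.
Proof.
have e : pnormal (0 : 'rV[K]_3) = 0.
  by rewrite /pnormal; case: pickP => // i; rewrite mxE eqxx.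
by apply: val_inj; rewrite /pt val_insubd e eqxx.
Qed.

Lemma val_nz (P : P2 K) : val P != 0.
Proof. by case: P => v /= /andP[]. Qed.

Lemma valK_pt (P : P2 K) : pt (val P) = P.
Proof. by apply: val_inj; rewrite ptE ?val_nz //; case: P => v /= /andP[_ /eqP]. Qed.

Lemma pt_eqP u v : u != 0 -> v != 0 -> pt u = pt v -> exists2 c, c != 0 & u = c *: v.
Proof.
move=> nu nv /(congr1 val); have [c nc ->] := val_pt nu; have [d nd ->] := val_pt nv.
move=> h; exists (c^-1 * d); first by rewrite mulf_neq0 ?invr_eq0.
by rewrite -scalerA -h scalerA mulVf // scale1r.
Qed.

Lemma neq_cross (P Q : P2 K) : P != Q -> cross (val P) (val Q) != 0.
Proof.
apply: contraNneq => h; have [c e] := cross_eq0 (val_nz Q) h.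
rewrite -(valK_pt P) -(valK_pt Q) e ptZ //.
by apply: contraTneq (val_nz P) => c0; rewrite e c0 scale0r eqxx.
Qed.

(** * Projective transformations *)

Definition act M (P : P2 K) : P2 K := pt (val P *m M).

Lemma mulmx_nz M v : M \in unitmx -> v != 0 -> v *m M != 0.
Proof.
by move=> u; apply: contraNneq => h; rewrite -(mulmxK u v) h mul0mx.
Qed.

Lemma actE M P : act M P = pt (val P *m M).
Proof. by []. Qed.

Lemma act_pt M v : M \in unitmx -> v != 0 -> act M (pt v) = pt (v *m M).
Proof.
move=> u nz; rewrite /act; have [c nc ->] := val_pt nz.
by rewrite -scalemxAl ptZ.
Qed.

Lemma val_act M P : M \in unitmx -> exists2 c, c != 0 & val (act M P) = c *: (val P *m M).
Proof. by move=> u; apply: val_pt; rewrite mulmx_nz ?val_nz. Qed.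

Lemma actZ (c : K) (M N : 'M[K]_3) : c != 0 ->
  (forall v, v *m M = c *: (v *m N)) -> forall P, act M P = act N P.
Proof. by move=> nc h P; rewrite /act h ptZ. Qed.

Lemma act_mul M N P : M \in unitmx -> N \in unitmx -> act N (act M P) = act (M *m N) P.
Proof. by move=> uM uN; rewrite {2}/act act_pt ?mulmx_nz ?val_nz // /act mulmxA. Qed.

Lemma act1 P : act 1%:M P = P.
Proof. by rewrite /act mulmx1 valK_pt. Qed.

Lemma actK M : M \in unitmx -> cancel (act M) (act (invmx M)).
Proof. by move=> u P; rewrite act_mul ?unitmx_inv // mulmxV ?act1. Qed.

Lemma actKV M : M \in unitmx -> cancel (act (invmx M)) (act M).
Proof. by move=> u P; rewrite act_mul ?unitmx_inv // mulVmx ?act1. Qed.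

Lemma act_inj M : M \in unitmx -> injective (act M).
Proof. by move=> u; apply: can_inj (actK u). Qed.

End Vectors.

(** * Ternary cubic forms *)

Section Cubics.
Variable K : fieldType.
Implicit Types (p q : {mpoly K[3]}) (u v w : 'rV[K]_3) (c : nat -> K).

Definition ev p v : K := p.@[v 0].
(** The gradient of p at u, paired with v: as a function of v it is the
    tangent line at u, and as a function of u the polar conic of v. *)
Definition polar p u v : K := \sum_i (p^`M(i)).@[u 0] * v 0 i.

(** The exponents of the ten monomials of degree 3: the three cubes, then the
    two cyclic families of x^2 y and of x y^2, and x y z last. *)
Definition mon3 (i : nat) : seq nat :=
  nth [:: 1; 1; 1] [:: [:: 3; 0; 0]; [:: 0; 3; 0]; [:: 0; 0; 3];
      [:: 2; 1; 0]; [:: 0; 2; 1]; [:: 1; 0; 2];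
      [:: 1; 2; 0]; [:: 0; 1; 2]; [:: 2; 0; 1]]%N i.

Definition cubic_form c : {mpoly K[3]} :=
  \sum_(i < 10) c i *: 'X_[ [multinom nth 0%N (mon3 i) j | j < 3] ].

Definition cubic_val c x y z : K :=
  c 0%N * x ^+ 3 + c 1%N * y ^+ 3 + c 2 * z ^+ 3
  + c 3 * (x ^+ 2 * y) + c 4 * (y ^+ 2 * z) + c 5 * (z ^+ 2 * x)
  + c 6 * (x * y ^+ 2) + c 7 * (y * z ^+ 2) + c 8 * (z * x ^+ 2)
  + c 9 * (x * y * z).

Lemma cubic_formD c d : cubic_form c + cubic_form d = cubic_form (fun i => c i + d i).
Proof. by rewrite /cubic_form -big_split; apply: eq_bigr => i _; rewrite /= scalerDl. Qed.

Lemma cubic_form0 c : (forall i : 'I_10, c i = 0) -> cubic_form c = 0.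
Proof. by move=> h; apply: big1 => i _; rewrite h scale0r. Qed.

Lemma mnm_deg3 (m : 'X_{1..3}) : mdeg m = (m 0%R + m 1%R + m 2%:R%R)%N.
Proof. by rewrite mdegE sum3. Qed.

Lemma cubic_mono (a : K) (m : 'X_{1..3}) : mdeg m = 3%N ->
  exists c, a *: 'X_[m] = cubic_form c.
Proof.
rewrite mnm_deg3 => hm.
have key (i : 'I_10) : [/\ m 0%R = nth 0%N (mon3 i) 0, m 1%R = nth 0%N (mon3 i) 1
     & m 2%:R%R = nth 0%N (mon3 i) 2] -> exists c, a *: 'X_[m] = cubic_form c.
  case=> h0 h1 h2; exists (fun j => a *+ (j == i :> nat)); rewrite /cubic_form.
  rewrite (bigD1 i) //= eqxx mulr1n big1 ?addr0; last first.
    by move=> j /negPf ne; rewrite (_ : (j == i :> nat) = false) // mulr0n scale0r.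
  by congr (_ *: 'X_[_]); apply/mnmP; apply: ord3P; rewrite !mnmE.
have [i hi] : exists i : 'I_10, [/\ m 0%R = nth 0%N (mon3 i) 0, m 1%R = nth 0%N (mon3 i) 1
     & m 2%:R%R = nth 0%N (mon3 i) 2].
  move: (m 0) (m 1) (m 2%:R) hm => [|[|[|[|m0]]]] [|[|[|[|m1]]]] [|[|[|[|m2]]]] //= _.
  - by exists (inord 2); rewrite inordK.
  - by exists (inord 7); rewrite inordK.
  - by exists (inord 4); rewrite inordK.
  - by exists (inord 1); rewrite inordK.
  - by exists (inord 5); rewrite inordK.
  - by exists (inord 9); rewrite inordK.
  - by exists (inord 6); rewrite inordK.
  - by exists (inord 8); rewrite inordK.
  - by exists (inord 3); rewrite inordK.
  - by exists (inord 0); rewrite inordK.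
exact: key hi.
Qed.

(** Homogeneity of degree 3 leaves only ten coefficients, so that every later
    computation with a cubic becomes a polynomial identity for the ring
    tactic. *)
Lemma homog3E p : p \is 3.-homog -> exists c, p = cubic_form c.
Proof.
move=> hp; rewrite (mpolyE p).
elim/big_rec: _ => [|m q _ [c ->]].
  by exists (fun _ => 0); rewrite cubic_form0.
have [m3|/eqP m3] := eqVneq (mdeg m) 3%N.
  by have [d ->] := cubic_mono p@_m m3; rewrite cubic_formD; eexists.
by exists c; rewrite (dhomog_nemf_coeff hp) ?scale0r ?add0r //; apply/eqP.
Qed.

Lemma sum10 (V : nmodType) (F : nat -> V) : \sum_(i < 10) F i =
  F 0%N + F 1%N + F 2 + F 3 + F 4 + F 5 + F 6 + F 7 + F 8 + F 9.
Proof. by rewrite !big_ord_recr big_ord0 /= add0r. Qed.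

Lemma ev_cubic c v : ev (cubic_form c) v = cubic_val c (v 0 0) (v 0 1) (v 0 2%:R).
Proof.
rewrite /ev /cubic_form raddf_sum /=.
under eq_bigr => i _ do rewrite mevalZ mevalX.
under eq_bigr => i _ do under eq_bigr => j _ do rewrite mnmE.
rewrite (sum10 (fun i => c i * \prod_(j < 3) v 0 j ^+ nth 0%N (mon3 i) j)).
by rewrite !prod3 /= /cubic_val; ring.
Qed.

Lemma polar_cubic c u v :
  polar (cubic_form c) u v =
  let x := u 0 0 in let y := u 0 1 in let z := u 0 2%:R in
    (3%:R * c 0%N * x ^+ 2 + 2%:R * c 3 * x * y + c 5 * z ^+ 2 + c 6 * y ^+ 2
     + 2%:R * c 8 * z * x + c 9 * y * z) * v 0 0
  + (3%:R * c 1%N * y ^+ 2 + c 3 * x ^+ 2 + 2%:R * c 4 * y * z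
     + 2%:R * c 6 * x * y + c 7 * z ^+ 2 + c 9 * x * z) * v 0 1
  + (3%:R * c 2 * z ^+ 2 + c 4 * y ^+ 2 + 2%:R * c 5 * z * x
     + 2%:R * c 7 * y * z + c 8 * x ^+ 2 + c 9 * x * y) * v 0 2%:R.
Proof.
rewrite /polar /cubic_form.
have key k : ((\sum_(i < 10) c i *: 'X_[ [multinom nth 0%N (mon3 i) j | j < 3] ])^`M(k)).@[u 0]
  = \sum_(i < 10) c i * ((nth 0%N (mon3 i) k)%:R * (u 0 0 ^+ (nth 0%N (mon3 i) 0 - (k == 0)) *
     u 0 1 ^+ (nth 0%N (mon3 i) 1 - (k == 1)) * u 0 2%:R ^+ (nth 0%N (mon3 i) 2 - (k == 2%:R)))).
  rewrite (raddf_sum (mderiv k)) raddf_sum; apply: eq_bigr => i _ /=.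
  rewrite mderivZ mevalZ mderivX mevalZ mevalX prod3; congr (_ * _).
  by rewrite !(mnmBE, mnmE) //.
under eq_bigr => k _ do rewrite key (sum10 (fun i => c i * ((nth 0%N (mon3 i) k)%:R * (u 0 0 ^+
    (nth 0%N (mon3 i) 0 - (k == 0)) *
     u 0 1 ^+ (nth 0%N (mon3 i) 1 - (k == 1)) * u 0 2%:R ^+ (nth 0%N (mon3 i) 2 - (k == 2%:R)))))).
by rewrite sum3 /= !subn0 /= !subn1 /=; ring.
Qed.
End Cubics.

(** * Polarisation *)

Section Polar.
Variables (K : fieldType) (p : {mpoly K[3]}).
Hypothesis hom : p \is 3.-homog.
Implicit Types (u v w : 'rV[K]_3).

Lemma ev_lincomb (s t : K) u v : ev p (s *: u + t *: v) =
  s ^+ 3 * ev p u + s ^+ 2 * t * polar p u v + s * t ^+ 2 * polar p v u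
  + t ^+ 3 * ev p v.
Proof.
have [c ->] := homog3E hom.
by rewrite !ev_cubic !polar_cubic /= !mxE /cubic_val; ring.
Qed.

Lemma evZ (s : K) u : ev p (s *: u) = s ^+ 3 * ev p u.
Proof.
by rewrite -[s *: u]addr0 -(scale0r u) ev_lincomb; ring.
Qed.

Lemma polar_lincombr (s t : K) u v w :
  polar p u (s *: v + t *: w) = s * polar p u v + t * polar p u w.
Proof. by rewrite /polar !sum3 !mxE; ring. Qed.

Lemma polarZr (s : K) u v : polar p u (s *: v) = s * polar p u v.
Proof. by rewrite /polar !sum3 !mxE; ring. Qed.

Lemma polarZl (s : K) u v : polar p (s *: u) v = s ^+ 2 * polar p u v.
Proof.
have [c ->] := homog3E hom.
by rewrite !polar_cubic /= !mxE; ring.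
Qed.

Lemma polar_diag u : polar p u u = 3%:R * ev p u.
Proof.
have [c ->] := homog3E hom.
by rewrite ev_cubic polar_cubic /cubic_val /=; ring.
Qed.

Lemma polar_lincombl (s t : K) u v :
  polar p (s *: u + t *: v) v =
  s ^+ 2 * polar p u v + 2%:R * s * t * polar p v u + 3%:R * t ^+ 2 * ev p v.
Proof.
have [c ->] := homog3E hom.
by rewrite ev_cubic !polar_cubic /= !mxE /cubic_val; ring.
Qed.

Lemma polar_quad (s t : K) u v w :
  polar p (s *: u + t *: v) w = s ^+ 2 * polar p u w + t ^+ 2 * polar p v w
   + s * t * (polar p (u + v) w - polar p u w - polar p v w).
Proof.
have [c ->] := homog3E hom.
by rewrite !polar_cubic /= !mxE; ring.
Qed.

Lemma polar_neq0_partial u v : polar p u v != 0 ->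
  exists i, (p^`M(i)).@[u 0] != 0.
Proof.
move=> h; apply/existsP; rewrite -negb_forall; apply: contra h => /forallP z.
by rewrite /polar big1 // => i _; rewrite (eqP (z i)) mul0r.
Qed.

(** The polar is recovered from values of the form. Hence a matrix that
    multiplies the values by a constant multiplies the tangents by the same
    constant. *)
Lemma polar_ev u v :
  2%:R * polar p u v = ev p (u + v) - ev p (u - v) - 2%:R * ev p v.
Proof.
have -> : u + v = 1 *: u + 1 *: v by rewrite !scale1r.
have -> : u - v = 1 *: u + (-1) *: v by rewrite scale1r scaleN1r.
by rewrite !ev_lincomb; ring.
Qed.

End Polar.

(** * Third intersection points on a smooth cubic *)

Definition smooth_form (K : fieldType) (p : {mpoly K[3]}) :=
  forall v : 'rV[K]_3, v != 0 -> ev p v = 0 -> exists i, (p^`M(i)).@[v 0] != 0.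

Section Third.
Variables (K : numClosedFieldType) (C : pcubic K).
Hypothesis hom : form C \is 3.-homog.
Hypothesis sm : smooth_form (form C).
Implicit Types (u v w : 'rV[K]_3) (P Q R : P2 K).
Local Notation G := (ev (form C)).
Local Notation D := (polar (form C)).

Lemma on_curveE P : on_curve C P = (G (val P) == 0). Proof. by []. Qed.

Lemma tangentE P v : tangent C P v = D (val P) v. Proof. by []. Qed.

Lemma on_curve_pt v : v != 0 -> on_curve C (pt v) = (G v == 0).
Proof.
move=> nz; rewrite on_curveE; have [c nc ->] := val_pt nz.
by rewrite evZ // mulf_eq0 expf_eq0 (negPf nc).
Qed.

Lemma polar_neq0 v : v != 0 -> G v = 0 -> exists w, D v w != 0.
Proof.
move=> nz h; have [i hi] := sm nz h; exists (delta_mx 0 i).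
rewrite /polar (bigD1 i) //= big1 ?addr0 ?mxE ?eqxx ?mulr1 // => j ne.
by rewrite mxE (negPf ne) mulr0.
Qed.

(** A smooth cubic contains no line. On the line through u and v, pairing the
    gradient with a third independent direction w gives a binary quadratic
    form, which has a zero; the gradient vanishes there, as it kills u and v
    along the line. *)
Lemma no_line u v : cross u v != 0 -> G u = 0 -> G v = 0 ->
  D u v = 0 -> D v u = 0 -> False.
Proof.
move=> ind gu gv duv dvu; have [w nzt] := triple_ex ind.
(* A zero of the binary quadratic form a s^2 + b s t + d t^2. *)
have [s [t [nst hst]]] : exists s t, (s != 0) || (t != 0) /\ D (s *: u + t *: v) w = 0.
  have [a0|a0] := eqVneq (D u w) 0.
    by exists 1, 0; rewrite oner_neq0 scale1r scale0r addr0.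
  set a := D u w in a0; set d := D v w; set b := D (u + v) w - a - d.
  exists ((- b + sqrtC (b ^+ 2 - 4%:R * a * d)) / (2%:R * a)), 1.
  rewrite oner_neq0 orbT polar_quad // -/a -/d -/b; split=> //.
  set r := sqrtC _; have hr : r ^+ 2 = b ^+ 2 - 4%:R * a * d by rewrite sqrtCK.
  have -> : ((- b + r) / (2 * a)) ^+ 2 * a + 1 ^+ 2 * d + (- b + r) / (2 * a) * 1 * b
     = (r ^+ 2 - (b ^+ 2 - 4%:R * a * d)) / (4%:R * a) by field.
  by rewrite hr subrr mul0r.
set x := s *: u + t *: v in hst.
have nx : x != 0.
  apply/eqP => /(cross_lincomb0 ind) [s0 t0].
  by move: nst; rewrite s0 t0 eqxx.
have gx : G x = 0 by rewrite ev_lincomb // gu gv duv dvu; ring.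
have [y] := polar_neq0 nx gx; case/negP; apply/eqP.
have xv : D x v = 0 by rewrite polar_lincombl // gv duv dvu; ring.
have xu : D x u = 0 by rewrite /x addrC polar_lincombl // gu duv dvu; ring.
apply: (mulfI nzt); rewrite mulr0 -polarZr cramer -[X in D x (X + _)]scale1r.
by rewrite !polar_lincombr xu xv hst; ring.
Qed.

(** The point is well defined: if both coefficients vanished, the form would
    vanish on the whole line. *)
Lemma third_neq P Q : on_curve C P -> on_curve C Q -> P != Q ->
  let w := D (val Q) (val P) *: val P - D (val P) (val Q) *: val Q in
  w != 0 /\ third C P Q = pt w.
Proof.
rewrite !on_curveE => /eqP gP /eqP gQ ne w; split; last by rewrite /third ne.
apply/eqP; rewrite /w -scaleNr => /(cross_lincomb0 (neq_cross ne)) [h1 /eqP].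
by rewrite oppr_eq0 => /eqP h2; apply: (no_line (neq_cross ne)).
Qed.

Lemma tangent_vecP P : on_curve C P ->
  cross (tangent_vec C P) (val P) != 0 /\ D (val P) (tangent_vec C P) = 0.
Proof.
rewrite on_curveE => /eqP gP; rewrite /tangent_vec.
set g := \row_j _.
have gE i : g 0 i = ((form C)^`M(i)).@[val P 0] by rewrite mxE.
have gP0 : g 0 0 * val P 0 0 + g 0 1 * val P 0 1 + g 0 2%:R * val P 0 2%:R = 0.
  by rewrite !gE -(sum3 (fun i => ((form C)^`M(i)).@[val P 0] * val P 0 i)) -/(D _ _) polar_diag // gP mulr0.
case: pickP => [i ni|h].
  split=> //; rewrite /polar sum3 -!gE /cross !vec3E; ring.
have [i ni] := sm (val_nz P) gP.
have [j nj] := row_neq0P (val_nz P).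
have e : cross (cross g (delta_mx 0 j)) (val P) = - val P 0 j *: g.
  apply: (@eq_trans _ _ ((g 0 0 * val P 0 0 + g 0 1 * val P 0 1 + g 0 2%:R * val P 0 2%:R) *:
      delta_mx 0 j - val P 0 j *: g)); last by rewrite gP0 scale0r add0r scaleNr.
  move: (val P) g {h nj gP0 gE gP ni} => x g; move: j; apply: ord3P;
  by rewrite /cross; apply: row3P; rewrite !(vec3E, mxE) /=; ring.
have /negbFE := h j; rewrite e scaler_eq0 oppr_eq0 (negPf nj) /=.
by move=> /eqP g0; case/negP: ni; rewrite -gE g0 mxE.
Qed.

(** The tangent line is a line and not the plane, since the gradient is
    nonzero. *)
Lemma tangent_span P T T' : on_curve C P -> cross T (val P) != 0 ->
  D (val P) T = 0 -> D (val P) T' = 0 -> exists a b, T' = a *: T + b *: val P.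
Proof.
rewrite on_curveE => /eqP gP ind hT hT'.
have [w nzt] := triple_ex ind.
have PP : D (val P) (val P) = 0 by rewrite polar_diag // gP mulr0.
have [y hy] := polar_neq0 (val_nz P) gP.
set x := val P in ind nzt hT hT' gP PP hy *.
have nw : D x w != 0.
  apply: contra hy => /eqP hw; apply/eqP; apply: (mulfI nzt); rewrite mulr0 -polarZr cramer.
  by rewrite -[X in D x (X + _)]scale1r !polar_lincombr hT PP hw; ring.
have t0 : triple T x T' = 0.
  apply: (mulIf nw); rewrite mul0r.
  have: D x (triple T x w *: T') = 0 by rewrite polarZr hT' mulr0.
  by rewrite cramer -[X in D x (X + _)]scale1r !polar_lincombr hT PP => <-; ring.
exists (triple T' x w / triple T x w), (triple T T' w / triple T x w).
apply: (scalerI nzt); rewrite cramer t0 scale0r addr0 scalerDr !scalerA.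
by rewrite ![_ * (_ / _)]mulrC !mulfVK.
Qed.

(** Any tangent direction computes the third point of the tangent: replacing T
    by a T + b P multiplies the defining expression by a^3. *)
Lemma third_tan P T : on_curve C P -> cross T (val P) != 0 -> D (val P) T = 0 ->
  let w := G T *: val P - D T (val P) *: T in
  w != 0 /\ third C P P = pt w.
Proof.
move=> oP ind hT w; have [ind0 hT0] := tangent_vecP oP.
have [a [b e]] := tangent_span oP ind hT hT0.
have gP : G (val P) = 0 by apply/eqP; rewrite -on_curveE.
have na : a != 0.
  apply: contraNneq ind0 => a0.
  by rewrite e a0 scale0r add0r crossZl crossvv scaler0.
have nw : w != 0.
  apply/eqP; rewrite /w addrC -scaleNr => /(cross_lincomb0 ind) [/eqP h1 h2].
  rewrite oppr_eq0 in h1; move/eqP: h1 => h1.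
  exact: (no_line ind).
split=> //; rewrite /third eqxx /=.
rewrite -/(G _) -/(D _ _).
have -> : G (tangent_vec C P) *: val P - D (tangent_vec C P) (val P) *: tangent_vec C P
   = a ^+ 3 *: w.
  rewrite e ev_lincomb // polar_lincombl // gP hT /w.
  by apply/rowP => i; rewrite !mxE; ring.
by rewrite ptZ // expf_neq0.
Qed.

Lemma pt_colin (a : K) P w : w != 0 -> w = a *: val P -> pt w = P.
Proof.
move=> nw e; have na : a != 0 by apply: contraNneq nw => a0; rewrite e a0 scale0r.
by rewrite e ptZ // valK_pt.
Qed.

(** D (T, P) is the coefficient of s u^2 in the restriction G (s P + u T) of
    the form to the tangent line, and P is a flex when only the term in u^3 is
    left. *)
Lemma flex_of_polar P T : on_curve C P -> cross T (val P) != 0 ->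
  D (val P) T = 0 -> D T (val P) = 0 -> third C P P = P.
Proof.
move=> oP ind h1 h2; have [nw ->] := third_tan oP ind h1.
by move: nw; rewrite h2 scale0r subr0 => nw; exact: (pt_colin nw (erefl _)).
Qed.

Lemma polar_of_flex P T : on_curve C P -> cross T (val P) != 0 ->
  D (val P) T = 0 -> third C P P = P -> D T (val P) = 0.
Proof.
move=> oP ind hT hP; have [nw e] := third_tan oP ind hT.
have [d nd dE] := val_pt nw; rewrite -e hP in dE.
have h : (1 - d * G T) *: val P + (d * D T (val P)) *: T = 0.
  rewrite scalerBl scale1r -!scalerA [X in X - _ + _]dE scalerBr.
  set p := d *: _; set q := d *: _.
  by rewrite [q - p - q]addrAC subrr add0r addNr.
rewrite cross_nz_sym in ind; have [_ /eqP] := cross_lincomb0 ind h.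
by rewrite mulf_eq0 (negPf nd) => /eqP.
Qed.

Lemma third_on P Q : on_curve C P -> on_curve C Q -> on_curve C (third C P Q).
Proof.
move=> oP oQ; have [e|ne] := eqVneq P Q; last first.
  have [nw ->] := third_neq oP oQ ne; rewrite on_curve_pt //.
  move: oP oQ; rewrite !on_curveE => /eqP gP /eqP gQ.
  by rewrite -scaleNr ev_lincomb // gP gQ; apply/eqP; ring.
rewrite -e; have [ind hT] := tangent_vecP oP.
have [nw ->] := third_tan oP ind hT; rewrite on_curve_pt //.
move: oP; rewrite !on_curveE => /eqP gP.
by rewrite -scaleNr ev_lincomb // gP hT; apply/eqP; ring.
Qed.

Lemma thirdC P Q : third C P Q = third C Q P.
Proof.
rewrite /third eq_sym; case: eqVneq => [-> //|ne].
set a := _ *: _; set b := _ *: _.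
by rewrite /= -(opprB b a); apply: (ptN (b - a)).
Qed.

(** The third point R of the line PQ is a combination of P and Q, so expanding
    the polars along this line turns the expression for the third point of PR
    into a multiple of Q. The tangencies Q = P, R = P and R = Q are treated by
    the same expansion. *)
Lemma third_invol P Q : on_curve C P -> on_curve C Q -> third C P (third C P Q) = Q.
Proof.
move=> oP oQ; have [<-|ne] := eqVneq P Q.
  have [ind hT] := tangent_vecP oP.
  have [nw e1] := third_tan oP ind hT; have oR := third_on oP oP.
  have [e|ne] := eqVneq P (third C P P); first by rewrite -e -e.
  have [nw2 ->] := third_neq oP oR ne; apply: (pt_colin nw2 (a := D (val (third C P P)) (val P))).
  have [c nc] := val_pt nw; rewrite -e1 => cE.
  suff -> : D (val P) (val (third C P P)) = 0 by rewrite scale0r subr0.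
  rewrite cE polarZr -scaleNr polar_lincombr hT polar_diag //.
  by rewrite (eqP oP : G _ = 0) !(mulr0, addr0).
have [nw e1] := third_neq oP oQ ne; have oR := third_on oP oQ.
have gP : G (val P) = 0 by apply/eqP.
have gQ : G (val Q) = 0 by apply/eqP.
have [c nc cE] := val_pt nw.
have [e|ne2] := eqVneq P (third C P Q).
  rewrite -e; have hQ : D (val P) (val Q) = 0.
    apply/eqP; apply/negPn/negP => nz; have := val_pt nw; rewrite -e1 -e => -[d nd dE].
    have : (1 - d * D (val Q) (val P)) *: val P + (d * D (val P) (val Q)) *: val Q = 0.
      rewrite scalerBl scale1r -!scalerA [X in X - _ + _]dE scalerBr.
      set x := d *: _; set y := d *: _.
      by rewrite [y - x - y]addrAC subrr add0r addNr.
    by move/(cross_lincomb0 (neq_cross ne)) => [_ /eqP]; rewrite mulf_eq0 (negPf nd) (negPf nz).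
  have ind : cross (val Q) (val P) != 0 by apply: neq_cross; rewrite eq_sym.
  have [nw3 ->] := third_tan oP ind hQ; apply: (pt_colin nw3 (a := - D (val Q) (val P))).
  by rewrite gQ scale0r add0r scaleNr.
have [nw2 ->] := third_neq oP oR ne2.
apply: (pt_colin nw2 (a := - c ^+ 2 * D (val P) (val Q) ^+ 3)).
move: cE; rewrite -e1 => ->; rewrite -scaleNr.
rewrite polarZl // polarZr [X in polar _ X (val P)]addrC polar_lincombl // polar_lincombr polar_diag // gP.
by apply/rowP => i; rewrite !mxE; ring.
Qed.

End Third.

(** * Torsion of order three and flexes *)

Lemma torsion3E (K : fieldType) (C : pcubic K) P :
  P \in torsion3 C <-> on_curve C P /\ addp C (addp C P P) P = orig C.
Proof. by split=> [/andP[-> /eqP]|[h /eqP h2]] //; apply/andP. Qed.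

Lemma addpE (K : fieldType) (C : pcubic K) P Q :
  addp C P Q = third C (orig C) (third C P Q).
Proof. by []. Qed.

Lemma opppE (K : fieldType) (C : pcubic K) P :
  oppp C P = third C P (third C (orig C) (orig C)).
Proof. by []. Qed.

Lemma fTE (K : fieldType) (C : pcubic K) T X :
  fT C T X = tangent C T (val X) / tangent C (orig C) (val X).
Proof. by []. Qed.

(* Keeps conversion from unfolding these into the choice of a normalised
   representative. *)
Local Opaque third act addp oppp pt tangent fT.

Section ChordTangent.
Variables (T : Type) (on : T -> bool) (th : T -> T -> T) (O : T).
Hypothesis thC : forall P Q, th P Q = th Q P.
Hypothesis th_on : forall P Q, on P -> on Q -> on (th P Q).
Hypothesis thK : forall P Q, on P -> on Q -> th P (th P Q) = Q.
Hypothesis onO : on O.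
Hypothesis flexO : th O O = O.

(** As O is a flex, th O X = O forces X = O. So 3 P = O says that O is on the
    line through 2 P and P, that is, 2 P = - P, where - P = th P O and 2 P =
    th O (th P P); cancelling th O leaves th P P = P. *)
Lemma chord_tangent_order3 P : on P ->
  th O (th (th O (th P P)) P) = O <-> th P P = P.
Proof.
move=> oP; have oPP := th_on oP oP; have oA := th_on onO oPP.
split=> h; last by rewrite h (thC _ P) (thC O P) thK.
have h3 : th (th O (th P P)) P = O.
  by rewrite -[LHS](thK onO) ?th_on // h flexO.
have hA : th O (th P P) = th P O by rewrite -[LHS](thK oP) // (thC P (th O _)) h3.
by rewrite -[LHS](thK onO) // hA (thC P) thK.
Qed.
End ChordTangent.

Section Flex.
Variables (K : numClosedFieldType) (C : pcubic K).
Hypothesis hom : form C \is 3.-homog.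
Hypothesis sm : smooth_form (form C).
Hypothesis onO : on_curve C (orig C).
Hypothesis flexO : third C (orig C) (orig C) = orig C.

Lemma torsion3_flexP P : P \in torsion3 C <-> on_curve C P /\ third C P P = P.
Proof.
have key := chord_tangent_order3 (@thirdC _ C) (@third_on _ _ hom sm)
  (@third_invol _ _ hom sm) onO flexO.
by split=> [/torsion3E|] [oP h]; [|apply/torsion3E];
  split; [exact: oP | exact/(key _ oP) | exact: oP | exact/(key _ oP)].
Qed.
End Flex.

(** * The Weil pairing and projective transformations *)

Lemma divf_scale (K : fieldType) (k a b : K) : k != 0 -> k * a / (k * b) = a / b.
Proof. by move=> nk; rewrite -mulf_div divff ?mul1r. Qed.

(** The pairing is a quotient of quotients of f_S and f_T, so constant factors
    of these functions disappear. *)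
Lemma quot_scale (K : fieldType) (k l a b c d a' b' c' d' : K) :
  k != 0 -> l != 0 -> a' = k * a -> b' = k * b -> c' = l * c -> d' = l * d ->
  a' / b' / (c' / d') = a / b / (c / d).
Proof. by move=> nk nl -> -> -> ->; rewrite !divf_scale. Qed.

Section Weil.
Variables (K : fieldType) (C : pcubic K).

Definition weil_expr S T R : K :=
  (fT C S (addp C T R) / fT C S R) / (fT C T (addp C S (oppp C R)) / fT C T (oppp C R)).

(** The definition of weil3 evaluates at an admissible point picked by
    epsilon, about which nothing else is known; its value can be computed only
    when all admissible points give the same one. *)
Definition weil_const S T z :=
  (exists R, weil_admissible C S T R) /\
  (forall R, weil_admissible C S T R -> weil_expr S T R = z).

Lemma weil_constE S T z : weil_const S T z -> weil3 C S T = z.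
Proof.
by case=> ex h; apply: h; apply: (epsilon_spec (inhabits (orig C)) _ ex).
Qed.
End Weil.

Section Transport.
Variables (K : numClosedFieldType) (C C' : pcubic K) (M : 'M[K]_3) (c : K).
Hypothesis hom : form C \is 3.-homog.
Hypothesis hom' : form C' \is 3.-homog.
Hypothesis sm : smooth_form (form C).
Hypothesis uM : M \in unitmx.
Hypothesis nc : c != 0.
Hypothesis evM : forall v, ev (form C') (v *m M) = c * ev (form C) v.
Implicit Types (P Q R S T : P2 K).

Lemma polar_transport u v : polar (form C') (u *m M) (v *m M) = c * polar (form C) u v.
Proof.
have n2 : (2%:R : K) != 0 by rewrite pnatr_eq0.
apply: (mulfI n2); rewrite [RHS]mulrCA !polar_ev // -mulmxDl -mulmxBl !evM.
by ring.
Qed.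

Lemma smooth_transport : smooth_form (form C').
Proof.
move=> v nz gv; have nu : v *m invmx M != 0 by rewrite mulmx_nz ?unitmx_inv.
have gu : ev (form C) (v *m invmx M) = 0.
  by apply: (mulfI nc); rewrite -evM mulmxKV // gv mulr0.
have [w nw] := polar_neq0 sm nu gu.
apply: (@polar_neq0_partial _ _ v (w *m M)).
by rewrite -(mulmxKV uM v) polar_transport mulf_neq0.
Qed.

Let sm' := smooth_transport.

Lemma on_curve_transport P : on_curve C' (act M P) = on_curve C P.
Proof.
rewrite [LHS]on_curve_pt ?mulmx_nz ?val_nz //.
by rewrite evM mulf_eq0 (negPf nc).
Qed.

Lemma cross_mulmx u v : cross u v != 0 -> v != 0 -> cross (u *m M) (v *m M) != 0.
Proof.
move=> ind nv; apply/eqP => h.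
have [k e] := cross_eq0 (mulmx_nz uM nv) h; case/negP: ind.
by rewrite -(mulmxK uM u) e -scalemxAl mulmxK // crossZl crossvv scaler0.
Qed.

Lemma third_transport P Q : on_curve C P -> on_curve C Q ->
  third C' (act M P) (act M Q) = act M (third C P Q).
Proof.
move=> oP oQ; have [a na aE] := val_act P uM; have [b nb bE] := val_act Q uM.
have oP' : on_curve C' (act M P) by rewrite on_curve_transport.
have oQ' : on_curve C' (act M Q) by rewrite on_curve_transport.
have [e|ne] := eqVneq P Q; last first.
  have ne' : act M P != act M Q by rewrite (inj_eq (act_inj uM)).
  have [nw ->] := third_neq hom sm oP oQ ne.
  have [nw' ->] := third_neq hom' sm' oP' oQ' ne'.
  rewrite act_pt // aE bE !polarZl // !polarZr !polar_transport.
  rewrite mulmxBl -!scalemxAl.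
  set x := polar _ _ _; set y := polar _ _ _; set p := val P *m M; set q := val Q *m M.
  have -> : (b ^+ 2 * (a * (c * x))) *: (a *: p) - (a ^+ 2 * (b * (c * y))) *: (b *: q)
    = (a ^+ 2 * b ^+ 2 * c) *: (x *: p - y *: q).
    by apply/rowP => i; rewrite !mxE; ring.
  by rewrite ptZ // !mulf_neq0 ?expf_neq0.
rewrite -e; have [ind hT] := tangent_vecP hom sm oP.
have [nw ->] := third_tan hom sm oP ind hT.
set T := tangent_vec C P in ind hT nw *.
have ind' : cross (T *m M) (val (act M P)) != 0.
  rewrite aE cross_antisym oppr_eq0 crossZl scaler_eq0 negb_or na /=.
  by rewrite -cross_nz_sym cross_mulmx ?val_nz.
have hT' : polar (form C') (val (act M P)) (T *m M) = 0.
  by rewrite aE polarZl // polar_transport hT !mulr0.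
have [nw' ->] := third_tan hom' sm' oP' ind' hT'.
rewrite act_pt // aE polarZr polar_transport evM mulmxBl -!scalemxAl.
set x := ev _ _; set y := polar _ _ _; set p := val P *m M; set q := T *m M.
have -> : (c * x) *: (a *: p) - (a * (c * y)) *: q = (a * c) *: (x *: p - y *: q).
  by apply/rowP => i; rewrite !mxE; ring.
by rewrite ptZ // mulf_neq0.
Qed.

Hypothesis onO : on_curve C (orig C).
Hypothesis origM : orig C' = act M (orig C).

Lemma addp_on P Q : on_curve C P -> on_curve C Q -> on_curve C (addp C P Q).
Proof. by move=> oP oQ; rewrite addpE !third_on. Qed.

Lemma oppp_on P : on_curve C P -> on_curve C (oppp C P).
Proof. by move=> oP; rewrite opppE !third_on. Qed.

Lemma addp_transport P Q : on_curve C P -> on_curve C Q ->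
  addp C' (act M P) (act M Q) = act M (addp C P Q).
Proof. by move=> oP oQ; rewrite !addpE origM !third_transport // third_on. Qed.

Lemma oppp_transport P : on_curve C P -> oppp C' (act M P) = act M (oppp C P).
Proof. by move=> oP; rewrite !opppE origM !third_transport // third_on. Qed.

Lemma torsion3_transport P : (act M P \in torsion3 C') <-> (P \in torsion3 C).
Proof.
have key : on_curve C P -> addp C' (addp C' (act M P) (act M P)) (act M P)
    = act M (addp C (addp C P P) P).
  by move=> oP; rewrite (addp_transport oP oP) (addp_transport (addp_on oP oP) oP).
split=> /torsion3E [oP h]; apply/torsion3E.
  have oP' : on_curve C P by rewrite -on_curve_transport.
  by split=> //; apply: (act_inj uM); rewrite -(key oP') h.
by split; [rewrite on_curve_transport | rewrite (key oP) h].
Qed.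

(** Normalising the image of X costs a factor x that is common to both
    tangents; the remaining factor k depends on T only. *)
Lemma tangent_transport T : exists2 k, k != 0 &
  forall X, exists2 x, x != 0 & tangent C' (act M T) (val (act M X)) = x * k * tangent C T (val X)
    /\ tangent C' (orig C') (val (act M X)) = x * tangent C (orig C) (val X).
Proof.
have [a na aE] := val_act T uM; have [o no oE] := val_act (orig C) uM.
exists (a ^+ 2 / o ^+ 2); first by rewrite mulf_neq0 ?invr_eq0 ?expf_neq0.
move=> X; have [x nx xE] := val_act X uM.
exists (x * c * o ^+ 2); first by rewrite !mulf_neq0 ?expf_neq0.
rewrite origM !tangentE aE xE oE !polarZl // !polarZr !polar_transport.
by split; [field | ring].
Qed.

Lemma fT_transport T : exists2 k, k != 0 & forall X, fT C' (act M T) (act M X) = k * fT C T X.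
Proof.
have [k nk h] := tangent_transport T; exists k => // X.
by have [x nx [e1 e2]] := h X; rewrite !fTE e1 e2 -(mulrA x k) divf_scale // mulrA.
Qed.

Lemma tangent_neq0_transport T X :
  (tangent C' (act M T) (val (act M X)) != 0) = (tangent C T (val X) != 0) /\
  (tangent C' (orig C') (val (act M X)) != 0) = (tangent C (orig C) (val X) != 0).
Proof.
have [k nk h] := tangent_transport T; have [x nx [e1 e2]] := h X.
by rewrite e1 e2 !mulf_eq0 (negPf nx) (negPf nk).
Qed.

Lemma weil_admissible_transport S T R : on_curve C S -> on_curve C T ->
  weil_admissible C' (act M S) (act M T) (act M R) = weil_admissible C S T R.
Proof.
move=> oS oT; rewrite /weil_admissible on_curve_transport.
apply: andb_id2l => oR; cbn [all].
rewrite oppp_transport // !addp_transport ?oppp_on //.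
have e U X := (tangent_neq0_transport U X).1.
have e0 X := (tangent_neq0_transport S X).2.
by congr [&& [&& _ && _, _ && _ & true], _ && _, _ && _ & true];
  [exact: (e S (addp C T R)) | exact: (e0 (addp C T R)) | exact: (e S R) | exact: (e0 R)
  | exact: (e T (addp C S (oppp C R))) | exact: (e0 (addp C S (oppp C R)))
  | exact: (e T (oppp C R)) | exact: (e0 (oppp C R))].
Qed.

(** Projective transformations preserve tangents up to constants, which cancel
    in the pairing, and they permute the admissible points. *)
Lemma weil_const_transport S T z : on_curve C S -> on_curve C T ->
  weil_const C S T z -> weil_const C' (act M S) (act M T) z.
Proof.
move=> oS oT [[R aR] h]; split.
  by exists (act M R); rewrite weil_admissible_transport.
move=> R'; rewrite -(actKV uM R'); set Q := act _ R'.
rewrite weil_admissible_transport // => aQ; rewrite -(h _ aQ).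
have /and3P[oQ _ _] := aQ.
have [kS nkS eS] := fT_transport S; have [kT nkT eT] := fT_transport T.
rewrite /weil_expr oppp_transport // !addp_transport ?oppp_on //.
exact: (quot_scale nkS nkT (eS (addp C T Q)) (eS Q) (eT (addp C S (oppp C Q))) (eT (oppp C Q))).
Qed.

End Transport.

(** * The Heisenberg group and the nine base points *)

Lemma cubic_form_homog (K : fieldType) (c : nat -> K) : cubic_form c \is 3.-homog.
Proof.
rewrite /cubic_form; apply: rpred_sum => i _; apply: rpredZ.
rewrite dhomogX; apply/eqP; apply: etrans (mnm_deg3 _) _; rewrite !mnmE /=.
by case: i => [[|[|[|[|[|[|[|[|[|[|//]]]]]]]]]]].
Qed.

Section Heisenberg.
Variables (K : fieldType) (w : K).
Hypothesis hw : w ^+ 2 + w + 1 = 0.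
Implicit Types (i j k l : 'I_3) (s t : 'I_3 * 'I_3) (u v : 'rV[K]_3).

Lemma w3 : w ^+ 3 = 1.
Proof.
apply/eqP; rewrite -subr_eq0; apply/eqP.
by transitivity ((w - 1) * (w ^+ 2 + w + 1)); [ring | rewrite hw mulr0].
Qed.

Definition wpow i : K := w ^+ i.

Lemma wpowD i j : wpow (i + j) = wpow i * wpow j.
Proof. by rewrite /wpow /= -exprD expr_mod // w3. Qed.

Lemma wpow0 : wpow 0 = 1. Proof. by []. Qed.

Lemma wpow3 i : wpow i ^+ 3 = 1.
Proof. by rewrite /wpow -exprM mulnC exprM w3 expr1n. Qed.

Lemma wpow_neq0 i : wpow i != 0.
Proof. by apply: contraTneq (oner_neq0 K) => h; rewrite -(wpow3 i) h expr0n eqxx. Qed.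

(** The Heisenberg group: (i, j) acts by shifting the coordinates cyclically
    by i and multiplying the k-th one by w^(jk). Indices are in Z/3, which is
    where w^3 = 1 is used. *)
Definition transl s : 'M[K]_3 := \matrix_(l, k) (wpow (s.2 * k) *+ (l == k - s.1)).

(** Exchanges the last two coordinates: k -> - k on indices modulo 3. *)
Definition negm : 'M[K]_3 := \matrix_(l, k) (l == - k)%:R.

Lemma translE v s k : (v *m transl s) 0 k = wpow (s.2 * k) * v 0 (k - s.1).
Proof.
rewrite mxE (bigD1 (k - s.1)) //= mxE eqxx mulr1n mulrC big1 ?addr0 // => l ne.
by rewrite mxE (negPf ne) mulr0n mulr0.
Qed.

Lemma negmE v k : (v *m negm) 0 k = v 0 (- k).
Proof.
rewrite mxE (bigD1 (- k)) //= mxE eqxx mulr1 big1 ?addr0 // => l ne.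
by rewrite mxE (negPf ne) mulr0.
Qed.

(** The group is a central extension of F_3^2: the matrices multiply up to a
    cube root of unity, so that the projective transformations commute. *)
Lemma translM v s t :
  v *m transl s *m transl t = wpow (- (s.2 * t.1)) *: (v *m transl (s + t)).
Proof.
apply/rowP => k; rewrite [RHS]mxE !translE !mulrA -!wpowD; congr (wpow _ * v 0 _).
  by rewrite /=; ring.
by rewrite /=; ring.
Qed.

Lemma transl0 v : v *m transl 0 = v.
Proof. by apply/rowP => k; rewrite translE /= mul0r wpow0 mul1r subr0. Qed.

Lemma mulmx_ext (M N : 'M[K]_3) : (forall v, v *m M = v *m N) -> M = N.
Proof. by move=> h; apply/row_matrixP => i; rewrite !rowE h. Qed.

Lemma transl_unit s : transl s \in unitmx.
Proof.
have h : transl s *m (wpow (- (s.2 * s.1)) *: transl (- s)) = 1%:M.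
  apply: mulmx_ext => v; rewrite mulmxA -scalemxAr translM subrr transl0 mulmx1 /=.
  by rewrite scalerA -wpowD mulrN opprK addNr wpow0 scale1r.
by have [] := mulmx1_unit h.
Qed.

Lemma negmK v : v *m negm *m negm = v.
Proof. by apply/rowP => k; rewrite !negmE opprK. Qed.

Lemma negm_unit : negm \in unitmx.
Proof.
have h : negm *m negm = 1%:M by apply: mulmx_ext => v; rewrite mulmxA negmK mulmx1.
by have [] := mulmx1_unit h.
Qed.

Lemma transl_negm v s : v *m transl s *m negm = v *m negm *m transl (- s).
Proof.
apply/rowP => k; rewrite negmE !translE negmE /=; congr (wpow _ * v 0 _); ring.
Qed.

Lemma act_translM s t P : act (transl t) (act (transl s) P) = act (transl (s + t)) P.
Proof.
rewrite act_mul ?transl_unit //.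
by apply: (actZ (wpow_neq0 (- (s.2 * t.1)))) => v; rewrite mulmxA translM.
Qed.

Lemma act_transl0 P : act (transl 0) P = P.
Proof.
have -> : transl 0 = 1%:M by apply: mulmx_ext => v; rewrite transl0 mulmx1.
exact: act1.
Qed.

Lemma act_negmK P : act negm (act negm P) = P.
Proof.
rewrite act_mul ?negm_unit //.
have -> : negm *m negm = 1%:M by apply: mulmx_ext => v; rewrite mulmxA negmK mulmx1.
exact: act1.
Qed.

Lemma act_transl_negm s P :
  act negm (act (transl s) P) = act (transl (- s)) (act negm P).
Proof.
rewrite !act_mul ?negm_unit ?transl_unit //; congr (act _ P).
by apply: mulmx_ext => v; rewrite !mulmxA transl_negm.
Qed.

Definition vorig : 'rV[K]_3 := vec3 0 1 (-1).

Lemma vorig_neq0 : vorig != 0.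
Proof. by rewrite /vorig vec3_eq0 oner_eq0 andbF. Qed.

Definition tor s : P2 K := pt (vorig *m transl s).

Lemma vtor_neq0 s : vorig *m transl s != 0.
Proof. by rewrite mulmx_nz ?transl_unit ?vorig_neq0. Qed.

Lemma torE s : tor s = act (transl s) (pt vorig).
Proof. by rewrite act_pt ?transl_unit ?vorig_neq0. Qed.

Lemma act_tor s t : act (transl t) (tor s) = tor (s + t).
Proof. by rewrite !torE act_translM. Qed.

Lemma act_negm_orig : act negm (pt vorig) = pt vorig.
Proof.
rewrite act_pt ?negm_unit ?vorig_neq0 //.
have -> : vorig *m negm = - vorig.
  apply: row3P; rewrite negmE !mxE /= ?oppr0 ?opprK //.
by rewrite ptN.
Qed.

Lemma act_negm_tor s : act negm (tor s) = tor (- s).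
Proof. by rewrite !torE act_transl_negm act_negm_orig. Qed.

Lemma tor0 : tor 0 = pt vorig.
Proof. by rewrite torE act_transl0. Qed.

Lemma ord3_addrr (i : 'I_3) : - (i + i) = i.
Proof. by apply/eqP; move: i; apply: ord3P. Qed.

Lemma pair3_addrr s : - (s + s) = s.
Proof. by case: s => i j; congr pair; apply: ord3_addrr. Qed.

Lemma vorigE k : vorig 0 k = (k == 1)%:R - (k == 2%:R)%:R.
Proof. by move: k; apply: ord3P; rewrite !mxE /= ?subr0 ?sub0r ?subrr. Qed.

Lemma vtorE s : [/\ (vorig *m transl s) 0 s.1 = 0,
  (vorig *m transl s) 0 (s.1 + 1) = wpow (s.2 * (s.1 + 1))
  & (vorig *m transl s) 0 (s.1 - 1) = - wpow (s.2 * (s.1 - 1))].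
Proof.
rewrite !translE subrr ![s.1 + _]addrC !addrK !vorigE /=.
by rewrite !subr0 sub0r mulr0 mulr1 mulrN1.
Qed.

End Heisenberg.

(** * Hesse cubics *)

Definition hesse (K : fieldType) (a b : K) : pcubic K :=
  PCubic (cubic_form (fun i => if (i < 3)%N then a else if i == 9 then b else 0))
    (pt (vorig K)).

Section HesseForm.
Variables (K : fieldType) (a b : K).
Implicit Types (u v : 'rV[K]_3).

Lemma hesse_homog : form (hesse a b) \is 3.-homog.
Proof. exact: cubic_form_homog. Qed.

Lemma ev_hesse v : ev (form (hesse a b)) v =
  a * (v 0 0 ^+ 3 + v 0 1 ^+ 3 + v 0 2%:R ^+ 3) + b * (v 0 0 * v 0 1 * v 0 2%:R).
Proof. by rewrite ev_cubic /cubic_val /=; ring. Qed.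

Lemma polar_hesse u v : polar (form (hesse a b)) u v =
    (3%:R * a * u 0 0 ^+ 2 + b * u 0 1 * u 0 2%:R) * v 0 0
  + (3%:R * a * u 0 1 ^+ 2 + b * u 0 0 * u 0 2%:R) * v 0 1
  + (3%:R * a * u 0 2%:R ^+ 2 + b * u 0 0 * u 0 1) * v 0 2%:R.
Proof. by rewrite polar_cubic /=; ring. Qed.

Lemma ev_hesse_negm v : ev (form (hesse a b)) (v *m negm K) = ev (form (hesse a b)) v.
Proof.
rewrite !ev_hesse !negmE oppr0.
have -> : - 1 = 2%:R :> 'I_3 by apply: val_inj.
have -> : - 2%:R = 1 :> 'I_3 by apply: val_inj.
by ring.
Qed.

Lemma ev_hesse_transl w : w ^+ 2 + w + 1 = 0 ->
  forall s v, ev (form (hesse a b)) (v *m transl w s) = ev (form (hesse a b)) v.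
Proof.
move=> hw [i j] v; rewrite !ev_hesse !translE /= !mulr0 wpow0 mul1r mulr1.
have -> : wpow w (j * 2%:R) = wpow w j ^+ 2 by rewrite expr2 -wpowD // mulr_natr mulr2n.
set t := wpow w j; have ht : t ^+ 3 = 1 by exact: wpow3.
set x := v 0 _; set y := v 0 _; set z := v 0 _.
transitivity (a * (x ^+ 3 + t ^+ 3 * y ^+ 3 + (t ^+ 3) ^+ 2 * z ^+ 3)
   + b * t ^+ 3 * (x * y * z)); first by ring.
rewrite ht /x /y /z; move: i {x y z ht}; apply: ord3P.
- by rewrite !subr0; ring.
- have -> : 0 - 1 = 2%:R :> 'I_3 by apply: val_inj.
  have -> : 1 - 1 = 0 :> 'I_3 by apply: val_inj.
  have -> : 2%:R - 1 = 1 :> 'I_3 by apply: val_inj.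
  by ring.
- have -> : 0 - 2%:R = 1 :> 'I_3 by apply: val_inj.
  have -> : 1 - 2%:R = 2%:R :> 'I_3 by apply: val_inj.
  have -> : 2%:R - 2%:R = 0 :> 'I_3 by apply: val_inj.
  by ring.
Qed.

End HesseForm.

Section Hesse.
Variables (K : numClosedFieldType) (w a b : K).
Hypothesis hw : w ^+ 2 + w + 1 = 0.
Let H := hesse a b.
Hypothesis sm : smooth_form (form H).
Implicit Types (u v : 'rV[K]_3) (P Q R : P2 K) (s t : 'I_3 * 'I_3).

Let hom : form H \is 3.-homog := hesse_homog a b.
Let n1 : (1 : K) != 0 := oner_neq0 K.
Let evT s v : ev (form H) (v *m transl w s) = 1 * ev (form H) v.
Proof. by rewrite ev_hesse_transl ?mul1r. Qed.
Let evN v : ev (form H) (v *m negm K) = 1 * ev (form H) v.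
Proof. by rewrite ev_hesse_negm mul1r. Qed.

Lemma hesse_a_neq0 : a != 0.
Proof.
apply/eqP => a0; have nz : vec3 (1 : K) 0 0 != 0 by rewrite vec3_eq0 oner_eq0.
have ev0 : ev (form H) (vec3 1 0 0) = 0 by rewrite ev_hesse !vec3E a0; ring.
have [y] := polar_neq0 sm nz ev0; case/negP.
by rewrite polar_hesse !vec3E a0; apply/eqP; ring.
Qed.

(** If 27 a^3 + b^3 = 0 the cubic is a triangle, and (1 : 1 : b^2 / 9 a^2) is
    a vertex of it. *)
Lemma hesse_disc_neq0 : 27%:R * a ^+ 3 + b ^+ 3 != 0.
Proof.
apply/eqP => h; have na := hesse_a_neq0.
set z := b ^+ 2 / (9%:R * a ^+ 2).
have nz : vec3 (1 : K) 1 z != 0 by rewrite vec3_eq0 oner_eq0.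
have e1 : 3%:R * a + b * z = 0.
  transitivity ((27%:R * a ^+ 3 + b ^+ 3) / (9%:R * a ^+ 2)); last by rewrite h mul0r.
  by rewrite /z; field.
have e2 : 3%:R * a * z ^+ 2 + b = 0.
  transitivity ((27%:R * a ^+ 3 + b ^+ 3) * b / (27%:R * a ^+ 3)); last by rewrite h !mul0r.
  by rewrite /z; field.
have pol0 v : polar (form H) (vec3 1 1 z) v = 0.
  rewrite polar_hesse !vec3E.
  transitivity ((3%:R * a + b * z) * (v 0 0 + v 0 1) + (3%:R * a * z ^+ 2 + b) * v 0 2%:R).
    by ring.
  by rewrite e1 e2; ring.
have ev0 : ev (form H) (vec3 1 1 z) = 0.
  have n3 : (3%:R : K) != 0 by rewrite pnatr_eq0.
  by apply: (mulfI n3); rewrite -polar_diag // pol0 mulr0.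
by have [y] := polar_neq0 sm nz ev0; rewrite pol0 eqxx.
Qed.

Let na := hesse_a_neq0.
Let nd := hesse_disc_neq0.

Lemma on_hesse_orig : on_curve H (orig H).
Proof.
by rewrite on_curve_pt ?vorig_neq0 // ev_hesse !vec3E; apply/eqP; ring.
Qed.
Let onO := on_hesse_orig.

Lemma on_hesse_negm P : on_curve H (act (negm K) P) = on_curve H P.
Proof. exact: on_curve_transport (negm_unit K) n1 evN _. Qed.

Lemma on_hesse_transl s P : on_curve H (act (transl w s) P) = on_curve H P.
Proof. exact: on_curve_transport (transl_unit hw s) n1 (evT s) _. Qed.

(** The points (x : y : z), (x : z : y) and (0 : 1 : -1) are collinear and the
    Hesse cubic is symmetric in y and z. *)
Lemma third_hesse_orig P : on_curve H P -> third H (orig H) P = act (negm K) P.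
Proof.
move=> oP; have [e|/eqP ne] := eqVneq (orig H) P.
  rewrite -e [RHS]act_negm_orig.
  have [c nc cE] := val_pt (vorig_neq0 K).
  (* The tangent at (0 : 1 : -1) is - b x + 3 a (y + z) = 0. *)
  set T : 'rV[K]_3 := vec3 (6%:R * a) b b.
  have ind : cross T (val (orig H)) != 0.
    rewrite cE cross_antisym oppr_eq0 crossZl scaler_eq0 negb_or nc /=.
    rewrite /cross /vorig /T !vec3E vec3_eq0 !negb_and.
    by apply/orP; right; apply/orP; left; rewrite mulN1r mul0r subr0 oppr_eq0 mulf_neq0 ?pnatr_eq0.
  have hT : polar (form H) (val (orig H)) T = 0.
    by rewrite cE polarZl // polar_hesse /vorig /T !vec3E; ring.
  apply: (flex_of_polar hom sm onO ind hT).
  by rewrite cE polarZr polar_hesse /vorig /T !vec3E; ring.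
have [nw ->] := third_neq hom sm onO oP (introN eqP ne).
have [c nc cE] := val_pt (vorig_neq0 K).
set o := vorig K in cE.
(* The representative of the origin is a multiple of (0, 1, -1), with c coming
   from its normalisation. *)
rewrite (_ : val (orig H) = c *: o) // in nw *.
have e : polar (form H) (val P) (c *: o) *: (c *: o) - polar (form H) (c *: o) (val P) *: val P
  = (- c ^+ 2 * polar (form H) o (val P)) *: (val P *m negm K).
  rewrite polarZr polarZl // !polar_hesse; apply: row3P; rewrite [RHS]mxE negmE ?oppr0 /o /vorig.
  - by rewrite !(mxE, vec3E) /=; ring.
  - have -> : - 1 = 2%:R :> 'I_3 by apply: val_inj.
    by rewrite !(mxE, vec3E) /=; ring.
  - have -> : - 2%:R = 1 :> 'I_3 by apply: val_inj.
    by rewrite !(mxE, vec3E) /=; ring.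
rewrite e in nw *; rewrite actE; apply: ptZ.
by apply: contraNneq nw => ->; rewrite scale0r.
Qed.

(** Translation by the inverse index moves the point of index s to the
    origin. *)
Lemma third_hesse_tor s P : on_curve H P ->
  third H (tor w s) P = act (negm K) (act (transl w s) P).
Proof.
move=> oP; set g := transl w s.
have ug : g \in unitmx by exact: transl_unit.
have oP1 : on_curve H (act (transl w (- s)) P) by rewrite on_hesse_transl.
have eP : P = act g (act (transl w (- s)) P) by rewrite act_translM // addNr act_transl0.
have e1 := third_transport hom hom sm ug n1 (evT s) onO oP1.
rewrite -eP (third_hesse_orig oP1) in e1.
apply: etrans (congr1 (fun Q => third H Q P) (torE hw s)) _; apply: etrans e1 _.
have ess : s + s = - s by rewrite -[LHS]opprK pair3_addrr.
by rewrite /g (act_transl_negm hw (- s)) opprK (act_translM hw) (act_transl_negm hw s) ess.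
Qed.

Lemma addp_hesse_tor s P : on_curve H P -> addp H (tor w s) P = act (transl w s) P.
Proof.
move=> oP; rewrite addpE (third_hesse_tor s oP).
have oQ : on_curve H (act (negm K) (act (transl w s) P)).
  by rewrite on_hesse_negm on_hesse_transl.
by rewrite (third_hesse_orig oQ) act_negmK.
Qed.

Lemma flex_hesse : third H (orig H) (orig H) = orig H.
Proof. by rewrite third_hesse_orig // act_negm_orig. Qed.

Lemma oppp_hesse P : on_curve H P -> oppp H P = act (negm K) P.
Proof. by move=> oP; rewrite opppE flex_hesse thirdC third_hesse_orig. Qed.

Lemma on_hesse_tor s : on_curve H (tor w s).
Proof. by rewrite (torE hw s) on_hesse_transl. Qed.

Lemma addp_hesse s t : addp H (tor w s) (tor w t) = tor w (s + t).
Proof. by rewrite (addp_hesse_tor s (on_hesse_tor t)) (act_tor hw) addrC. Qed.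

(** Flexes lie on the Hessian, which for a Hesse cubic is again a combination
    of x^3 + y^3 + z^3 and x y z; modulo the equation of the curve, it is a
    constant times the discriminant times x y z. Here the factor z^2 comes
    from the choice of tangent direction. *)
Lemma hesse_flex_last_coord P : on_curve H P -> third H P P = P -> val P 0 2%:R != 0 ->
  val P 0 0 * val P 0 1 * val P 0 2%:R = 0.
Proof.
move=> oP hP nz; have evP : ev (form H) (val P) = 0 by apply/eqP.
set x := val P 0 0; set y := val P 0 1; set z := val P 0 2%:R.
set gx := 3%:R * a * x ^+ 2 + b * y * z; set gy := 3%:R * a * y ^+ 2 + b * x * z.
set gz := 3%:R * a * z ^+ 2 + b * x * y.
have pE v : polar (form H) (val P) v = gx * v 0 0 + gy * v 0 1 + gz * v 0 2%:R.
  by rewrite polar_hesse.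
set T := vec3 gy (- gx) 0.
have hT : polar (form H) (val P) T = 0 by rewrite pE !vec3E; ring.
have ind : cross T (val P) != 0.
  have [v nv] := polar_neq0 sm (val_nz P) evP; apply: contra nv => /eqP/rowP h.
  have := h 0; have := h 1; rewrite /cross /T !mxE /= -/z mul0r => /eqP.
  rewrite sub0r oppr_eq0 mulf_eq0 (negPf nz) orbF => /eqP hy.
  rewrite mul0r subr0 => /eqP; rewrite mulf_eq0 (negPf nz) orbF oppr_eq0 => /eqP hx.
  have : polar (form H) (val P) (val P) = 0 by rewrite polar_diag // evP mulr0.
  rewrite !pE hx hy !mul0r !add0r => /eqP; rewrite mulf_eq0 (negPf nz) orbF => /eqP ->.
  by rewrite mul0r.
have := polar_of_flex hom sm oP ind hT hP.
rewrite polar_hesse !vec3E -/x -/y -/z => h.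
have nzd : z ^+ 2 * (27%:R * a ^+ 3 + b ^+ 3) != 0 by rewrite mulf_neq0 ?expf_neq0.
apply: (mulIf nzd); rewrite mul0r.
transitivity (27%:R * a ^+ 2 * x * y * ev (form H) (val P) -
  ((3%:R * a * gy ^+ 2 + b * - gx * 0) * x + (3%:R * a * (- gx) ^+ 2 + b * gy * 0) * y
    + (3%:R * a * 0 ^+ 2 + b * gy * - gx) * z)).
  by rewrite ev_hesse -/x -/y -/z /gx /gy; ring.
by rewrite h evP mulr0 subr0.
Qed.

Lemma flex_transl s P : on_curve H P -> third H P P = P ->
  third H (act (transl w s) P) (act (transl w s) P) = act (transl w s) P.
Proof.
move=> oP hP; rewrite (third_transport hom hom sm (transl_unit hw s) n1 (evT s) oP oP).
by rewrite hP.
Qed.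

(** A cyclic shift of the coordinates, which preserves the curve and its
    flexes, makes a nonzero coordinate the last one. *)
Lemma hesse_flex_coord P : on_curve H P -> third H P P = P ->
  val P 0 0 * val P 0 1 * val P 0 2%:R = 0.
Proof.
move=> oP hP; have [i ni] := row_neq0P (val_nz P).
set s : 'I_3 * 'I_3 := (2%:R - i, 0); set Q := act (transl w s) P.
have oQ : on_curve H Q by rewrite on_hesse_transl.
have [c nc cE] := val_act P (transl_unit hw s).
have QE k : val Q 0 k = c * val P 0 (k - (2%:R - i)).
  by rewrite cE mxE translE mul0r wpow0 mul1r.
have nQ : val Q 0 2%:R != 0 by rewrite QE opprB addrC subrK mulf_neq0.
have := hesse_flex_last_coord oQ (flex_transl s oP hP) nQ.
rewrite !QE => /eqP h; apply/eqP; move: h; rewrite !mulf_eq0 (negPf nc) !orFb.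
clear; move: i; apply: ord3P; rewrite ?subr0.
- have -> : 0 - 2%:R = 1 :> 'I_3 by apply: val_inj.
  have -> : 1 - 2%:R = 2%:R :> 'I_3 by apply: val_inj.
  rewrite subrr; by case: eqP; case: eqP; case: eqP.
- have -> : 2%:R - 1 = 1 :> 'I_3 by apply: val_inj.
  have -> : 0 - 1 = 2%:R :> 'I_3 by apply: val_inj.
  have -> : 2%:R - 1 = 1 :> 'I_3 by apply: val_inj.
  rewrite subrr; by case: eqP; case: eqP; case: eqP.
- by rewrite subrr !subr0.
Qed.

Lemma cube_root1 (z : K) : z ^+ 3 = 1 -> exists j, z = wpow w j.
Proof.
move=> h; have /eqP : (z - 1) * (z - w) * (z - w ^+ 2) = 0.
  have w3 := w3 hw.
  transitivity (z ^+ 3 - w ^+ 3 + (w ^+ 2 + w + 1) * (z * w - z ^+ 2)); first by ring.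
  by rewrite h w3 hw; ring.
rewrite !mulf_eq0 !subr_eq0 -orbA => /or3P[] /eqP ->.
- by exists 0.
- by exists 1; rewrite /wpow expr1.
- by exists 2%:R.
Qed.

(** A flex lies on a side of the triangle x y z = 0, where the equation
    reduces to y^3 + z^3 = 0. *)
Lemma hesse_flexP P : on_curve H P -> third H P P = P -> exists s, P = tor w s.
Proof.
move=> oP hP; have evP : ev (form H) (val P) = 0 by apply/eqP.
have [i hi] : exists i, val P 0 i = 0.
  have /eqP := hesse_flex_coord oP hP; rewrite !mulf_eq0 -orbA.
  by move=> /or3P[] /eqP h; [exists 0 | exists 1 | exists 2%:R].
set y := val P 0 (i + 1); set z := val P 0 (i - 1).
have hyz : y ^+ 3 + z ^+ 3 = 0.
  apply: (mulfI na); rewrite mulr0 -evP ev_hesse; move: hi; rewrite /y /z.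
  clear; move: i; apply: ord3P => h0.
  - have -> : 0 + 1 = 1 :> 'I_3 by apply: val_inj.
    have -> : 0 - 1 = 2%:R :> 'I_3 by apply: val_inj.
    by rewrite h0; ring.
  - have -> : 1 + 1 = 2%:R :> 'I_3 by apply: val_inj.
    have -> : 1 - 1 = 0 :> 'I_3 by apply: val_inj.
    by rewrite h0; ring.
  - have -> : 2%:R + 1 = 0 :> 'I_3 by apply: val_inj.
    have -> : 2%:R - 1 = 1 :> 'I_3 by apply: val_inj.
    by rewrite h0; ring.
have cases (Q : 'I_3 -> Prop) : Q i -> Q (i + 1) -> Q (i - 1) -> forall k, Q k.
  clear; move: i; apply: ord3P; rewrite ?add0r.
  - have -> : - 1 = 2%:R :> 'I_3 by apply: val_inj.
    exact: ord3P.
  - have -> : 1 + 1 = 2%:R :> 'I_3 by apply: val_inj.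
    by rewrite subrr => *; apply: ord3P.
  - have -> : 2%:R + 1 = 0 :> 'I_3 by apply: val_inj.
    have -> : 2%:R - 1 = 1 :> 'I_3 by apply: val_inj.
    by move=> *; apply: ord3P.
have ny : y != 0.
  apply: contra (val_nz P) => /eqP y0; apply/eqP/rowP; apply: cases; rewrite mxE //.
  by have := hyz; rewrite y0 expr0n add0r => /eqP; rewrite expf_eq0 => /eqP.
have [j hj] : exists j, - z / y = wpow w j.
  apply: cube_root1; rewrite expr_div_n exprNn -signr_odd /= expr1 mulN1r.
  have -> : - z ^+ 3 = y ^+ 3 by apply/eqP; rewrite eq_sym -subr_eq0 opprK hyz.
  by rewrite divff ?expf_neq0.
have i3 : i - 1 = i + 1 + 1 by move: i {hi y z hyz cases ny hj}; apply: ord3P; apply: val_inj.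
exists (i, j); have [e0 e1 e2] := vtorE w (i, j); rewrite /= in e0 e1 e2.
rewrite /tor -(valK_pt P).
have -> : val P = (y / wpow w (j * (i + 1))) *: (vorig K *m transl w (i, j)).
  apply/rowP; apply: cases; rewrite [RHS]mxE ?e0 ?e1 ?e2 ?mulr0 //.
    by rewrite mulfVK ?wpow_neq0.
  have eW : wpow w (j * (i - 1)) = wpow w (j * (i + 1)) * wpow w j.
    by rewrite -wpowD // i3 [in LHS]mulrDr mulr1.
  by rewrite -/z eW -hj; field; rewrite ny wpow_neq0.
apply: ptZ; by rewrite mulf_neq0 ?invr_eq0 ?wpow_neq0.
Qed.

Lemma torsion3_hesse P : P \in torsion3 H <-> exists s, P = tor w s.
Proof.
split=> [/(torsion3_flexP hom sm onO flex_hesse) [oP hP]|[s ->]].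
  exact: hesse_flexP.
apply/(torsion3_flexP hom sm onO flex_hesse); split; first exact: on_hesse_tor.
by rewrite (third_hesse_tor s (on_hesse_tor s)) (act_tor hw) (act_negm_tor hw) pair3_addrr.
Qed.

End Hesse.

(** * The Weil pairing on a Hesse cubic *)

Definition det2 (s t : 'I_3 * 'I_3) : 'I_3 := s.1 * t.2 - s.2 * t.1.

(** The shape taken by the pairing on a Hesse cubic: four tangent values a, b,
    c, d, each occurring once upstairs and once downstairs, with roots of
    unity z1, ..., z4. *)
Lemma ratio_quot (K : fieldType) (k l a b c d A B C E z1 z2 z3 z4 : K) :
  k != 0 -> l != 0 -> z2 != 0 -> z3 != 0 -> z4 != 0 ->
  a != 0 -> b != 0 -> c != 0 -> d != 0 ->
  A = k * (z1 * a / b) -> B = k * (z2 * c / d) ->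
  C = l * (z3 * a / c) -> E = l * (z4 * b / d) ->
  A / B / (C / E) = z1 * z4 / (z2 * z3).
Proof.
move=> nk nl n2 n3 n4 na nb nc nd -> -> -> ->; field.
by rewrite nk nl n2 n3 n4 na nb nc nd.
Qed.

Lemma and_bools p1 o1 p2 o2 p3 o3 p4 o4 q1 q2 q3 q4 :
  p1 = q1 -> o1 = q2 -> p2 = q3 -> o2 = q4 -> p3 = q1 -> o3 = q3 -> p4 = q2 -> o4 = q4 ->
  [&& true, [&& p1 && o1, p2 && o2 & true], p3 && o3, p4 && o4 & true] = [&& q1, q2, q3 & q4].
Proof. by do 8!move=> ->; case: q1 q2 q3 q4 => [] [] [] []. Qed.

Section TorInj.
Variables (K : numClosedFieldType) (w : K).
Hypothesis hw : w ^+ 2 + w + 1 = 0.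
Implicit Types (s t : 'I_3 * 'I_3).

Lemma wpow_inj : injective (wpow w).
Proof.
move=> i j h; apply/eqP; rewrite -subr_eq0; apply/eqP.
have : wpow w (i - j) = 1.
  apply: (mulIf (wpow_neq0 hw j)); rewrite -wpowD // subrK mul1r h //.
have n3 : (3%:R : K) != 0 by rewrite pnatr_eq0.
move: (i - j); apply: ord3P => //; rewrite /wpow /= => h1; case/negP: n3.
  by move: hw; rewrite expr1 in h1; rewrite h1 expr1n => <-; apply/eqP; ring.
move: hw; rewrite (h1 : w ^+ 2 = 1) => h2.
have e : w = - 2%:R by rewrite -[w]addr0 -oppr0 -h2; ring.
apply/eqP; transitivity (w ^+ 2 - 1); last by rewrite (h1 : w ^+ 2 = 1) subrr.
by rewrite e; ring.
Qed.

Lemma tor_inj : injective (tor w).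
Proof.
move=> [i j] [i' j'] h; have [c nc e] := pt_eqP (vtor_neq0 hw _) (vtor_neq0 hw _) h.
have E k : (vorig K *m transl w (i, j)) 0 k = c * (vorig K *m transl w (i', j')) 0 k.
  by rewrite e mxE.
have [z0 z1 z2] := vtorE w (i, j); have [y0 y1 y2] := vtorE w (i', j').
rewrite /= in z0 z1 z2 y0 y1 y2.
have ei : i = i'.
  have := E i; rewrite z0 => /esym/eqP; rewrite mulf_eq0 (negPf nc) /=.
  have : [|| i == i', i == i' + 1 | i == i' - 1].
    by move: i i' {h e E z0 z1 z2 y0 y1 y2}; do 2!apply: ord3P.
  case/or3P => /eqP -> //; rewrite ?y1 ?y2 ?oppr_eq0 (negPf (wpow_neq0 hw _)) //.
subst i'; congr pair.
have e1 := E (i + 1); have e2 := E (i - 1).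
rewrite z1 y1 in e1; rewrite z2 y2 mulrN in e2; move/oppr_inj: e2 => e2.
have : wpow w (j * (i - 1) + j' * (i + 1)) = wpow w (j * (i + 1) + j' * (i - 1)).
  by rewrite !wpowD // e1 e2; ring.
move/wpow_inj => h3; apply/eqP; rewrite -subr_eq0; apply/eqP.
rewrite -[LHS]ord3_addrr; apply/eqP; rewrite oppr_eq0; apply/eqP.
transitivity (j * (i + 1) + j' * (i - 1) - (j * (i - 1) + j' * (i + 1))); first by ring.
by rewrite h3 subrr.
Qed.
End TorInj.

Section WeilHesse.
Variables (K : numClosedFieldType) (w a b : K).
Hypothesis hw : w ^+ 2 + w + 1 = 0.
Let H := hesse a b.
Hypothesis sm : smooth_form (form H).
Implicit Types (u v y : 'rV[K]_3) (P Q R : P2 K) (s t : 'I_3 * 'I_3).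

Let hom : form H \is 3.-homog := hesse_homog a b.
Let n1 : (1 : K) != 0 := oner_neq0 K.
Let evT s v : ev (form H) (v *m transl w s) = 1 * ev (form H) v.
Proof. by rewrite ev_hesse_transl ?mul1r. Qed.
Let evN v : ev (form H) (v *m negm K) = 1 * ev (form H) v.
Proof. by rewrite ev_hesse_negm mul1r. Qed.

Definition tan_tor s y := polar (form H) (vorig K *m transl w s) y.
Definition tan_orig y := polar (form H) (vorig K) y.

Lemma tan_orig_negm y : tan_orig (y *m negm K) = tan_orig y.
Proof.
rewrite /tan_orig !polar_hesse !negmE /vorig !vec3E oppr0.
have -> : - 1 = 2%:R :> 'I_3 by apply: val_inj.
have -> : - 2%:R = 1 :> 'I_3 by apply: val_inj.
by ring.
Qed.

(** The tangent at the point s, evaluated at R + t, is up to a root of unity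
    the tangent at the origin evaluated at R + (t - s). *)
Lemma tan_tor_transl s t y :
  tan_tor s (y *m transl w t) = wpow w ((t - s).2 * s.1) * tan_orig (y *m transl w (t - s)).
Proof.
have e : y *m transl w t = wpow w ((t - s).2 * s.1) *: (y *m transl w (t - s) *m transl w s).
  by rewrite translM // subrK scalerA -wpowD // subrr wpow0 scale1r.
by rewrite e /tan_tor polarZr (polar_transport hom hom (evT s)) mul1r /tan_orig.
Qed.

Lemma tan_tor_eval s : exists2 k, k != 0 & forall y, y != 0 ->
  [/\ fT H (tor w s) (pt y) = k * (tan_tor s y / tan_orig y),
     (tangent H (tor w s) (val (pt y)) != 0) = (tan_tor s y != 0)
   & (tangent H (orig H) (val (pt y)) != 0) = (tan_orig y != 0)].
Proof.
have [c nc cE] := val_pt (vtor_neq0 hw s); have [d nd dE] := val_pt (vorig_neq0 K).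
exists (c ^+ 2 / d ^+ 2); first by rewrite mulf_neq0 ?invr_eq0 ?expf_neq0.
move=> y ny; have [x nx xE] := val_pt ny.
have e1 : tangent H (tor w s) (val (pt y)) = c ^+ 2 * x * tan_tor s y.
  by rewrite tangentE xE polarZr {1}/tor cE polarZl // /tan_tor; ring.
have e2 : tangent H (orig H) (val (pt y)) = d ^+ 2 * x * tan_orig y.
  by rewrite tangentE xE polarZr (_ : val (orig H) = d *: vorig K) // polarZl // /tan_orig; ring.
split; last 2 first.
- by rewrite e1 !mulf_eq0 (negPf nc) (negPf nx).
- by rewrite e2 !mulf_eq0 (negPf nd) (negPf nx).
rewrite fTE e1 e2.
have [->|nz] := eqVneq (tan_orig y) 0; first by rewrite !mulr0 invr0 !mulr0.
by field; rewrite nz nx nd.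
Qed.

(** The tangent at the flex (0 : 1 : -1) meets the cubic there only, and this
    point has first coordinate 0. *)
Lemma tan_orig_neq0 y : ev (form H) y = 0 -> y 0 0 != 0 -> tan_orig y != 0.
Proof.
move=> evy; apply: contraNneq => h.
have : (27%:R * a ^+ 3 + b ^+ 3) * y 0 0 ^+ 3 = 0.
  transitivity (27%:R * a ^+ 2 * ev (form H) y + tan_orig y *
   (27%:R * a ^+ 2 * (y 0 1 * y 0 2%:R)
     - ((3%:R * a * (y 0 1 + y 0 2%:R)) ^+ 2 + (3%:R * a * (y 0 1 + y 0 2%:R)) * b * y 0 0 + b
         ^+ 2 * y 0 0 ^+ 2))).
    by rewrite ev_hesse /tan_orig polar_hesse /vorig !vec3E; ring.
  by rewrite evy h mul0r mulr0 addr0.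
by move/eqP; rewrite mulf_eq0 (negPf (hesse_disc_neq0 sm)) expf_eq0.
Qed.

Let addp_pt s R : on_curve H R -> addp H (tor w s) R = pt (val R *m transl w s).
Proof. by move=> oR; rewrite (addp_hesse_tor hw sm s oR) actE. Qed.

Let oppp_pt R : on_curve H R -> oppp H R = pt (val R *m negm K).
Proof. by move=> oR; rewrite (oppp_hesse sm oR) actE. Qed.

Let addp_oppp_pt s R : on_curve H R ->
  addp H (tor w s) (oppp H R) = pt (val R *m negm K *m transl w s).
Proof.
move=> oR; have oN : on_curve H (oppp H R).
  by rewrite (oppp_hesse sm oR) on_hesse_negm.
rewrite (addp_hesse_tor hw sm s oN) (oppp_pt oR) act_pt ?transl_unit //.
by rewrite mulmx_nz ?negm_unit ?val_nz.
Qed.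

Lemma hesse_weil_admissible s t R : on_curve H R ->
  weil_admissible H (tor w s) (tor w t) R =
  [&& tan_orig (val R *m transl w (t - s)) != 0, tan_orig (val R *m transl w t) != 0,
      tan_orig (val R *m transl w (- s)) != 0 & tan_orig (val R) != 0].
Proof.
move=> oR; rewrite /weil_admissible oR; cbn [all].
have [ks nks hs] := tan_tor_eval s; have [kt nkt ht] := tan_tor_eval t.
have n0 := val_nz R; have nN := mulmx_nz (negm_unit K) n0.
have nt := mulmx_nz (transl_unit hw t) n0.
have nNs := mulmx_nz (transl_unit hw s) nN.
have [_ f1 g1] := hs _ nt; have [_ f2 g2] := hs _ n0.
have [_ f3 g3] := ht _ nNs; have [_ f4 g4] := ht _ nN.
have vR := congr1 val (valK_pt R); have at_ := congr1 val (addp_pt t oR).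
have ao := congr1 val (addp_oppp_pt s oR); have ov := congr1 val (oppp_pt oR).
rewrite -at_ in f1 g1; rewrite vR in f2 g2; rewrite -ao in f3 g3; rewrite -ov in f4 g4.
have e1 : (tan_tor s (val R *m transl w t) != 0) = (tan_orig (val R *m transl w (t - s)) != 0).
  by rewrite tan_tor_transl mulf_eq0 (negPf (wpow_neq0 hw _)).
have e2 : (tan_tor s (val R) != 0) = (tan_orig (val R *m transl w (- s)) != 0).
  by rewrite -{1}(transl0 w (val R)) tan_tor_transl mulf_eq0 (negPf (wpow_neq0 hw _)) sub0r.
have e3 : (tan_tor t (val R *m negm K *m transl w s) != 0) = (tan_orig (val R *m transl w (t - s)) != 0).
  rewrite tan_tor_transl mulf_eq0 (negPf (wpow_neq0 hw _)) /=.
  by rewrite -tan_orig_negm transl_negm negmK opprB.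
have e4 : (tan_tor t (val R *m negm K) != 0) = (tan_orig (val R *m transl w t) != 0).
  rewrite -{1}(transl0 w (_ *m negm K)) tan_tor_transl mulf_eq0 (negPf (wpow_neq0 hw _)) /=.
  by rewrite sub0r -tan_orig_negm transl_negm negmK opprK.
have e5 : (tan_orig (val R *m negm K *m transl w s) != 0) = (tan_orig (val R *m transl w (- s)) != 0).
  by rewrite -tan_orig_negm transl_negm negmK.
rewrite tan_orig_negm in g4.
exact: (and_bools (etrans f1 e1) g1 (etrans f2 e2) g2 (etrans f3 e3) (etrans g3 e5) (etrans f4 e4) g4).
Qed.

(** By [tan_tor_transl] and the symmetry under - 1, all the tangents in the
    pairing are values of the tangent at the origin at R + (t - s), R + t, R -
    s and R. Each occurs once in the numerator and once in the denominator.
    What remains is the product of the Heisenberg cocycles, the commutator of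
    s and t. *)
Lemma hesse_weil s t : weil_const H (tor w s) (tor w t) (wpow w (det2 s t)).
Proof.
have na := hesse_a_neq0 sm; split.
  (* An admissible point: (x : 1 : 1) is a fixed point of - 1, that is, a
     2-torsion point, and none of its translates has first coordinate 0. *)
  have [x nx hx] : exists2 x, x != 0 & a * x ^+ 3 + b * x + 2%:R * a = 0.
    have [x hx] := @solve_monicpoly K 3 (fun i => [:: - 2%:R; - b / a; 0]`_i) isT.
    rewrite !big_ord_recr big_ord0 /= in hx.
    have hx2 : a * x ^+ 3 + b * x + 2%:R * a = 0 by rewrite hx; field.
    exists x => //; apply: contraTneq (na) => x0; move: hx2; rewrite x0 expr0n /= !mulr0 !add0r.
    by rewrite negbK => /eqP; rewrite mulf_eq0 pnatr_eq0.
  set r : 'rV[K]_3 := vec3 x 1 1.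
  have nr : r != 0 by rewrite vec3_eq0 oner_eq0 !andbF.
  have evr : ev (form H) r = 0 by rewrite ev_hesse !vec3E -hx; ring.
  have [c nc cE] := val_pt nr.
  have oR : on_curve H (pt r) by rewrite on_curve_pt // evr.
  exists (pt r); rewrite hesse_weil_admissible //.
  have key (u : 'I_3 * 'I_3) : tan_orig (val (pt r) *m transl w u) != 0.
    rewrite cE -scalemxAl /tan_orig polarZr mulf_neq0 // tan_orig_neq0 //.
      by rewrite ev_hesse_transl.
    rewrite translE mulf_neq0 ?wpow_neq0 // /r.
    by move: (0 - u.1); apply: ord3P; rewrite !vec3E ?oner_neq0.
  by rewrite !key -{1}(transl0 w (val (pt r))) key.
move=> R aR; have /andP[oR _] := aR.
rewrite hesse_weil_admissible // in aR.
have /and4P[na1 na2 na3 na4] := aR.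
have [ks nks hs] := tan_tor_eval s; have [kt nkt ht] := tan_tor_eval t.
have n0 := val_nz R; have nN := mulmx_nz (negm_unit K) n0.
have nt := mulmx_nz (transl_unit hw t) n0.
have nNs := mulmx_nz (transl_unit hw s) nN.
have [f1 _ _] := hs _ nt; have [f2 _ _] := hs _ n0.
have [f3 _ _] := ht _ nNs; have [f4 _ _] := ht _ nN.
rewrite -(addp_pt t oR) in f1; rewrite valK_pt in f2.
rewrite -(addp_oppp_pt s oR) in f3; rewrite -(oppp_pt oR) in f4.
have g1 : tan_tor s (val R *m transl w t) =
    wpow w ((t - s).2 * s.1) * tan_orig (val R *m transl w (t - s)).
  exact: tan_tor_transl.
have g2 : tan_tor s (val R) = wpow w ((0 - s).2 * s.1) * tan_orig (val R *m transl w (- s)).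
  by rewrite -{1}(transl0 w (val R)) tan_tor_transl sub0r.
have g3 : tan_tor t (val R *m negm K *m transl w s) =
    wpow w ((s - t).2 * t.1) * tan_orig (val R *m transl w (t - s)).
  by rewrite tan_tor_transl -tan_orig_negm transl_negm negmK opprB.
have g4 : tan_tor t (val R *m negm K) = wpow w ((0 - t).2 * t.1) * tan_orig (val R *m transl w t).
  rewrite -{1}(transl0 w (_ *m negm K)) tan_tor_transl.
  by rewrite !sub0r -tan_orig_negm transl_negm negmK opprK.
have g5 : tan_orig (val R *m negm K *m transl w s) = tan_orig (val R *m transl w (- s)).
  by rewrite -tan_orig_negm transl_negm negmK.
rewrite g1 in f1; rewrite g2 in f2; rewrite g3 g5 in f3; rewrite g4 tan_orig_negm in f4.
have nz := wpow_neq0 hw.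
apply: etrans (ratio_quot nks nkt (nz _) (nz _) (nz _) na1 na2 na3 na4 f1 f2 f3 f4) _.
rewrite -!wpowD //; apply: (mulIf (nz ((0 - s).2 * s.1 + (s - t).2 * t.1))).
rewrite mulfVK ?nz // -wpowD //; congr wpow; rewrite /det2 /=; ring.
Qed.
End WeilHesse.

(** * Cubic forms as functions and linear substitutions *)

Section CubicExt.
Variable K : fieldType.
Hypothesis n2 : (2%:R : K) != 0.
Implicit Types (p q : {mpoly K[3]}).

(** The values at points with coordinates in {0, 1, -1} determine the ten
    coefficients once 2 is invertible. *)
Lemma cubic_val_eq0 (c : nat -> K) :
  (forall x y z, cubic_val c x y z = 0) -> forall i : 'I_10, c i = 0.
Proof.
rewrite /cubic_val => h.
have c0 : c 0%N = 0 by rewrite -[RHS](h 1 0 0); ring.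
have c1 : c 1%N = 0 by rewrite -[RHS](h 0 1 0); ring.
have c2 : c 2 = 0 by rewrite -[RHS](h 0 0 1); ring.
have half (u v : K) : u + v = 0 -> u - v = 0 -> u = 0 /\ v = 0.
  move=> h1 h2; split; apply: (mulfI n2); rewrite mulr0.
    by transitivity (u + v + (u - v)); [ring | rewrite h1 h2 addr0].
  by transitivity (u + v - (u - v)); [ring | rewrite h1 h2 subr0].
have [c6 c3] : c 6 = 0 /\ c 3 = 0.
  by apply: half; [rewrite -[RHS](h 1 1 0) | rewrite -[RHS](h 1 (-1) 0)]; rewrite c0 c1; ring.
have [c7 c4] : c 7 = 0 /\ c 4 = 0.
  by apply: half; [rewrite -[RHS](h 0 1 1) | rewrite -[RHS](h 0 1 (-1))]; rewrite c1 c2; ring.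
have [c5 c8] : c 5 = 0 /\ c 8 = 0.
  by apply: half; [rewrite -[RHS](h 1 0 1) | rewrite -[RHS](h 1 0 (-1))]; rewrite c0 c2; ring.
have c9 : c 9 = 0 by rewrite -[RHS](h 1 1 1) c0 c1 c2 c3 c4 c5 c6 c7 c8; ring.
by case=> [[|[|[|[|[|[|[|[|[|[|//]]]]]]]]]]].
Qed.

Lemma cubic_ext p q : p \is 3.-homog -> q \is 3.-homog ->
  (forall v, ev p v = ev q v) -> p = q.
Proof.
move=> hp hq h; apply/eqP; rewrite -subr_eq0; apply/eqP.
have hpq : p - q \is 3.-homog by rewrite rpredB.
have [c e] := homog3E hpq; rewrite e; apply: cubic_form0; apply: cubic_val_eq0 => x y z.
have := ev_cubic c (vec3 x y z); rewrite !vec3E -e => <-.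
by rewrite /ev mevalB -!/(ev _ _) h subrr.
Qed.
End CubicExt.

Section LinearChange.
Variable K : fieldType.
Implicit Types (p : {mpoly K[3]}) (u v w x : 'rV[K]_3) (M : 'M[K]_3).

Lemma comp_linear_homog p M : p \is 3.-homog ->
  p \mPo [tuple \sum_j M j i *: 'X_j | i < 3] \is 3.-homog.
Proof.
move=> /homog3E [c ->]; rewrite /cubic_form raddf_sum; apply: rpred_sum => i _ /=.
rewrite comp_mpolyZ; apply: rpredZ; rewrite comp_mpolyX prod3 !mnmE.
have hl k : tnth [tuple \sum_j M j k *: 'X_j | k < 3] k \is 1.-homog.
  rewrite tnth_mktuple; apply: rpred_sum => j _; apply: rpredZ.
  by rewrite dhomogX; apply/eqP; exact: mdeg1.
set l := [tuple _ | k < 3] in hl *.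
have key (k0 k1 k2 : nat) : (k0 + k1 + k2 = 3)%N ->
    tnth l 0 ^+ k0 * tnth l 1 ^+ k1 * tnth l 2%:R ^+ k2 \is 3.-homog.
  move=> h.
  have := dhomogM (dhomogM (dhomogMn k0 (hl 0)) (dhomogMn k1 (hl 1))) (dhomogMn k2 (hl 2%:R)).
  by rewrite !mul1n h.
by apply: key; case: i => [[|[|[|[|[|[|[|[|[|[|//]]]]]]]]]]].
Qed.

Lemma ev_comp_linear p M v :
  ev (p \mPo [tuple \sum_j M j i *: 'X_j | i < 3]) v = ev p (v *m M).
Proof.
rewrite /ev comp_mpoly_meval; apply: meval_eq => i.
rewrite tnth_mktuple raddf_sum mxE; apply: eq_bigr => j _ /=.
by rewrite mevalZ mevalXU mulrC.
Qed.

Definition rows3 u v w : 'M[K]_3 := \matrix_(i, j) ([:: u; v; w]`_i) 0 j.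

Lemma mul_rows3 x u v w :
  x *m rows3 u v w = x 0 0 *: u + x 0 1 *: v + x 0 2%:R *: w.
Proof. by apply/rowP => j; rewrite mulmx3 !mxE. Qed.

Lemma rows3_unit u v w : triple u v w != 0 -> rows3 u v w \in unitmx.
Proof.
move=> nz.
pose N : 'M[K]_3 := \matrix_(i, j) ((triple u v w)^-1 * ([:: cross v w; cross w u; cross u v]`_j) 0 i).
have h : rows3 u v w *m N = 1%:M.
  apply/matrixP => i j; rewrite mxE sum3 !mxE.
  move: i j nz; do 2!apply: ord3P; rewrite /= /triple /cross !vec3E => nz;
  rewrite ?mulr1n ?mulr0n; by field.
by have [] := mulmx1_unit h.
Qed.

End LinearChange.

(** * Weierstrass cubics and their Hesse form *)

Definition weier (K : fieldType) (A B : K) : pcubic K :=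
  PCubic (cubic_form (fun i => [:: -1; 0; - B; 0; 1; - A]`_i)) (pt010 K).

Lemma ev_weier (K : fieldType) (A B : K) v : ev (form (weier A B)) v =
  v 0 1 ^+ 2 * v 0 2%:R - (v 0 0 ^+ 3 + A * (v 0 0 * v 0 2%:R ^+ 2) + B * v 0 2%:R ^+ 3).
Proof. by rewrite ev_cubic /cubic_val /=; ring. Qed.

Lemma polar_weier (K : fieldType) (A B : K) u v : polar (form (weier A B)) u v =
  - (3%:R * u 0 0 ^+ 2 + A * u 0 2%:R ^+ 2) * v 0 0 + 2%:R * u 0 1 * u 0 2%:R * v 0 1
  + (u 0 1 ^+ 2 - 2%:R * A * u 0 0 * u 0 2%:R - 3%:R * B * u 0 2%:R ^+ 2) * v 0 2%:R.
Proof. by rewrite polar_cubic /=; ring. Qed.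

Section Weierstrass.
Variable K : numClosedFieldType.
Implicit Types (A B a b : K).

Definition wdisc A B := 4%:R * A ^+ 3 + 27%:R * B ^+ 2.

(** A double root of x^3 + A x + B is a singular point; it is - 3 B / 2 A when
    the discriminant vanishes and A does not. *)
Lemma wdisc_neq0 A B : smooth_form (form (weier A B)) -> wdisc A B != 0.
Proof.
move=> sm; apply/eqP => hd.
have [x [hx1 hx2]] : exists x, 3%:R * x ^+ 2 + A = 0 /\ x ^+ 3 + A * x + B = 0.
  have [A0|nA] := eqVneq A 0.
    have B0 : B = 0.
      move/eqP: hd; rewrite /wdisc A0 expr0n /= mulr0 add0r mulf_eq0 pnatr_eq0 /=.
      by rewrite expf_eq0 /= => /eqP.
    by exists 0; rewrite A0 B0; split; ring.
  exists (- (3%:R * B) / (2%:R * A)); split.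
    by transitivity (wdisc A B / (4%:R * A ^+ 2)); [rewrite /wdisc; field | rewrite hd mul0r].
  by transitivity (- B * wdisc A B / (8%:R * A ^+ 3)); [rewrite /wdisc; field | rewrite hd mulr0 mul0r].
have nz : vec3 x 0 1 != 0 by rewrite vec3_eq0 oner_eq0 !andbF.
have pol0 v : polar (form (weier A B)) (vec3 x 0 1) v = 0.
  rewrite polar_weier !vec3E.
  transitivity (- (3%:R * x ^+ 2 + A) * v 0 0 + (x * (3%:R * x ^+ 2 + A) - 3%:R * (x ^+ 3 + A *
      x + B)) * v 0 2%:R).
    by ring.
  by rewrite hx1 hx2; ring.
have ev0 : ev (form (weier A B)) (vec3 x 0 1) = 0.
  rewrite ev_weier !vec3E; transitivity (- (x ^+ 3 + A * x + B)); first by ring.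
  by rewrite hx2 oppr0.
by have [y] := polar_neq0 sm nz ev0; rewrite pol0 eqxx.
Qed.

(** With hesseB, the coefficients of the Weierstrass equation of the Hesse
    cubic of parameters a and b. *)
Definition hesseA a b := 3%:R * b * (216%:R * a ^+ 3 - b ^+ 3).
Definition hesseB a b := - 2%:R * (b ^+ 6 + 540%:R * a ^+ 3 * b ^+ 3 - 5832%:R * a ^+ 6).
Definition hdisc a b := 27%:R * a ^+ 3 + b ^+ 3.

Lemma wdisc_hesse a b :
  wdisc (hesseA a b) (hesseB a b) = 186624%:R * a ^+ 3 * hdisc a b ^+ 3.
Proof. by rewrite /wdisc /hesseA /hesseB /hdisc; ring. Qed.

(** The flexes (0 : 1 : -w) and (0 : 1 : -w^2) of the Hesse cubic have
    abscissa 3 b^2 on the Weierstrass model, and flex tangents satisfy m^2 = 3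
    x for the slope m. So 3 b is taken to be a root m of the equation of the
    slopes, which is the 3-division polynomial 3 x^4 + 6 A x^2 + 12 B x - A^2
    at x = m^2 / 3. Then a^3 is determined by A. *)
Lemma hesse_params A B : exists a b, A = hesseA a b /\ B = hesseB a b.
Proof.
(* For A = 0 the equation of the slopes has the root 0, where A / b makes no
   sense. *)
have [A0|nA] := eqVneq A 0.
  have [a ha] : exists a : K, a ^+ 6 = B / 11664%:R.
    by exists (6.-root (B / 11664%:R)); rewrite rootCK.
  exists a, 0; rewrite /hesseA /hesseB A0; split; first by ring.
  transitivity (11664%:R * a ^+ 6); last by ring.
  by rewrite ha mulrC mulfVK // pnatr_eq0.
have [m hm] := @solve_monicpoly K 8
  (fun i => [:: 27%:R * A ^+ 2; 0; - (108%:R * B); 0; - (18%:R * A); 0; 0; 0]`_i) isT.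
rewrite !big_ord_recr big_ord0 /= in hm.
have nm : m != 0.
  apply: contraNneq nA => m0; move: hm; rewrite m0 => /esym/eqP.
  rewrite !expr0n /= !(mulr0, mulr1, addr0, add0r) mulf_eq0 pnatr_eq0 /=.
  by rewrite expf_eq0.
set b := m / 3%:R; have mE : m = 3%:R * b by rewrite mulrC mulfVK ?pnatr_eq0.
have nb : b != 0 by rewrite mulf_neq0 ?invr_eq0 ?pnatr_eq0.
have [a ha] : exists a : K, a ^+ 3 = (A / (3%:R * b) + b ^+ 3) / 216%:R.
  by exists (3.-root ((A / (3%:R * b) + b ^+ 3) / 216%:R)); rewrite rootCK.
have AE : A = hesseA a b by rewrite /hesseA ha; field.
exists a, b; split=> //.
have n972 : (972%:R : K) * b ^+ 2 != 0 by rewrite mulf_neq0 ?expf_neq0 ?pnatr_eq0.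
apply: (mulfI n972).
(* As m^2 = 9 b^2, the equation of the slopes is linear in B with coefficient
   972 b^2. *)
transitivity (27%:R * A ^+ 2 - 18%:R * A * m ^+ 4 - m ^+ 8); last by rewrite mE AE /hesseA /hesseB; ring.
by rewrite hm mE; ring.
Qed.

Variable w : K.
Hypothesis hw : w ^+ 2 + w + 1 = 0.
Let th := 2%:R * w + 1.

Lemma theta2 : th ^+ 2 = - 3%:R.
Proof. by transitivity (4%:R * (w ^+ 2 + w + 1) - 3%:R); [rewrite /th; ring | rewrite hw; ring]. Qed.

Lemma theta_neq0 : th != 0.
Proof.
apply: contraTneq (isT : (true : bool)) => h; have := theta2; rewrite h expr0n /=.
by move/esym/eqP; rewrite oppr_eq0 pnatr_eq0.
Qed.

(** The third column is the tangent to the Hesse cubic at the origin, which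
    becomes the line at infinity; the second is the form y - z that changes
    sign under - 1; the first completes them so that the equation has no term
    in x^2 z. *)
Definition to_weier a b : 'M[K]_3 := rows3
  (vec3 (4%:R * hdisc a b - 3%:R * b ^+ 3) 0 (- b))
  (vec3 (9%:R * a * b ^+ 2) (12%:R * hdisc a b * th * a) (3%:R * a))
  (vec3 (9%:R * a * b ^+ 2) (- (12%:R * hdisc a b * th * a)) (3%:R * a)).

Lemma to_weier_unit a b : a != 0 -> hdisc a b != 0 -> to_weier a b \in unitmx.
Proof.
move=> na nd; apply: rows3_unit.
have -> : triple (vec3 (4%:R * hdisc a b - 3%:R * b ^+ 3) 0 (- b))
  (vec3 (9%:R * a * b ^+ 2) (12%:R * hdisc a b * th * a) (3%:R * a))
  (vec3 (9%:R * a * b ^+ 2) (- (12%:R * hdisc a b * th * a)) (3%:R * a))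
  = 288%:R * th * a ^+ 2 * hdisc a b ^+ 2.
  by rewrite /triple /cross !vec3E; ring.
by rewrite !mulf_neq0 ?expf_neq0 ?theta_neq0 ?pnatr_eq0.
Qed.

Lemma ev_to_weier a b v : ev (form (weier (hesseA a b) (hesseB a b))) (v *m to_weier a b)
  = - (1728%:R * a ^+ 2 * hdisc a b ^+ 2) * ev (form (hesse a b)) v.
Proof.
rewrite ev_weier ev_hesse mul_rows3 !mxE /=.
set x := v 0 0; set y := v 0 1; set z := v 0 2%:R.
set Y := x * _ + _ + _; set Z := x * _ + _ + _; set X := x * _ + _ + _.
(* Y = 12 theta (27 a^3 + b^3) a (y - z), where theta = 2 w + 1 is a square
   root of -3. *)
have -> : Y ^+ 2 = - 3%:R * (12%:R * hdisc a b * a * (y - z)) ^+ 2.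
  by rewrite -theta2 /Y; ring.
by rewrite /X /Z /hesseA /hesseB /hdisc; ring.
Qed.

Lemma vorig_to_weier a b : vorig K *m to_weier a b = vec3 0 (24%:R * hdisc a b * th * a) 0.
Proof.
rewrite mul_rows3 /vorig !vec3E; apply: row3P; rewrite !mxE /=; ring.
Qed.

End Weierstrass.

Lemma pt010E (K : fieldType) : pt010 K = pt (vec3 0 1 0).
Proof. by rewrite -[LHS]valK_pt. Qed.

(** * Hesse models of smooth cubics with a flex *)

Definition hesse_model (K : fieldType) (C : pcubic K) (M : 'M[K]_3) (a b : K) : Prop :=
  [/\ M \in unitmx,
      exists2 c, c != 0 & forall v, ev (form C) (v *m M) = c * ev (form (hesse a b)) v
    & orig C = act M (orig (hesse a b))].

Section Model.
Variable K : numClosedFieldType.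
Implicit Types (a b : K) (C : pcubic K).
Variable w : K.
Hypothesis hw : w ^+ 2 + w + 1 = 0.

Lemma weier_hesse_model A B a b : A = hesseA a b -> B = hesseB a b -> wdisc A B != 0 ->
  hesse_model (weier A B) (to_weier w a b) a b.
Proof.
move=> -> ->; rewrite wdisc_hesse => nz.
have na : a != 0 by apply: contraNneq nz => ->; rewrite expr0n /= mulr0 mul0r.
have nd : hdisc a b != 0 by apply: contraNneq nz => ->; rewrite expr0n /= mulr0.
split; first exact: to_weier_unit.
  exists (- (1728%:R * a ^+ 2 * hdisc a b ^+ 2)); last by move=> v; exact: ev_to_weier.
  by rewrite oppr_eq0 !mulf_neq0 ?expf_neq0 ?pnatr_eq0.
rewrite act_pt ?to_weier_unit ?vorig_neq0 // vorig_to_weier.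
set k := 24%:R * _ * _ * _; have nk : k != 0 by rewrite !mulf_neq0 ?theta_neq0 ?pnatr_eq0.
have -> : vec3 0 k 0 = k *: vec3 0 1 0 by apply: row3P; rewrite !mxE /= ?mulr0 ?mulr1.
by rewrite ptZ //; exact: pt010E.
Qed.

Variable C : pcubic K.
Hypothesis hom : form C \is 3.-homog.
Hypothesis sm : smooth_form (form C).
Hypothesis onO : on_curve C (orig C).
Hypothesis flexO : third C (orig C) (orig C) = orig C.

(** In the frame made of a tangent direction at the origin, the origin and a
    third point, the form is a multiple of x^3 on the line z = 0. This kills
    the coefficients of y^3, x^2 y and x y^2. *)
Lemma flex_frame : exists M c, [/\ M \in unitmx,
    forall v, ev (form C) (v *m M) = cubic_val c (v 0 0) (v 0 1) (v 0 2%:R),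
    [/\ c 0%N != 0, c 1%N = 0, c 3 = 0, c 6 = 0 & c 4 != 0]
  & act M (pt (vec3 0 1 0)) = orig C].
Proof.
have [ind hT] := tangent_vecP hom sm onO.
set T := tangent_vec C (orig C) in ind hT; set O := val (orig C) in ind hT.
have [W nW] := triple_ex ind; set M := rows3 T O W.
have uM : M \in unitmx by exact: rows3_unit.
have evO : ev (form C) O = 0 by apply/eqP.
have hTO : polar (form C) T O = 0 by exact (polar_of_flex hom sm onO ind hT flexO).
have nT : ev (form C) T != 0 by apply/eqP => h; exact: (no_line hom sm ind).
have nOW : polar (form C) O W != 0.
  have [y] := polar_neq0 sm (val_nz _) evO; apply: contra => /eqP hW.
  apply/eqP; apply: (mulfI nW); rewrite mulr0 -polarZr cramer -[X in polar _ _ (X + _)]scale1r.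
  by rewrite !polar_lincombr hT hW polar_diag // evO; ring.
have [c hc] := homog3E (comp_linear_homog M hom).
have evM x y z : ev (form C) (x *: T + y *: O + z *: W) = cubic_val c x y z.
  have := ev_comp_linear (form C) M (vec3 x y z).
  by rewrite hc ev_cubic mul_rows3 !vec3E.
have n2 : (2%:R : K) != 0 by rewrite pnatr_eq0.
have TO x y : cubic_val c x y 0 = x ^+ 3 * ev (form C) T.
  by rewrite -evM scale0r addr0 ev_lincomb // hTO hT evO; ring.
have OW y z : cubic_val c 0 y z = y ^+ 2 * z * polar (form C) O W + y * z ^+ 2 * polar (form C)
    W O + z ^+ 3 * ev (form C) W.
  by rewrite -evM scale0r add0r ev_lincomb // evO; ring.
have c0 : c 0%N = ev (form C) T.
  by transitivity (cubic_val c 1 0 0); [rewrite /cubic_val; ring | rewrite TO; ring].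
have c1 : c 1%N = 0.
  by transitivity (cubic_val c 0 1 0); [rewrite /cubic_val; ring | rewrite TO; ring].
have c3 : c 3 = 0.
  apply: (mulfI n2); rewrite mulr0; transitivity (cubic_val c 1 1 0 - cubic_val c 1 (-1) 0 - 2%:R * c 1%N).
    by rewrite /cubic_val; ring.
  by rewrite !TO c1; ring.
have c6 : c 6 = 0.
  apply: (mulfI n2); rewrite mulr0; transitivity (cubic_val c 1 1 0 + cubic_val c 1 (-1) 0 - 2%:R * c 0%N).
    by rewrite /cubic_val; ring.
  by rewrite !TO c0; ring.
have c2 : c 2 = ev (form C) W.
  by transitivity (cubic_val c 0 0 1); [rewrite /cubic_val; ring | rewrite OW; ring].
have c4 : c 4 = polar (form C) O W.
  apply: (mulfI n2); transitivity (cubic_val c 0 1 1 - cubic_val c 0 1 (-1) - 2%:R * c 2).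
    by rewrite /cubic_val; ring.
  by rewrite !OW c2; ring.
exists M, c; split=> //.
- by move=> v; rewrite mul_rows3.
- by rewrite c0 c4.
- rewrite act_pt ?vec3_eq0 ?oner_eq0 ?andbF //.
  by rewrite mul_rows3 !vec3E !scale0r add0r addr0 scale1r; exact: valK_pt.
Qed.

(** Completing the square in y and the cube in x; the factor k on y makes the
    coefficients of x^3 and y^2 z opposite. *)
Lemma weier_reduction (c : nat -> K) : c 0%N != 0 -> c 1%N = 0 -> c 3 = 0 -> c 6 = 0 -> c 4 != 0 ->
  exists M A B, [/\ M \in unitmx, forall v, let u := v *m M in
     cubic_val c (u 0 0) (u 0 1) (u 0 2%:R) = - c 0%N * ev (form (weier A B)) v
     & act M (pt (vec3 0 1 0)) = pt (vec3 0 1 0)].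
Proof.
move=> n0 c1 c3 c6 n4; set g := c 0%N in n0 *; set d := c 4 in n4.
have [k hk] : exists k, k ^+ 2 = - g / d by exists (sqrtC (- g / d)); rewrite sqrtCK.
have nk : k != 0.
  apply: contraNneq n0 => k0; move/eqP: hk; rewrite k0 expr0n /= eq_sym mulf_eq0 invr_eq0.
  by rewrite (negPf n4) orbF oppr_eq0.
(* p, q, r are the coefficients of x^2, x and 1 after completing the square in
   y, and e the shift of x. *)
pose p := c 8 - c 9 ^+ 2 / (4%:R * d).
pose q := c 5 - c 9 * c 7 / (2%:R * d).
pose r := c 2 - c 7 ^+ 2 / (4%:R * d).
pose e := - p / (3%:R * g).
pose M := rows3 (vec3 1 (- c 9 / (2%:R * d)) 0) (vec3 0 k 0)
  (vec3 e (- (c 9 * e + c 7) / (2%:R * d)) 1).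
have uM : M \in unitmx.
  apply: rows3_unit; rewrite /triple /cross !vec3E.
  by apply: contraNneq nk => <-; apply/eqP; ring.
exists M, ((q + 2%:R * p * e + 3%:R * g * e ^+ 2) / g), ((r + q * e + p * e ^+ 2 + g * e ^+ 3)
    / g); split=> //.
- move=> v u; rewrite ev_weier {}/u mul_rows3 !mxE /=.
  set x := v 0 0; set y := v 0 1; set z := v 0 2%:R.
  rewrite /cubic_val c1 c3 c6 -/g -/d.
  have hgd : g = - d * k ^+ 2 by rewrite hk; field.
  have he : p = - 3%:R * g * e by rewrite /e; field.
  rewrite {2}he.
  have n3 : c 8 = - 3%:R * g * e + c 9 ^+ 2 / (4%:R * d) by rewrite -he /p; ring.
  rewrite he n3 /q /r.
  rewrite hgd in n0 *; field.
  by rewrite n4 nk.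
- rewrite act_pt ?vec3_eq0 ?oner_eq0 ?andbF // mul_rows3 !vec3E !scale0r add0r addr0 scale1r.
  have -> : vec3 0 k 0 = k *: vec3 0 1 0 by apply: row3P; rewrite !mxE /= ?mulr0 ?mulr1.
  by rewrite ptZ.
Qed.

(** A smooth cubic with a flex has a Weierstrass form, which has a Hesse
    form. *)
Lemma hesse_model_ex : exists M a b, hesse_model C M a b.
Proof.
have [M1 [c [u1 ev1 [n0 c1 c3 c6 n4] o1]]] := flex_frame.
have [M2 [A [B [u2 ev2 o2]]]] := weier_reduction n0 c1 c3 c6 n4.
have evM v : ev (form (weier A B)) v = (- c 0%N)^-1 * ev (form C) (v *m (M2 *m M1)).
  by rewrite mulmxA ev1 ev2 mulKf ?oppr_eq0.
have u21 : M2 *m M1 \in unitmx by rewrite unitmx_mul u1 u2.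
have smW : smooth_form (form (weier A B)).
  apply: (smooth_transport (M := invmx (M2 *m M1)) (c := (- c 0%N)^-1) hom _ sm).
  - exact: cubic_form_homog.
  - by rewrite unitmx_inv.
  - by rewrite invr_eq0 oppr_eq0.
  - by move=> v; rewrite evM mulmxKV.
have [a [b [hA hB]]] := hesse_params A B.
have [u3 [k nk ev3] o3] := weier_hesse_model hA hB (wdisc_neq0 smW).
exists (to_weier w a b *m (M2 *m M1)), a, b; split.
- by rewrite unitmx_mul u3 u21.
- exists (- c 0%N * k); first by rewrite mulf_neq0 ?oppr_eq0.
  move=> v; rewrite -mulrA -ev3 evM mulVKf ?oppr_eq0 ?mulmxA //.
- apply: esym; apply: etrans (esym (act_mul _ u3 u21)) _.
  apply: etrans (congr1 (act _) (esym o3)) _; apply: etrans (esym (act_mul _ u2 u1)) _.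
  apply: etrans (congr1 (fun Q => act M1 (act M2 Q)) (pt010E K)) _.
  exact: etrans (congr1 (act M1) o2) o1.
Qed.

End Model.

(** * Curves with a Hesse model *)

Section ModelFacts.
Variables (K : numClosedFieldType) (w : K).
Hypothesis hw : w ^+ 2 + w + 1 = 0.
Variables (C : pcubic K) (M : 'M[K]_3) (a b : K).
Hypothesis hom : form C \is 3.-homog.
Hypothesis sm : smooth_form (form C).
Hypothesis mod : hesse_model C M a b.
Implicit Types (s t : 'I_3 * 'I_3) (P : P2 K).

Lemma model_unit : M \in unitmx. Proof. by case: mod. Qed.

Lemma model_smooth : smooth_form (form (hesse a b)).
Proof.
have [uM [c nc hc] _] := mod.
apply: (smooth_transport (M := invmx M) (c := c^-1) hom (hesse_homog a b) sm).
- by rewrite unitmx_inv.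
- by rewrite invr_eq0.
- by move=> v; rewrite -[v in RHS](mulmxKV uM) hc mulKf.
Qed.

Let smH := model_smooth.
Let homH := hesse_homog a b.
Let onO := on_hesse_orig a b.

Lemma model_torsion P : P \in torsion3 C <-> exists s, P = act M (tor w s).
Proof.
have [uM [c nc hc] o] := mod.
have key Q := torsion3_transport homH hom smH uM nc hc onO o Q.
split=> [|[s ->]]; last by apply/key/(torsion3_hesse hw smH); exists s.
rewrite -{1}(actKV uM P) => /key/(torsion3_hesse hw smH) [s e].
by exists s; rewrite -e actKV.
Qed.

Lemma model_addp s t :
  addp C (act M (tor w s)) (act M (tor w t)) = act M (tor w (s + t)).
Proof.
have [uM [c nc hc] o] := mod.
apply: etrans (congr1 (act M) (addp_hesse hw smH s t)).
have := addp_transport homH hom smH uM nc hc onO o (on_hesse_tor a b hw s) (on_hesse_tor a b hw t).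
exact.
Qed.

Lemma model_weil s t :
  weil3 C (act M (tor w s)) (act M (tor w t)) = wpow w (det2 s t).
Proof.
have [uM [c nc hc] o] := mod; apply: weil_constE.
exact: (weil_const_transport homH hom smH uM nc hc onO o (on_hesse_tor a b hw s)
  (on_hesse_tor a b hw t) (hesse_weil hw smH s t)).
Qed.

Lemma model_inj s t : act M (tor w s) = act M (tor w t) -> s = t.
Proof. by move=> h; exact: tor_inj hw _ _ (act_inj model_unit h). Qed.

Lemma model_orig : orig C = act M (tor w 0).
Proof. by have [_ _ ->] := mod; rewrite (tor0 hw). Qed.

End ModelFacts.

(** * Cubics and projectivities through the nine points *)

Section NinePoints.
Variables (K : numClosedFieldType) (w : K).
Hypothesis hw : w ^+ 2 + w + 1 = 0.
Implicit Types (s t : 'I_3 * 'I_3) (i j k : 'I_3) (v : 'rV[K]_3).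

(** A polynomial of degree 2 with the three roots 1, w, w^2 is zero. *)
Lemma wpow_vandermonde (x y z : K) :
  (forall j, x + y * wpow w j + z * wpow w j ^+ 2 = 0) -> [/\ x = 0, y = 0 & z = 0].
Proof.
move=> h; have n3 : (3%:R : K) != 0 by rewrite pnatr_eq0.
have := h 2%:R; have := h 1; have := h 0; rewrite /wpow /= expr0 expr1.
set e0 := (_ + _ + _); set e1 := (_ + _ + _); set e2 := (_ + _ + _) => h0 h1 h2.
have w3 := w3 hw.
have s5 : 1 + w ^+ 4 + w ^+ 5 = 0.
  transitivity ((w ^+ 2 + w + 1) * (w ^+ 3 - w + 1)); first by ring.
  by rewrite hw mul0r.
have s4 : 1 + w ^+ 2 + w ^+ 4 = 0.
  transitivity ((w ^+ 2 + w + 1) * (w ^+ 2 - w + 1)); first by ring.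
  by rewrite hw mul0r.
split; apply: (mulfI n3); rewrite mulr0.
- transitivity (e0 + e1 + e2 - (w ^+ 2 + w + 1) * y - (1 + w ^+ 2 + w ^+ 4) * z - (w - w) * z).
    by rewrite /e0 /e1 /e2; ring.
  by rewrite h0 h1 h2 hw s4; ring.
- transitivity (e0 + w ^+ 2 * e1 + w * e2 - (w ^+ 2 + w + 1) * x - (1 + w ^+ 4 + w ^+ 5) * z
    - (2%:R * w ^+ 3 - 2%:R) * y).
    by rewrite /e0 /e1 /e2; ring.
  by rewrite s5 w3 h0 h1 h2 hw; ring.
- transitivity (e0 + w * e1 + w ^+ 2 * e2 - (w ^+ 2 + w + 1) * x - (1 + w ^+ 2 + w ^+ 4) * y
    - (w ^+ 3 + (w ^+ 3) ^+ 2 - 2%:R) * z).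
    by rewrite /e0 /e1 /e2; ring.
  by rewrite s4 w3 h0 h1 h2 hw; ring.
Qed.

Lemma vtor_row0 j : vorig K *m transl w (0, j) = vec3 0 (wpow w j) (- wpow w j ^+ 2).
Proof.
have e : wpow w (j * 2%:R) = wpow w j ^+ 2 by rewrite expr2 -wpowD // mulr_natr mulr2n.
by apply: row3P; rewrite translE vec3E /= ?subr0 vorigE /= ?mulr1 ?e ?mulr0 // !(subrr, sub0r,
    mulr1, subr0, mulrN1, mulr0).
Qed.

Lemma vtor_row1 j : vorig K *m transl w (1, j) = vec3 (- 1) 0 (wpow w j ^+ 2).
Proof.
have e : wpow w (j * 2%:R) = wpow w j ^+ 2 by rewrite expr2 -wpowD // mulr_natr mulr2n.
apply: row3P; rewrite translE vec3E /= vorigE /=.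
- by rewrite mulr0 wpow0 mul1r sub0r.
- by rewrite ?subrr /= ?subrr ?mulr0.
- by rewrite e subr0 mulr1.
Qed.

Lemma vtor_row2 j : vorig K *m transl w (2%:R, j) = vec3 1 (- wpow w j) 0.
Proof.
apply: row3P; rewrite translE vec3E /= vorigE /=.
- by rewrite mulr0 wpow0 mul1r subr0.
- by rewrite mulr1 sub0r mulrN1.
- by rewrite subrr mulr0.
Qed.

(** Each side of the triangle x y z = 0 carries three of the nine points.
    Vanishing there gives, side by side, a polynomial of degree 2 in w^j with
    three zeros; together they leave only the coefficients of the Hesse
    pencil. *)
Lemma cubic_through_tor (p : {mpoly K[3]}) : p \is 3.-homog ->
  (forall s, ev p (vorig K *m transl w s) = 0) ->
  exists a b, forall v, ev p v = ev (form (hesse a b)) v.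
Proof.
move=> /homog3E [c ->] h.
have t3 j := wpow3 hw j.
have h0 j : (c 1%N - c 2) + (- c 4) * wpow w j + c 7 * wpow w j ^+ 2 = 0.
  rewrite -[RHS](h (0, j)) vtor_row0 ev_cubic !vec3E /cubic_val.
  transitivity (c 1%N * wpow w j ^+ 3 - c 2 * (wpow w j ^+ 3) ^+ 2 - c 4 * wpow w j ^+ 3 * wpow w j
     + c 7 * wpow w j ^+ 3 * wpow w j ^+ 2); last by ring.
  by rewrite t3; ring.
have h1 j : (c 2 - c 0%N) + (- c 5) * wpow w j + c 8 * wpow w j ^+ 2 = 0.
  rewrite -[RHS](h (1, j)) vtor_row1 ev_cubic !vec3E /cubic_val.
  transitivity (c 2 * (wpow w j ^+ 3) ^+ 2 - c 0%N - c 5 * wpow w j ^+ 3 * wpow w j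
     + c 8 * wpow w j ^+ 2); last by ring.
  by rewrite t3; ring.
have h2 j : (c 0%N - c 1%N) + (- c 3) * wpow w j + c 6 * wpow w j ^+ 2 = 0.
  rewrite -[RHS](h (2%:R, j)) vtor_row2 ev_cubic !vec3E /cubic_val.
  transitivity (c 0%N - c 1%N * wpow w j ^+ 3 - c 3 * wpow w j
     + c 6 * wpow w j ^+ 2); last by ring.
  by rewrite t3; ring.
have [/eqP e1 /eqP e4 e7] := wpow_vandermonde h0.
have [/eqP e2 /eqP e5 e8] := wpow_vandermonde h1.
have [_ /eqP e3 e6] := wpow_vandermonde h2.
rewrite !oppr_eq0 in e3 e4 e5; rewrite !subr_eq0 in e1 e2.
exists (c 0%N), (c 9) => v; rewrite ev_cubic ev_hesse /cubic_val.
by rewrite (eqP e1) (eqP e2) (eqP e3) (eqP e4) (eqP e5) e6 e7 e8; ring.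
Qed.

(** The nine points contain projective frames, four points with no three
    collinear, so a projectivity fixing all of them is the identity. *)
Lemma fixes_tor_scalar (N : 'M[K]_3) : N \in unitmx ->
  (forall s, act N (tor w s) = tor w s) -> exists2 c, c != 0 & N = c%:M.
Proof.
move=> uN h.
have ex s : exists c, vorig K *m transl w s *m N = c *: (vorig K *m transl w s).
  have := h s; rewrite /tor act_pt ?vtor_neq0 // => e.
  by have [c _ ec] := pt_eqP (mulmx_nz uN (vtor_neq0 hw s)) (vtor_neq0 hw s) e; exists c.
have t3 j := wpow3 hw j.
have h0 j : N 1 0 = wpow w j * N 2%:R 0 /\
  (N 2%:R 2%:R - N 1 1) + N 2%:R 1 * wpow w j + (- N 1 2%:R) * wpow w j ^+ 2 = 0.
  have [c] := ex (0, j); rewrite vtor_row0 => /rowP e.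
  have := e 0; have := e 1; have := e 2%:R; rewrite !mulmx3 !mxE /= => e2 e1 e0; split.
    apply: (mulfI (wpow_neq0 hw j)); apply/eqP; rewrite -subr_eq0; apply/eqP.
    by transitivity (c * 0); [rewrite -e0; ring | rewrite mulr0].
  transitivity ((c * wpow w j) * (- wpow w j ^+ 2) - (c * - wpow w j ^+ 2) * wpow w j); last by ring.
  rewrite -e1 -e2; transitivity (N 2%:R 2%:R * wpow w j ^+ 3 - N 1 1 * wpow w j ^+ 3
     + N 2%:R 1 * wpow w j ^+ 3 * wpow w j - N 1 2%:R * wpow w j ^+ 2); last by ring.
  by rewrite t3; ring.
have h2 j : N 0 2%:R = wpow w j * N 1 2%:R /\
  N 0 1 + (N 0 0 - N 1 1) * wpow w j + (- N 1 0) * wpow w j ^+ 2 = 0.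
  have [c] := ex (2%:R, j); rewrite vtor_row2 => /rowP e.
  have := e 0; have := e 1; have := e 2%:R; rewrite !mulmx3 !mxE /= => e2 e1 e0; split.
    apply/eqP; rewrite -subr_eq0; apply/eqP.
    by transitivity (c * 0); [rewrite -e2; ring | rewrite mulr0].
  transitivity (c * - wpow w j - (c * 1) * (- wpow w j)); last by ring.
  by rewrite -e1 -e0; ring.
have [/eqP d12 n21 /eqP n12] := wpow_vandermonde (fun j => (h0 j).2).
have [n01 /eqP d01 /eqP n10] := wpow_vandermonde (fun j => (h2 j).2).
rewrite oppr_eq0 in n12; rewrite oppr_eq0 in n10; rewrite subr_eq0 in d12; rewrite subr_eq0 in d01.
move: d12 n12 d01 n10 => /eqP d12 /eqP n12 /eqP d01 /eqP n10.
have n02 : N 0 2%:R = 0 by have [-> _] := h2 0; rewrite n12 mulr0.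
have n20 : N 2%:R 0 = 0 by have [] := h0 0; rewrite n10 wpow0 mul1r.
have e : N = (N 0 0)%:M.
  apply/matrixP; apply: ord3P; apply: ord3P; rewrite [RHS]mxE /= ?mulr1n ?mulr0n //.
  by rewrite d12.
exists (N 0 0) => //; apply: contraTneq uN => n00; rewrite e n00.
by rewrite unitmxE det_scalar expr0n /= unitr0.
Qed.

End NinePoints.

(** * Projectivities inducing the special linear group of the torsion *)

Section SpecialLinear.
Variables (K : numClosedFieldType) (w : K).
Hypothesis hw : w ^+ 2 + w + 1 = 0.
Implicit Types (s t : 'I_3 * 'I_3) (i j k : 'I_3) (v : 'rV[K]_3).

(** The Fourier transform on Z/3 exchanges shifts and multiplications by
    characters, up to a sign. *)
Definition fourier : 'M[K]_3 := \matrix_(l, k) wpow w (l * k).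
Definition quarter_turn s : 'I_3 * 'I_3 := (- s.2, s.1).
(** Multiplication by the Gaussian w^(k^2) shears the Heisenberg group: it
    fixes characters and turns a shift into a shift times a character. *)
Definition gauss : 'M[K]_3 := \matrix_(l, k) (wpow w (k * k) *+ (l == k)).
Definition shear s : 'I_3 * 'I_3 := (s.1, s.2 - s.1).

Lemma fourierE v k : (v *m fourier) 0 k = \sum_l wpow w (l * k) * v 0 l.
Proof. by rewrite mxE; apply: eq_bigr => l _; rewrite mxE mulrC. Qed.

Lemma gaussE v k : (v *m gauss) 0 k = wpow w (k * k) * v 0 k.
Proof.
rewrite mxE (bigD1 k) //= mxE eqxx mulr1n mulrC big1 ?addr0 // => l ne.
by rewrite mxE (negPf ne) mulr0n mulr0.
Qed.

Lemma transl_fourier s v : v *m transl w s *m fourier =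
  wpow w (s.1 * s.2) *: (v *m fourier *m transl w (quarter_turn s)).
Proof.
apply/rowP => k; rewrite [RHS]mxE translE !fourierE /=.
rewrite (reindex_inj (addrI s.1)) /= mulrA mulr_sumr; apply: eq_bigr => l _.
rewrite translE addrAC subrr add0r !mulrA -!wpowD //; congr (wpow w _ * _); ring.
Qed.

Lemma transl_gauss s v : exists2 c, c != 0 &
  v *m transl w s *m gauss = c *: (v *m gauss *m transl w (shear s)).
Proof.
exists (wpow w (- (s.1 * s.1))); first exact: wpow_neq0.
apply/rowP => k; rewrite [RHS]mxE translE !gaussE translE /= !mulrA -!wpowD //.
congr (wpow w _ * _); rewrite mulrBr mulrBl mulrBl.
have e2 : s.1 * k + s.1 * k = - (s.1 * k) by rewrite -[LHS]opprK ord3_addrr.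
apply/eqP; rewrite -subr_eq0; apply/eqP.
by transitivity (s.1 * k + s.1 * k + s.1 * k); [ring | rewrite e2 addNr].
Qed.

Definition realizable (f : 'I_3 * 'I_3 -> 'I_3 * 'I_3) :=
  exists2 N : 'M[K]_3, N \in unitmx & forall s, act N (tor w s) = tor w (f s).

(** N normalises the Heisenberg group and fixes the origin, so it permutes the
    nine points as it permutes the group. *)
Lemma realizable_of (N : 'M[K]_3) (d : K) f : N \in unitmx -> d != 0 ->
  vorig K *m N = d *: vorig K ->
  (forall s v, exists2 c, c != 0 & v *m transl w s *m N = c *: (v *m N *m transl w (f s))) ->
  realizable f.
Proof.
move=> uN nd hN h; exists N => // s; rewrite /tor act_pt ?vtor_neq0 //.
have [c nc ->] := h s (vorig K).
by rewrite ptZ // hN -scalemxAl ptZ.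
Qed.

Lemma realizable_fourier : realizable quarter_turn.
Proof.
have n3 : (3%:R : K) != 0 by rewrite pnatr_eq0.
have w4 : w ^+ 4 = w by rewrite (exprD w 3 1) w3 // mul1r expr1.
have uF : fourier \in unitmx.
  pose N : 'M[K]_3 := \matrix_(l, k) (3%:R^-1 * wpow w (- (l * k))).
  have h : fourier *m N = 1%:M.
    apply/matrixP => i k; rewrite mxE [RHS]mxE.
    transitivity (3%:R^-1 * \sum_(l : 'I_3) wpow w (i - k) ^+ (l : nat)).
      rewrite mulr_sumr; apply: eq_bigr => l _; rewrite !mxE mulrCA -wpowD //; congr (_ * _).
      rewrite /wpow -exprM -[RHS](expr_mod _ (w3 hw)); congr (w ^+ _).
      move: i k l; do 3!apply: ord3P; done.
    rewrite sum3 /= expr0 expr1 -(subr_eq0 i k); move: (i - k); apply: ord3P; rewrite /wpow /=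
        ?mulr1n ?mulr0n.
    - by field.
    - by rewrite expr1; transitivity (3%:R^-1 * (w ^+ 2 + w + 1)); [ring | rewrite hw mulr0].
    - rewrite -exprM w4; by transitivity (3%:R^-1 * (w ^+ 2 + w + 1)); [ring | rewrite hw mulr0].
  by have [] := mulmx1_unit h.
have nd : w - w ^+ 2 != 0.
  rewrite subr_eq0; apply/eqP => h; have := @wpow_inj _ _ hw 1 2%:R.
  by rewrite /wpow expr1 => /(_ h).
apply: (realizable_of uF nd); last first.
  by move=> s v; exists (wpow w (s.1 * s.2)); [exact: wpow_neq0 | exact: transl_fourier].
apply: row3P; rewrite fourierE sum3 !mxE /= /wpow /= ?expr0 ?expr1; ring.
Qed.

Lemma realizable_gauss : realizable shear.
Proof.
have uG : gauss \in unitmx.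
  pose N : 'M[K]_3 := \matrix_(l, k) (wpow w (- (k * k)) *+ (l == k)).
  have h : gauss *m N = 1%:M.
    apply: mulmx_ext => v; rewrite mulmxA mulmx1; apply/rowP => k.
    rewrite mxE (bigD1 k) //= [N k k]mxE eqxx mulr1n big1 ?addr0.
      by rewrite gaussE mulrC mulrA -wpowD // addNr wpow0 mul1r.
    by move=> l ne; rewrite [N l k]mxE (negPf ne) mulr0n mulr0.
  by have [] := mulmx1_unit h.
apply: (realizable_of uG (wpow_neq0 hw 1)); last exact: transl_gauss.
apply: row3P; rewrite gaussE [RHS]mxE vorigE /= ?subrr ?mulr0 //.
Qed.

Definition word_act (l : seq bool) s := foldr (fun c => if c then quarter_turn else shear) s l.

Lemma realizable_word l : realizable (word_act l).
Proof.
elim: l => [|c l [N uN hN]] /=.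
  by exists 1%:M => [|s]; [exact: unitmx1 | exact: act1].
have [N' uN' hN'] : realizable (if c then quarter_turn else shear).
  by case: c; [exact: realizable_fourier | exact: realizable_gauss].
exists (N *m N'); first by rewrite unitmx_mul uN.
by move=> s; rewrite -act_mul // hN hN'.
Qed.

Lemma word_actD l s t : word_act l (s + t) = word_act l s + word_act l t.
Proof.
elim: l => //= c l ->; case: c; rewrite /quarter_turn /shear; congr pair => /=; ring.
Qed.

Fixpoint words n : seq (seq bool) :=
  if n is n'.+1 then [::] :: [seq true :: l | l <- words n'] ++ [seq false :: l | l <- words n']
  else [:: [::]].

(** An explicit list, as the enumeration of a finite type does not reduce. *)
Definition all3 : seq 'I_3 := [:: 0; 1; 2%:R].

(** The quarter turn and the shear generate SL_2(F_3), and words of length at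
    most 7 reach all of its 24 elements. *)
Lemma sl2_words : all (fun p : 'I_3 => all (fun q : 'I_3 => all (fun i : 'I_3 => all (fun j : 'I_3 =>
  (p * j - q * i == 1) ==>
  has (fun l => (word_act l (1, 0) == (p, q)) && (word_act l (0, 1) == (i, j))) (words 7))
  all3) all3) all3) all3.
Proof. by vm_compute. Qed.

Lemma mem_all3 i : i \in all3. Proof. by move: i; apply: ord3P. Qed.

Lemma additive_pair (f : 'I_3 * 'I_3 -> 'I_3 * 'I_3) i j :
  (forall s t, f (s + t) = f s + f t) -> f (i, j) = f (1, 0) *+ i + f (0, 1) *+ j.
Proof.
move=> fD; have f0 : f 0 = 0 by apply: (addrI (f 0)); rewrite -fD !addr0.
have fM s n : f (s *+ n) = f s *+ n by elim: n => [|n IH] //; rewrite !mulrS fD IH.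
rewrite -!fM -fD; congr f.
by move: i j; do 2!apply: ord3P; apply/eqP.
Qed.

(** Every symplectic automorphism of the torsion comes from a projectivity:
    the generators are the Fourier transform and the Gaussian. *)
Lemma realizable_sl2 f : (forall s t, f (s + t) = f s + f t) ->
  det2 (f (1, 0)) (f (0, 1)) = 1 -> realizable f.
Proof.
move=> fD hd; move: hd (fun i j => additive_pair i j fD); case: (f (1, 0)) => p q; case: (f (0, 1)) => r r'.
rewrite /det2 /= => /eqP hd hf.
have := sl2_words => /allP/(_ p (mem_all3 p))/allP/(_ q (mem_all3 q)).
move=> /allP/(_ r (mem_all3 r))/allP/(_ r' (mem_all3 r')); rewrite hd => /hasP [l _ /andP[/eqP e1 /eqP e2]].
have [N uN hN] := realizable_word l; exists N => // -[i j].
by rewrite hN hf (additive_pair i j (word_actD l)) e1 e2.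
Qed.
End SpecialLinear.

(** * The pencil in Hesse form *)

Section Pencil.
Variables (K : numClosedFieldType) (w a b : K).
Hypothesis hw : w ^+ 2 + w + 1 = 0.
Hypothesis na : a != 0.
Hypothesis nb : b != 0.
Hypothesis nd : hdisc a b != 0.
Let q := 216%:R * a ^+ 3 - b ^+ 3.
Hypothesis nq : q != 0.
Let th := 2%:R * w + 1.
Let A := hesseA a b.
Let B := hesseB a b.
Let d := wdisc A B.
Implicit Types (u v : 'rV[K]_3) (s t : 'I_3 * 'I_3).

(** The same shape as [to_weier]: the second column is odd under - 1 and (0 :
    1 : -1) goes to (0 : 1 : 0). Its entries depend on the parameters of the
    Hesse model of E_0 only, so that it serves for all members of the
    pencil. *)
Definition to_pencil : 'M[K]_3 := rows3
  (vec3 (144%:R * a * hdisc a b * (b ^+ 3 - 54%:R * a ^+ 3)) 0 (6%:R * a))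
  (vec3 (3888%:R * a ^+ 3 * b * hdisc a b) (- (2%:R * th * b * q)) b)
  (vec3 (3888%:R * a ^+ 3 * b * hdisc a b) (2%:R * th * b * q) b).

Let th2 : th ^+ 2 = - 3%:R.
Proof. exact: theta2 hw. Qed.
Let nth : th != 0.
Proof. exact: theta_neq0 hw. Qed.

Lemma to_pencil_unit : to_pencil \in unitmx.
Proof.
apply: rows3_unit.
have -> : triple (vec3 (144%:R * a * hdisc a b * (b ^+ 3 - 54%:R * a ^+ 3)) 0 (6%:R * a))
  (vec3 (3888%:R * a ^+ 3 * b * hdisc a b) (- (2%:R * th * b * q)) b)
  (vec3 (3888%:R * a ^+ 3 * b * hdisc a b) (2%:R * th * b * q) b)
  = 576%:R * a * b ^+ 2 * th * hdisc a b * q ^+ 2.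
  by rewrite /triple /cross !vec3E /q; ring.
by rewrite !mulf_neq0 ?expf_neq0 ?pnatr_eq0.
Qed.

Definition pencil0 v := d * (v 0 1 ^+ 2 * v 0 2%:R)
  - (v 0 0 ^+ 3 - d * (v 0 0 * v 0 2%:R ^+ 2) - (2%:R * B * d) * v 0 2%:R ^+ 3).
Definition pencil_inf v := - (3%:R * (v 0 0 ^+ 2 * v 0 2%:R))
  - (18%:R * B) * (v 0 0 * v 0 2%:R ^+ 2) + 3%:R * (v 0 0 * v 0 1 ^+ 2) - d * v 0 2%:R ^+ 3.

Lemma pencil0_hesse v : pencil0 (v *m to_pencil) =
  12%:R ^+ 6 * a ^+ 3 * b ^+ 2 * hdisc a b ^+ 3 * q ^+ 2 * ev (form (hesse (- b) (18%:R * a))) v.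
Proof.
rewrite /pencil0 mul_rows3 !mxE /= ev_hesse /d wdisc_hesse.
set x := v 0 0; set y := v 0 1; set z := v 0 2%:R.
rewrite /B /hesseB /hdisc /q; ring: th2.
Qed.

Lemma pencil_inf_hesse v : pencil_inf (v *m to_pencil) =
  12%:R ^+ 4 * a * b ^+ 2 * hdisc a b * q ^+ 2 *
  ev (form (hesse (- (9%:R * a ^+ 2 * b)) (b ^+ 3 - 54%:R * a ^+ 3))) v.
Proof.
rewrite /pencil_inf mul_rows3 !mxE /= ev_hesse /d wdisc_hesse.
set x := v 0 0; set y := v 0 1; set z := v 0 2%:R.
rewrite /B /hesseB /hdisc /q; ring: th2.
Qed.

Definition phi_vec u : 'rV[K]_3 := vec3
  (- u 0 1 * (- (3%:R * A * u 0 0 ^+ 2) + 9%:R * B * u 0 0 * u 0 2%:R - 3%:R * A ^+ 2 * u 0 2%:R ^+ 2))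
  (A * u 0 2%:R * (3%:R * u 0 0 ^+ 2 + A * u 0 2%:R ^+ 2))
  (3%:R * u 0 0 * u 0 1 * u 0 2%:R).

Lemma phi_vecZ (c : K) u : phi_vec (c *: u) = c ^+ 3 *: phi_vec u.
Proof. by apply: row3P; rewrite !(vec3E, mxE) /=; ring. Qed.

(** What phi does to the indices of the torsion points; its determinant is
    -1. *)
Definition flip s : 'I_3 * 'I_3 := (s.1, - s.2).

Lemma pt_proportional u v : u 0 2%:R != 0 -> v 0 2%:R != 0 ->
  u 0 0 * v 0 2%:R = u 0 2%:R * v 0 0 -> u 0 1 * v 0 2%:R = u 0 2%:R * v 0 1 ->
  u != 0 /\ pt u = pt v.
Proof.
move=> nu nv h0 h1; split.
  by apply: contraNneq nu => ->; rewrite mxE.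
have -> : u = (u 0 2%:R / v 0 2%:R) *: v.
  apply: row3P; rewrite [RHS]mxE.
  - by rewrite mulrAC -h0 mulfK.
  - by rewrite mulrAC -h1 mulfK.
  - by rewrite mulfVK.
by apply: ptZ; rewrite mulf_neq0 ?invr_eq0.
Qed.

(** Here t = w^j, and the points are those of index (0, j) and (0, -j). The
    relation on t excludes t = 1, which is the origin, where phi_vec
    vanishes. *)
Lemma phi_vec_tor0 (t : K) : t ^+ 2 = - t - 1 -> t != 0 ->
  let u := phi_vec (vec3 0 t (- t ^+ 2) *m to_weier w a b) in
  let v := vec3 0 (t ^+ 2) (- t ^+ 4) *m to_pencil in
  [/\ u 0 2%:R != 0, v 0 2%:R != 0, u 0 0 * v 0 2%:R = u 0 2%:R * v 0 0
   & u 0 1 * v 0 2%:R = u 0 2%:R * v 0 1].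
Proof.
move=> ht nt u v.
have n2 : 2%:R * t + 1 != 0.
  apply: contraTneq (isT : true) => h.
  have : (2%:R * t + 1) ^+ 2 = - 3%:R by ring: ht.
  by rewrite h expr0n /= => /esym/eqP; rewrite oppr_eq0 pnatr_eq0.
have nn (n : nat) : (n.+1%:R : K) != 0 by rewrite pnatr_eq0.
rewrite /u /v !mul_rows3 /phi_vec !(vec3E, mxE) /= -/th; split.
- set P := _ * _.
  have -> : P = - (3%:R * (9%:R * a * b ^+ 2 * (2%:R * t + 1)) * (12%:R * hdisc a b * th * a) *
      (3%:R * a * (2%:R * t + 1))).
    by rewrite /P; ring: ht.
  by rewrite oppr_eq0 !mulf_neq0 ?expf_neq0.
- set P := _ + _; have -> : P = - b * (2%:R * t + 1) by rewrite /P; ring: ht.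
  by rewrite mulf_neq0 ?oppr_eq0.
- by rewrite /A /B /hesseA /hesseB /hdisc; ring: ht.
- by rewrite /A /B /hesseA /hesseB /q /hdisc; ring: ht th2.
Qed.

(** The points of index (1, j) and (1, -j), with t = w^j. *)
Lemma phi_vec_tor1 (t : K) : t ^+ 3 = 1 -> t != 0 ->
  let u := phi_vec (vec3 (- 1) 0 (t ^+ 2) *m to_weier w a b) in
  let v := vec3 (- 1) 0 (t ^+ 4) *m to_pencil in
  [/\ u 0 2%:R != 0, v 0 2%:R != 0, u 0 0 * v 0 2%:R = u 0 2%:R * v 0 0
   & u 0 1 * v 0 2%:R = u 0 2%:R * v 0 1].
Proof.
move=> ht nt u v.
have nn (n : nat) : (n.+1%:R : K) != 0 by rewrite pnatr_eq0.
have n1 : 3%:R * a * t ^+ 2 + b != 0.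
  apply: contraNneq nd => h.
  have -> : hdisc a b = (3%:R * a * t ^+ 2 + b) * (9%:R * a ^+ 2 * t ^+ 4 - 3%:R * a * b * t ^+ 2 + b ^+ 2).
    by rewrite /hdisc; ring: ht.
  by rewrite h mul0r.
have n2 : 6%:R * a * t ^+ 2 - b != 0.
  apply: contraNneq nq => h.
  have -> : q = (6%:R * a * t ^+ 2 - b) * (36%:R * a ^+ 2 * t ^+ 4 + 6%:R * a * b * t ^+ 2 + b ^+ 2).
    by rewrite /q; ring: ht.
  by rewrite h mul0r.
rewrite /u /v !mul_rows3 /phi_vec !(vec3E, mxE) /= -/th; split.
- set P := _ * _.
  have -> : P = 3%:R * ((6%:R * a * t ^+ 2 - b) ^+ 2 * (3%:R * a * t ^+ 2 + b)) * (12%:R *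
      hdisc a b * th * a * t ^+ 2) * (3%:R * a * t ^+ 2 + b).
    by rewrite /P /hdisc; ring: ht.
  by rewrite !mulf_neq0 ?expf_neq0.
- set P := _ + _; have -> : P = - t * (6%:R * a * t ^+ 2 - b) by rewrite /P; ring: ht.
  by rewrite mulf_neq0 ?oppr_eq0.
- by rewrite /A /B /hesseA /hesseB /hdisc; ring: ht.
- by rewrite /A /B /hesseA /hesseB /q /hdisc; ring: ht th2.
Qed.

(** The points of index (2, j) and (2, -j), with t = w^j. *)
Lemma phi_vec_tor2 (t : K) : t ^+ 3 = 1 -> t != 0 ->
  let u := phi_vec (vec3 1 (- t) 0 *m to_weier w a b) in
  let v := vec3 1 (- t ^+ 2) 0 *m to_pencil in
  [/\ u 0 2%:R != 0, v 0 2%:R != 0, u 0 0 * v 0 2%:R = u 0 2%:R * v 0 0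
   & u 0 1 * v 0 2%:R = u 0 2%:R * v 0 1].
Proof.
move=> ht nt u v.
have nn (n : nat) : (n.+1%:R : K) != 0 by rewrite pnatr_eq0.
have n1 : 3%:R * a * t + b != 0.
  apply: contraNneq nd => h.
  have -> : hdisc a b = (3%:R * a * t + b) * (9%:R * a ^+ 2 * t ^+ 2 - 3%:R * a * b * t + b ^+ 2).
    by rewrite /hdisc; ring: ht.
  by rewrite h mul0r.
have n2 : 6%:R * a * t - b != 0.
  apply: contraNneq nq => h.
  have -> : q = (6%:R * a * t - b) * (36%:R * a ^+ 2 * t ^+ 2 + 6%:R * a * b * t + b ^+ 2).
    by rewrite /q; ring: ht.
  by rewrite h mul0r.
rewrite /u /v !mul_rows3 /phi_vec !(vec3E, mxE) /= -/th; split.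
- set P := _ * _.
  have -> : P = 3%:R * ((6%:R * a * t - b) ^+ 2 * (3%:R * a * t + b)) * (12%:R * hdisc a b * th
      * a * t) * (3%:R * a * t + b).
    by rewrite /P /hdisc; ring: ht.
  by rewrite !mulf_neq0 ?expf_neq0.
- set P := _ + _; have -> : P = t ^+ 2 * (6%:R * a * t - b) by rewrite /P; ring: ht.
  by rewrite mulf_neq0 ?expf_neq0.
- by rewrite /A /B /hesseA /hesseB /hdisc; ring: ht.
- by rewrite /A /B /hesseA /hesseB /q /hdisc; ring: ht th2.
Qed.

End Pencil.

(** * Extension of scalars *)

Section MapPt.
Variables (K L : fieldType) (f : {rmorphism K -> L}).

Lemma map_pnormal (v : 'rV[K]_3) : pnormal (map_mx f v) = map_mx f (pnormal v).
Proof.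
rewrite /pnormal.
have -> : [pick i | map_mx f v 0 i != 0] = [pick i | v 0 i != 0].
  by apply: eq_pick => i; rewrite mxE fmorph_eq0.
by case: pickP => [i _|_]; rewrite ?map_mx0 // map_mxZ mxE fmorphV.
Qed.

Lemma val_map_pt (P : P2 K) : val (map_pt f P) = map_mx f (val P).
Proof.
rewrite /map_pt ptE; first by rewrite map_pnormal; case: P => v /= /andP[_ /eqP ->].
by rewrite map_mx_eq0 val_nz.
Qed.

Lemma map_pt_inj : injective (map_pt f).
Proof.
by move=> P Q /(congr1 val); rewrite !val_map_pt => /map_mx_inj h; apply: val_inj.
Qed.

Lemma map_pt_pt (v : 'rV[K]_3) : v != 0 -> map_pt f (pt v) = pt (map_mx f v).
Proof.
move=> nz; apply: val_inj; rewrite val_map_pt !ptE ?map_mx_eq0 //.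
by rewrite map_pnormal.
Qed.

Lemma map_vec3 (a b c : K) : map_mx f (vec3 a b c) = vec3 (f a) (f b) (f c).
Proof. by apply: row3P; rewrite !mxE. Qed.

Lemma map_pt010 : map_pt f (pt010 K) = pt010 L.
Proof. by apply: val_inj; rewrite val_map_pt map_vec3 rmorph0 rmorph1. Qed.

Lemma map_act (M : 'M[K]_3) P : M \in unitmx ->
  map_pt f (act M P) = act (map_mx f M) (map_pt f P).
Proof.
by move=> uM; rewrite !actE map_pt_pt ?mulmx_nz ?val_nz // map_mxM val_map_pt.
Qed.

Lemma map_cubic_form (c : nat -> K) :
  map_mpoly f (cubic_form c) = cubic_form (fun i => f (c i)).
Proof.
rewrite /cubic_form raddf_sum; apply: eq_bigr => i _ /=.
by rewrite map_mpolyZ map_mpolyX.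
Qed.

End MapPt.

Lemma cubic_form_eq (K : fieldType) (c d : nat -> K) :
  (forall i, (i < 10)%N -> c i = d i) -> cubic_form c = cubic_form d.
Proof. by move=> h; apply: eq_bigr => i _; rewrite h. Qed.

Lemma homog_XXX (K : fieldType) (i j l : 'I_3) :
  'X_i * 'X_j * 'X_l \is [in K[3], 3.-homog].
Proof.
have h k : 'X_k \is [in K[3], 1.-homog] by rewrite dhomogX; apply/eqP; exact: mdeg1.
exact: dhomogM (dhomogM (h i) (h j)) (h l).
Qed.

Lemma homog_X3 (K : fieldType) (i : 'I_3) : 'X_i ^+ 3 \is [in K[3], 3.-homog].
Proof. by rewrite exprS expr2 mulrA homog_XXX. Qed.

(** * Coefficients of the given cubics *)

Section Forms.
Variables (k : fieldExtType rat) (A B : k).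

Lemma numfield_two_neq0 : (2%:R : k) != 0.
Proof.
have h : (2%:R : rat) != 0 by [].
by rewrite -(rmorph_nat (in_alg k)) fmorph_eq0.
Qed.

Lemma F0_homog : F0_form A B \is 3.-homog.
Proof.
rewrite /F0_form; apply: rpredB; [|apply: rpredB; [apply: rpredB|]].
- by apply: rpredZ; rewrite expr2 homog_XXX.
- exact: homog_X3.
- by apply: rpredZ; rewrite expr2 mulrA homog_XXX.
- by apply: rpredZ; exact: homog_X3.
Qed.

Lemma Finf_homog : Finf_form A B \is 3.-homog.
Proof.
rewrite /Finf_form; apply: rpredB; [apply: rpredD; [apply: rpredB|]|].
- by rewrite rpredN; apply: rpredZ; rewrite expr2 homog_XXX.
- by apply: rpredZ; rewrite expr2 mulrA homog_XXX.
- by apply: rpredZ; rewrite expr2 mulrA homog_XXX.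
- by apply: rpredZ; exact: homog_X3.
Qed.

Lemma E0_homog : form (E0 A B) \is 3.-homog.
Proof.
rewrite /E0 [form _]/=; apply: rpredB; [|apply: rpredD; [apply: rpredD|]].
- by rewrite expr2 homog_XXX.
- exact: homog_X3.
- by apply: rpredZ; rewrite expr2 mulrA homog_XXX.
- by apply: rpredZ; exact: homog_X3.
Qed.

Lemma E0_cubic : form (E0 A B) = cubic_form (fun i => [:: -1; 0; - B; 0; 1; - A]`_i).
Proof.
apply: (cubic_ext numfield_two_neq0 E0_homog (cubic_form_homog _)) => v.
rewrite ev_cubic /cubic_val /= /ev.
rewrite mevalB !mevalD !mevalZ !mevalM !mevalXU.
ring.
Qed.

Let d := delta A B.

Lemma F0_cubic : F0_form A B =
  cubic_form (fun i => [:: -1; 0; 2%:R * B * d; 0; d; d]`_i).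
Proof.
apply: (cubic_ext numfield_two_neq0 F0_homog (cubic_form_homog _)) => v.
rewrite ev_cubic /cubic_val /= /ev /F0_form -/d.
rewrite !mevalB !mevalZ !mevalM !mevalXU.
ring.
Qed.

Lemma Finf_cubic : Finf_form A B =
  cubic_form (fun i => [:: 0; 0; - d; 0; 0; - (18%:R * B); 3%:R; 0; - 3%:R]`_i).
Proof.
apply: (cubic_ext numfield_two_neq0 Finf_homog (cubic_form_homog _)) => v.
rewrite ev_cubic /cubic_val /= /ev /Finf_form -/d.
rewrite !(mevalB, mevalD) mevalN !mevalZ !mevalM !mevalXU.
ring.
Qed.
End Forms.

(** * The map phi on torsion points *)

(** Checked on the three sides of the triangle x y z = 0 separately. *)
Lemma phi_tor (K : numClosedFieldType) (w a b : K) s :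
  w ^+ 2 + w + 1 = 0 -> a != 0 -> b != 0 -> hdisc a b != 0 -> 216%:R * a ^+ 3 - b ^+ 3 != 0 ->
  s != 0 ->
  pt (phi_vec a b (val (act (to_weier w a b) (tor w s)))) = act (to_pencil w a b) (tor w (flip s)).
Proof.
move=> hw na nb nd nq ns.
have uh : to_weier w a b \in unitmx by exact: to_weier_unit.
have ug : to_pencil w a b \in unitmx by exact: to_pencil_unit.
have e1 : act (to_weier w a b) (tor w s) = pt (vorig K *m transl w s *m to_weier w a b).
  exact: act_pt uh (vtor_neq0 hw s).
have e2 : act (to_pencil w a b) (tor w (flip s)) = pt (vorig K *m transl w (flip s) *m to_pencil w a b).
  exact: act_pt ug (vtor_neq0 hw _).
rewrite e1 e2; set u := _ *m to_weier w a b.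
have [c nc ->] := val_pt (mulmx_nz uh (vtor_neq0 hw s) : u != 0).
rewrite phi_vecZ ptZ ?expf_neq0 // /u; move: ns {e1 e2 u c nc}; case: s => i j ns.
have eN : wpow w (- j) = wpow w j ^+ 2 by rewrite expr2 -wpowD // -[in LHS](ord3_addrr j) opprK.
have eN2 : (wpow w j ^+ 2) ^+ 2 = wpow w j ^+ 4 by rewrite -exprM.
have nt := wpow_neq0 hw j.
move: i ns; apply: ord3P => ns; rewrite /flip /=.
- rewrite !vtor_row0 // eN eN2.
  have ht : wpow w j ^+ 2 = - wpow w j - 1.
    have nt1 : wpow w j - 1 != 0.
      rewrite subr_eq0 -(wpow0 w) (inj_eq (wpow_inj hw)).
      by apply: contra ns => /eqP ->.
    apply: (mulfI nt1); transitivity (wpow w j ^+ 3 - wpow w j ^+ 2); first by ring.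
    by rewrite wpow3 //; ring.
  by have [h1 h2 h3 h4] := phi_vec_tor0 hw na nb nd ht nt; have [] := pt_proportional h1 h2 h3 h4.
- rewrite !vtor_row1 // eN eN2.
  by have [h1 h2 h3 h4] := phi_vec_tor1 hw na nd nq (wpow3 hw j) nt; have [] := pt_proportional h1 h2 h3 h4.
- rewrite !vtor_row2 // eN.
  by have [h1 h2 h3 h4] := phi_vec_tor2 hw na nd nq (wpow3 hw j) nt; have [] := pt_proportional h1 h2 h3 h4.
Qed.

Section NumberFieldCurves.
Variables (k : fieldExtType rat) (iota : {rmorphism k -> algC}).

Lemma elliptic_geom (C : pcubic k) : elliptic iota C ->
  [/\ form C \is 3.-homog, form (geom iota C) \is 3.-homog, smooth_form (form (geom iota C)),
   on_curve (geom iota C) (orig (geom iota C))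
   & third (geom iota C) (orig (geom iota C)) (orig (geom iota C)) = orig (geom iota C)].
Proof.
case=> hom sm onO fl; split=> //.
have [c e] := homog3E hom.
by rewrite /geom /base_change [form _]/= e map_cubic_form cubic_form_homog.
Qed.

Variables (A B : k).
Let al := iota A.
Let be := iota B.

Lemma iota_delta : iota (delta A B) = wdisc al be.
Proof. by rewrite /delta /wdisc rmorphD !rmorphM !rmorph_nat -/al -/be; ring. Qed.

Lemma geom_E0 : geom iota (E0 A B) = weier al be.
Proof.
rewrite /geom /base_change; congr PCubic; last exact: map_pt010.
rewrite E0_cubic map_cubic_form; apply: cubic_form_eq => i.
by case: i => [|[|[|[|[|[|i]]]]]] _ /=; rewrite ?nth_nil ?rmorphN ?rmorph1 ?rmorph0.
Qed.

Lemma ev_geom_F0 v : ev (map_mpoly iota (F0_form A B)) v =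
  wdisc al be * (v 0 1 ^+ 2 * v 0 2%:R)
  - (v 0 0 ^+ 3 - wdisc al be * (v 0 0 * v 0 2%:R ^+ 2) - (2%:R * be * wdisc al be) * v 0 2%:R ^+ 3).
Proof.
rewrite F0_cubic map_cubic_form ev_cubic /cubic_val /=.
rewrite !(rmorphN, rmorphM, rmorph1, rmorph0, rmorph_nat) iota_delta -/be.
ring.
Qed.

Lemma ev_geom_Finf v : ev (map_mpoly iota (Finf_form A B)) v =
  - (3%:R * (v 0 0 ^+ 2 * v 0 2%:R)) - (18%:R * be) * (v 0 0 * v 0 2%:R ^+ 2)
  + 3%:R * (v 0 0 * v 0 1 ^+ 2) - wdisc al be * v 0 2%:R ^+ 3.
Proof.
rewrite Finf_cubic map_cubic_form ev_cubic /cubic_val /=.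
rewrite !(rmorphN, rmorphM, rmorph1, rmorph0, rmorph_nat) iota_delta -/be.
ring.
Qed.

Lemma ev_geom_Ft t v : ev (form (geom iota (Ft A B t))) v =
  if t is Some t then ev (map_mpoly iota (F0_form A B)) v + iota t * ev (map_mpoly iota (Finf_form A B)) v
  else ev (map_mpoly iota (Finf_form A B)) v.
Proof.
case: t => [t|] //; rewrite /geom /base_change /Ft [form _]/= rmorphD /= map_mpolyZ.
by rewrite /ev mevalD mevalZ.
Qed.

Lemma polar_geom_F0 u v : polar (map_mpoly iota (F0_form A B)) u v =
  (- 3%:R * u 0 0 ^+ 2 + wdisc al be * u 0 2%:R ^+ 2) * v 0 0
  + 2%:R * wdisc al be * u 0 1 * u 0 2%:R * v 0 1
  + (wdisc al be * u 0 1 ^+ 2 + 2%:R * wdisc al be * u 0 0 * u 0 2%:R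
     + 6%:R * be * wdisc al be * u 0 2%:R ^+ 2) * v 0 2%:R.
Proof.
rewrite F0_cubic map_cubic_form polar_cubic /=.
rewrite !(rmorphN, rmorphM, rmorph1, rmorph0, rmorph_nat) iota_delta -/be.
ring.
Qed.

Hypothesis hE0 : elliptic iota (E0 A B).
Hypothesis hA : A != 0.

Let nal : al != 0. Proof. by rewrite /al fmorph_eq0. Qed.

Lemma E0_wdisc_neq0 : wdisc al be != 0.
Proof. by have [_ _ sm _ _] := elliptic_geom hE0; rewrite geom_E0 in sm; exact: wdisc_neq0 sm. Qed.
Let nd := E0_wdisc_neq0.

(** At a singular point with z = 1 the derivatives give y = 0, x = - 3 B and
    then 4 A^3 = 0. *)
Lemma F0_smooth : smooth_form (form (geom iota (F0 A B))).
Proof.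
rewrite /geom /base_change [form _]/= => v nz _.
have key w : polar (map_mpoly iota (F0_form A B)) v w != 0 -> exists i, ((map_mpoly iota
    (F0_form A B))^`M(i)).@[v 0] != 0.
  exact: polar_neq0_partial.
have n3 (n : nat) : (n.+1%:R : algC) != 0 by rewrite pnatr_eq0.
have [h0|/key //] := eqVneq (polar (map_mpoly iota (F0_form A B)) v (vec3 1 0 0)) 0.
have [h1|/key //] := eqVneq (polar (map_mpoly iota (F0_form A B)) v (vec3 0 1 0)) 0.
have [h2|/key //] := eqVneq (polar (map_mpoly iota (F0_form A B)) v (vec3 0 0 1)) 0.
case/negP: nz; move: h0 h1 h2; rewrite !polar_geom_F0 !vec3E.
rewrite -[v]vec3K vec3_eq0 !vec3E; set x := v 0 0; set y := v 0 1; set z := v 0 2%:R; set D := wdisc al be.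
rewrite !(mulr0, mulr1, addr0, add0r) => h0 h1 h2.
have z0 : z = 0.
  apply/eqP/negPn/negP => nz.
  have y0 : y = 0.
    by move/eqP: h1; rewrite !mulf_eq0 (negPf (n3 1%N)) (negPf nd) (negPf nz) !orbF => /eqP.
  have hx : x = - 3%:R * be * z.
    have n2d : 2%:R * D * z != 0 by rewrite !mulf_neq0.
    apply: (mulfI n2d); apply/eqP; rewrite -subr_eq0; apply/eqP.
    by rewrite -[RHS]h2 y0; ring.
  have : 4%:R * al ^+ 3 * z ^+ 2 = 0 by rewrite -h0 hx /D /wdisc; ring.
  by apply/eqP; rewrite !mulf_neq0 ?expf_neq0.
have x0 : x = 0.
  by move/eqP: h0; rewrite z0 expr0n /= mulr0 addr0 mulf_eq0 oppr_eq0 (negPf (n3 2)) /= expf_eq0 /= => /eqP.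
have y0 : y = 0.
  by move/eqP: h2; rewrite z0 expr0n /= !mulr0 !addr0 mulf_eq0 (negPf nd) /= expf_eq0 /= => /eqP.
by rewrite x0 y0 z0 eqxx.
Qed.

Lemma F0_elliptic : elliptic iota (F0 A B).
Proof.
have o : orig (geom iota (F0 A B)) = pt010 algC by exact: map_pt010.
have vo : val (orig (geom iota (F0 A B))) = vec3 0 1 0 by rewrite o.
have hom : form (geom iota (F0 A B)) \is 3.-homog.
  by rewrite /geom /base_change [form _]/= F0_cubic map_cubic_form cubic_form_homog.
have onO : on_curve (geom iota (F0 A B)) (orig (geom iota (F0 A B))).
  rewrite on_curveE vo [ev _ _]ev_geom_F0 !vec3E; apply/eqP; ring.
split; [exact: F0_homog | exact: F0_smooth | exact: onO |].
apply: (@flex_of_polar _ _ hom F0_smooth _ (vec3 1 0 0) onO); rewrite vo.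
- by rewrite /cross !vec3E vec3_eq0 !(mul0r, mulr0, mulr1, subr0) oner_eq0 !andbF.
- by rewrite [polar _ _ _]polar_geom_F0 !vec3E; ring.
- by rewrite [polar _ _ _]polar_geom_F0 !vec3E; ring.
Qed.

Section Torsion.
Variables (w a b : algC).
Hypothesis hw : w ^+ 2 + w + 1 = 0.
Hypothesis ha : al = hesseA a b.
Hypothesis hb : be = hesseB a b.

(** A = 0 is the exceptional case: then b (216 a^3 - b^3) = 0 and [to_pencil]
    degenerates. *)
Lemma params_neq0 : [/\ a != 0, b != 0, hdisc a b != 0 & 216%:R * a ^+ 3 - b ^+ 3 != 0].
Proof.
have := nd; rewrite ha hb wdisc_hesse => nz; have := nal; rewrite ha => nA.
split.
- by apply: contraNneq nz => ->; rewrite expr0n /= mulr0 mul0r.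
- by apply: contraNneq nA => ->; rewrite /hesseA mulr0 mul0r.
- by apply: contraNneq nz => ->; rewrite expr0n /= mulr0.
- by apply: contraNneq nA => h; rewrite /hesseA h mulr0.
Qed.

Lemma E0_model : hesse_model (geom iota (E0 A B)) (to_weier w a b) a b.
Proof. by rewrite geom_E0; exact: weier_hesse_model. Qed.

Lemma Ft_model t : exists a' b', hesse_model (geom iota (Ft A B t)) (to_pencil w a b) a' b'.
Proof.
have [na nb nh nq] := params_neq0.
have e0 v : ev (map_mpoly iota (F0_form A B)) (v *m to_pencil w a b) =
    pencil0 a b (v *m to_pencil w a b) by rewrite ev_geom_F0 ha hb.
have e1 v : ev (map_mpoly iota (Finf_form A B)) (v *m to_pencil w a b) =
    pencil_inf a b (v *m to_pencil w a b) by rewrite ev_geom_Finf ha hb.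
have ug : to_pencil w a b \in unitmx by exact: to_pencil_unit.
have og : orig (geom iota (Ft A B t)) = act (to_pencil w a b) (pt (vorig algC)).
  rewrite act_pt ?vorig_neq0 // (_ : orig _ = pt010 algC); last exact: map_pt010.
  set c := - (4%:R * (2%:R * w + 1) * b * (216%:R * a ^+ 3 - b ^+ 3)).
  have nc : c != 0 by rewrite oppr_eq0 !mulf_neq0 ?theta_neq0 ?pnatr_eq0.
  have -> : vorig algC *m to_pencil w a b = c *: vec3 0 1 0.
    rewrite mul_rows3 /vorig !vec3E; apply: row3P; rewrite !mxE /= /c; ring.
  by rewrite ptZ //; exact: pt010E.
set c0 := 12%:R ^+ 6 * a ^+ 3 * b ^+ 2 * hdisc a b ^+ 3 * (216%:R * a ^+ 3 - b ^+ 3) ^+ 2.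
set c1 := 12%:R ^+ 4 * a * b ^+ 2 * hdisc a b * (216%:R * a ^+ 3 - b ^+ 3) ^+ 2.
case: t og => [t|] og.
  exists (c0 * (- b) + iota t * c1 * - (9%:R * a ^+ 2 * b)),
    (c0 * (18%:R * a) + iota t * c1 * (b ^+ 3 - 54%:R * a ^+ 3)).
  split=> //; exists 1; first exact: oner_neq0.
  move=> v; rewrite ev_geom_Ft e0 e1 pencil0_hesse // pencil_inf_hesse // -/c0 -/c1.
  by rewrite !ev_hesse; ring.
exists (c1 * - (9%:R * a ^+ 2 * b)), (c1 * (b ^+ 3 - 54%:R * a ^+ 3)).
split=> //; exists 1; first exact: oner_neq0.
move=> v; rewrite ev_geom_Ft e1 pencil_inf_hesse // -/c1.
by rewrite !ev_hesse; ring.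
Qed.

Lemma phi_torsion s :
  phi iota A B (act (to_weier w a b) (tor w s)) = act (to_pencil w a b) (tor w (flip s)).
Proof.
have [na nb nh nq] := params_neq0.
have [_ _ oE] := E0_model; have [a' [b' [_ _ oF]]] := Ft_model None.
have t0 : pt (vorig algC) = tor w 0 by rewrite (tor0 hw).
have oE' : pt010 algC = act (to_weier w a b) (tor w 0).
  by rewrite -t0 -[RHS]oE; apply: esym; exact: map_pt010.
have oF' : pt010 algC = act (to_pencil w a b) (tor w 0).
  by rewrite -t0 -[RHS]oF; apply: esym; exact: map_pt010.
rewrite /phi; case: eqP => [e|ne].
  have -> : s = 0.
    apply: (tor_inj hw); apply: (act_inj (to_weier_unit hw na nh)).
    exact: etrans e oE'.
  by rewrite /flip /= oppr0.
have ns : s != 0 by apply/eqP => s0; apply: ne; rewrite s0.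
by rewrite -(phi_tor hw na nb nh nq ns) /phi_vec -ha -hb.
Qed.

End Torsion.
End NumberFieldCurves.

(** * Elements fixed by the Galois group *)

(** A primitive element generates the image of k together with x; the roots of
    its minimal polynomial over the rationals generate L. *)
Lemma galois_closure_in_algC (k : fieldExtType rat) (iota : {rmorphism k -> algC}) (x : algC) :
  exists (L : splittingFieldType rat) (LC : {rmorphism L -> algC}) (j : {lrmorphism k -> L}),
    (forall a, iota a = LC (j a)) /\ exists y, x = LC y.
Proof.
pose b0 := vbasis {:k}.
have [z _ /sig_eqW[[|px ps] // [Dx Ds]]] := algC_PET (x :: map iota b0).
have [p [_ mon_p] /(_ p) pz0] := minCpolyP z; rewrite dvdpp in pz0.
have [r Dr] := closed_field_poly_normal (map_poly ratr p : {poly algC}).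
rewrite lead_coef_map (monicP mon_p) rmorph1 scale1r in Dr.
have rz : z \in r by rewrite -root_prod_XsubC -Dr.
have [Qr [QrC [rr Drr genQr]]] := num_field_exists r.
have QrC_poly (f : {poly rat}) : map_poly QrC (map_poly (in_alg Qr) f) = map_poly ratr f.
  rewrite -map_poly_comp; apply: eq_map_poly => a.
  by rewrite /= rmorphZ_num rmorph1 mulr1.
have [zz Dz] : {zz | QrC zz = z}.
  by move: rz; rewrite -Drr => /mapP/sig2_eqW[zz]; exists zz.
have splitQr : SplittingField.axiom Qr.
  exists (map_poly (in_alg Qr) p).
    by apply/polyOverP=> i; rewrite coef_map memvZ ?memv_line.
  exists rr => //.
  congr (_ %= _): (eqpxx (map_poly (in_alg Qr) p)); apply/(map_poly_inj QrC).
  rewrite QrC_poly Dr -Drr big_map rmorph_prod /=; apply: eq_bigr => u _.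
  by rewrite map_polyXsubC.
have jP a : {y | iota a = QrC y}.
  exists (\sum_i coord b0 i a *: (map_poly (in_alg Qr) ps`_i).[zz]).
  rewrite {1}(coord_vbasis (memvf a)) !rmorph_sum /=; apply: eq_bigr => i _.
  rewrite 2!rmorphZ_num -(nth_map _ 0) ?size_tuple // Ds.
  rewrite -horner_map Dz QrC_poly (nth_map 0) //.
  by have:= congr1 size Ds; rewrite !size_map size_tuple => <-.
pose j a := sval (jP a).
have Dj a : iota a = QrC (j a) by rewrite /j; case: (jP a).
pose rwM := (=^~ Dj, rmorphZ_num, rmorph1, rmorphB, rmorphM).
have ja : zmod_morphism j.
  by move=> ? ?; apply: (fmorph_inj QrC); rewrite !rwM.
have jm : monoid_morphism j.
  by split; try move=> ? ?; apply: (fmorph_inj QrC); rewrite !rwM /= ?rwM.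
have jl : scalable j.
  by try move=> ? ?; apply: (fmorph_inj QrC); rewrite !rwM.
pose jaM := GRing.isZmodMorphism.Build _ _ j ja.
pose jmM := GRing.isMonoidMorphism.Build _ _ j jm.
pose jlM := GRing.isScalable.Build _ _  _ _ j jl.
pose jLRM : {lrmorphism _ -> _} := HB.pack j jaM jmM jlM.
pose L : splittingFieldType rat :=
  HB.pack Qr (FieldExt_isSplittingField.Build rat Qr splitQr).
exists L, QrC, jLRM; split=> //.
exists (map_poly (in_alg Qr) px).[zz].
by rewrite -horner_map Dz QrC_poly Dx.
Qed.

(** The Galois correspondence in a finite Galois extension containing k and x;
    its automorphisms extend to algC. *)
Lemma galois_fixed (k : fieldExtType rat) (iota : {rmorphism k -> algC}) (x : algC) :
  (forall sigma : {rmorphism algC -> algC},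
     (forall a, sigma (iota a) = iota a) -> sigma x = x) ->
  exists a, x = iota a.
Proof.
move=> fix_x; have [L [LC [j [Dj [y Dy]]]]] := galois_closure_in_algC iota x.
pose lj := linfun j; pose K := (lj @: fullv)%VS.
have memK u : reflect (exists a, u = j a) (u \in K).
  apply: (iffP memv_imgP) => [[a _ ->] | [a ->]];
    by exists a; rewrite ?lfunE ?memvf.
have algK : is_aspace K.
  rewrite /is_aspace has_algid1; last by apply/memK; exists 1; rewrite rmorph1.
  apply/prodvP=> _ _ /memK[y1 ->] /memK[y2 ->].
  by apply/memK; exists (y1 * y2); rewrite rmorphM.
pose KA := ASpace algK.
have galK : galois KA {:L}.
  apply/and3P; split; [exact: subvf | | exact: normalFieldf].
  apply/separableP => u _; apply: pcharf0_separable => p.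
  by rewrite (fmorph_pchar (in_alg L)) pchar_num.
suffices /memK [a ya] : y \in K by exists a; rewrite Dy ya Dj.
rewrite -[K]/(KA : {vspace L}) -(galois_fixedField galK).
apply/(fixedFieldP (memvf y)) => g gG.
have [nu Dnu] := extend_algC_subfield_aut LC (g : {rmorphism L -> L}).
apply: (fmorph_inj LC); rewrite [LHS](Dnu y) -Dy fix_x // => a.
rewrite Dj -[LHS](Dnu (j a)); congr (LC _).
by apply: (fixed_gal (subvf KA) gG); apply/memK; exists a.
Qed.

(** * The map phi is an anti-symplectic isomorphism *)

Lemma map_pt_ptE (K L : fieldType) (f : {rmorphism K -> L}) (v : 'rV[K]_3) :
  map_pt f (pt v) = pt (map_mx f v).
Proof.
have [->|nz] := eqVneq v 0; last exact: map_pt_pt.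
by rewrite map_mx0 !pt_0 map_pt010.
Qed.

Lemma omega_ex : exists w : algC, w ^+ 2 + w + 1 = 0.
Proof.
exists ((- 1 + sqrtC (- 3%:R)) / 2%:R); set r := sqrtC _.
have hr : r ^+ 2 = - 3%:R by rewrite sqrtCK.
by transitivity ((r ^+ 2 + 3%:R) / 4%:R); [field | rewrite hr addNr mul0r].
Qed.

Lemma det2_flip s t : det2 (flip s) (flip t) = - det2 s t.
Proof. by rewrite /det2 /flip /=; ring. Qed.

Lemma flipK s : flip (flip s) = s.
Proof. by case: s => i j; rewrite /flip /= opprK. Qed.

Lemma flipD s t : flip (s + t) = flip s + flip t.
Proof. by rewrite /flip /= opprD. Qed.

Lemma map_to_weier_rows (K L : fieldType) (f : {rmorphism K -> L}) (w a b : K) :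
  let h := 27%:R * a ^+ 3 + b ^+ 3 in let h' := 27%:R * f a ^+ 3 + f b ^+ 3 in
  [/\ f (4%:R * h - 3%:R * b ^+ 3) = 4%:R * h' - 3%:R * f b ^+ 3,
      f (9%:R * a * b ^+ 2) = 9%:R * f a * f b ^+ 2,
      f (12%:R * h * (2%:R * w + 1) * a) = 12%:R * h' * (2%:R * f w + 1) * f a
    & f (3%:R * a) = 3%:R * f a].
Proof.
by rewrite /= !(rmorphN, rmorphB, rmorphD, rmorphM, rmorph_nat, rmorph1).
Qed.

Section MapTorsion.
Variables (sigma : {rmorphism algC -> algC}) (w : algC).
Hypothesis hw : w ^+ 2 + w + 1 = 0.

Lemma omega_map : sigma w ^+ 2 + sigma w + 1 = 0.
Proof. by rewrite -(rmorph1 sigma) -rmorphXn -!rmorphD hw rmorph0. Qed.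

Lemma map_vtor s :
  map_mx sigma (vorig algC *m transl w s) = vorig algC *m transl (sigma w) s.
Proof.
rewrite map_mxM /vorig map_vec3 rmorph0 rmorph1 rmorphN1; congr (_ *m _).
by apply/matrixP => l m; rewrite !mxE rmorphMn /= /wpow rmorphXn.
Qed.

(** Conjugation moves the root of unity w and keeps the index. *)
Lemma map_tor s : map_pt sigma (tor w s) = tor (sigma w) s.
Proof. by rewrite /tor map_pt_ptE map_vtor. Qed.

Lemma map_rows3 (u v x : 'rV[algC]_3) :
  map_mx sigma (rows3 u v x) = rows3 (map_mx sigma u) (map_mx sigma v) (map_mx sigma x).
Proof.
by apply/matrixP => l m; rewrite !mxE; move: l; apply: ord3P; rewrite /= mxE.
Qed.

Lemma map_to_weier a b :
  map_mx sigma (to_weier w a b) = to_weier (sigma w) (sigma a) (sigma b).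
Proof.
rewrite /to_weier map_rows3 !map_vec3 /hdisc !rmorph0 !rmorphN.
by have [-> -> -> ->] := map_to_weier_rows sigma w a b.
Qed.
End MapTorsion.

Lemma map_phi_vec (K L : fieldType) (f : {rmorphism K -> L}) (a b X Y Z : K) :
  map_mx f (vec3 (- Y * (- (3%:R * a * X ^+ 2) + 9%:R * b * X * Z - 3%:R * a ^+ 2 * Z ^+ 2))
    (a * Z * (3%:R * X ^+ 2 + a * Z ^+ 2)) (3%:R * X * Y * Z)) =
  vec3 (- f Y * (- (3%:R * f a * f X ^+ 2) + 9%:R * f b * f X * f Z - 3%:R * f a ^+ 2 * f Z ^+ 2))
    (f a * f Z * (3%:R * f X ^+ 2 + f a * f Z ^+ 2)) (3%:R * f X * f Y * f Z).
Proof.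
rewrite map_vec3; congr vec3;
  by rewrite !(rmorphXn, rmorph_nat, rmorphB, rmorphD, rmorphM, rmorphN).
Qed.

Section PhiGalois.
Variables (k : fieldExtType rat) (iota : {rmorphism k -> algC}) (A B : k).
Variable sigma : {rmorphism algC -> algC}.
Hypothesis fix_k : forall a, sigma (iota a) = iota a.

Lemma phi_galois P : phi iota A B (map_pt sigma P) = map_pt sigma (phi iota A B P).
Proof.
rewrite /phi; case: eqP => [e|ne]; case: eqP => [e'|ne'].
- by rewrite map_pt010.
- by case: ne'; apply: (map_pt_inj (f := sigma)); rewrite e map_pt010.
- by case: ne; rewrite e' map_pt010.
by rewrite map_pt_ptE map_phi_vec val_map_pt !mxE !fix_k.
Qed.
End PhiGalois.

Section PhiAntisymplectic.
Variables (k : fieldExtType rat) (iota : {rmorphism k -> algC}) (A B : k).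
Hypothesis hE0 : elliptic iota (E0 A B).
Hypothesis hA : A != 0.

(** phi is [flip] on indices: a bijective homomorphism of determinant -1,
    which inverts w ^ det. *)
Lemma phi_antisymplectic t : elliptic iota (Ft A B t) ->
  antisymplectic_iso iota (E0 A B) (Ft A B t) (phi iota A B).
Proof.
move=> hF; have [w hw] := omega_ex.
have [a [b [ha hb]]] := hesse_params (iota A) (iota B).
have [_ homE smE _ _] := elliptic_geom hE0; have [_ homF smF _ _] := elliptic_geom hF.
have mE := E0_model hE0 hw ha hb.
have [a' [b' mF]] := Ft_model hE0 hA hw ha hb t.
have phiE := phi_torsion hE0 hA hw ha hb.
have tE P := model_torsion hw homE smE mE P.
have tF P := model_torsion hw homF smF mF P.
have key s : phi iota A B (act (to_weier w a b) (tor w s)) \in torsion3 (geom iota (Ft A B t)).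
  by apply/tF; exists (flip s); exact: phiE.
split; first split.
- by move=> P /tE [s ->].
- move=> P Q /tE [s ->] /tE [u ->] e; congr act; congr tor.
  have e2 := etrans (etrans (esym (phiE s)) e) (phiE u).
  by rewrite -(flipK s) (model_inj hw mF e2) flipK.
- move=> Q /tF [s ->]; exists (act (to_weier w a b) (tor w (flip s))).
    by apply/tE; exists (flip s).
  by apply: etrans (phiE _) _; rewrite flipK.
- move=> P Q /tE [s ->] /tE [u ->].
  apply: etrans (congr1 _ (model_addp hw homE smE mE s u)) _.
  apply: etrans (phiE _) _; rewrite flipD.
  apply: etrans (esym (model_addp hw homF smF mF (flip s) (flip u))) _.
  exact (congr2 (addp (geom iota (Ft A B t))) (esym (phiE s)) (esym (phiE u))).
- by move=> sigma fix_k P _; exact: phi_galois.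
- move=> P Q /tE [s ->] /tE [u ->].
  apply: etrans (congr2 (weil3 (geom iota (Ft A B t))) (phiE s) (phiE u)) _.
  apply: etrans (model_weil hw homF smF mF (flip s) (flip u)) _.
  apply: etrans _ (congr1 _ (esym (model_weil hw homE smE mE s u))).
  rewrite det2_flip; apply: (mulIf (wpow_neq0 hw (det2 s u))).
  by rewrite mulVf ?wpow_neq0 // -wpowD // addNr.
Qed.
End PhiAntisymplectic.

(** * Curves anti-symplectically congruent to E_0 *)

Section ActAlgebra.
Variable K : fieldType.
Implicit Types (M N G : 'M[K]_3) (X : P2 K).

(** Two matrices agree at N X exactly when a conjugate of their quotient fixes
    X. *)
Lemma act_fix_conj M M' N X : M \in unitmx -> M' \in unitmx -> N \in unitmx ->
  act M' (act N X) = act M (act N X) -> act (N *m M' *m invmx M *m invmx N) X = X.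
Proof.
move=> uM uM' uN h; have uMi : invmx M \in unitmx by rewrite unitmx_inv.
have uNi : invmx N \in unitmx by rewrite unitmx_inv.
have u1 : N *m M' \in unitmx by rewrite unitmx_mul uN.
have u2 : N *m M' *m invmx M \in unitmx by rewrite unitmx_mul u1.
rewrite -(act_mul _ u2 uNi) -(act_mul _ u1 uMi) -(act_mul _ uN uM') h.
by rewrite (actK uM) (actK uN).
Qed.

Lemma conj_scalar (c : K) M M' N : M \in unitmx -> N \in unitmx ->
  N *m M' *m invmx M *m invmx N = c%:M -> M' = c *: M.
Proof.
move=> uM uN h; apply: (can_inj (mulKmx uN)).
have e : N *m M' *m invmx M = c *: N.
  by rewrite -[LHS](mulmxKV uN) h mul_scalar_mx.
by rewrite -[LHS](mulmxKV uM) e -scalemxAl scalemxAr.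
Qed.

Lemma act_transfer M N G X : M \in unitmx -> N \in unitmx -> G \in unitmx ->
  act (invmx M *m invmx N *m G) (act M (act N X)) = act G X.
Proof.
move=> uM uN uG; have uMi : invmx M \in unitmx by rewrite unitmx_inv.
have uNi : invmx N \in unitmx by rewrite unitmx_inv.
have u1 : invmx M *m invmx N \in unitmx by rewrite unitmx_mul uMi.
by rewrite -(act_mul _ u1 uG) -(act_mul _ uMi uNi) (actK uM) (actK uN).
Qed.

Lemma actZl (c : K) M X : c != 0 -> act (c *: M) X = act M X.
Proof. by move=> nc; apply: (actZ nc) => v; rewrite scalemxAr. Qed.
End ActAlgebra.

Lemma map_hesseAB (K L : numClosedFieldType) (f : {rmorphism K -> L}) a b :
  f (hesseA a b) = hesseA (f a) (f b) /\ f (hesseB a b) = hesseB (f a) (f b).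
Proof.
rewrite /hesseA /hesseB.
by rewrite !(rmorphXn, rmorph_nat, rmorphB, rmorphD, rmorphM, rmorphN).
Qed.

Lemma ev_map (K L : fieldType) (f : {rmorphism K -> L}) (p : {mpoly K[3]}) v :
  p \is 3.-homog -> ev (map_mpoly f p) (map_mx f v) = f (ev p v).
Proof.
move=> /homog3E [c ->]; rewrite map_cubic_form !ev_cubic /cubic_val !mxE.
by rewrite !(rmorphXn, rmorphD, rmorphM).
Qed.

Lemma evZD (K : fieldType) (p q : {mpoly K[3]}) (c : K) v :
  ev (p + c *: q) v = ev p v + c * ev q v.
Proof. by rewrite /ev mevalD mevalZ. Qed.

Lemma evZl (K : fieldType) (p : {mpoly K[3]}) (c : K) v : ev (c *: p) v = c * ev p v.
Proof. by rewrite /ev mevalZ. Qed.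

Section Descent.
Variables (k : fieldExtType rat) (iota : {rmorphism k -> algC}).

(** The quotients of the entries by a nonzero entry are fixed by the Galois
    group. *)
Lemma matrix_descent (M : 'M[algC]_3) : M \in unitmx ->
  (forall sigma : {rmorphism algC -> algC}, (forall a, sigma (iota a) = iota a) ->
     exists c, map_mx sigma M = c *: M) ->
  exists M0 : 'M[k]_3, exists2 c, c != 0 & M0 \in unitmx /\ M = c *: map_mx iota M0.
Proof.
move=> uM h.
have [[i j] nij] : exists ij : 'I_3 * 'I_3, M ij.1 ij.2 != 0.
  apply/existsP; rewrite -negb_forall; apply: contraL uM => /forallP z.
  have -> : M = 0 by apply/matrixP => i j; rewrite mxE; apply/eqP; exact: (z (i, j)).
  by rewrite unitmxE det0 unitr0.
rewrite /= in nij.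
have /fin_all_exists [f hf] : forall lm : 'I_3 * 'I_3, exists a, M lm.1 lm.2 / M i j = iota a.
  case=> l m; apply: galois_fixed => sigma hs.
  have [c /matrixP e] := h sigma hs.
  have eij := e i j; have elm := e l m; rewrite !mxE in eij elm.
  rewrite fmorph_div eij elm -mulf_div divff ?mul1r //.
  by apply: contraTneq nij => c0; move: eij; rewrite c0 mul0r => /eqP; rewrite fmorph_eq0 negbK.
have e : M = M i j *: map_mx iota (\matrix_(l, m) f (l, m)).
  by apply/matrixP => l m; rewrite !mxE -hf mulrC mulfVK.
exists (\matrix_(l, m) f (l, m)), (M i j) => //; split=> //.
by rewrite -(map_unitmx iota) -(unitmxZ _ (_ : M i j \is a GRing.unit)) ?unitfE // -e.
Qed.

End Descent.

Section Membership.
Variables (k : fieldExtType rat) (iota : {rmorphism k -> algC}) (A B : k).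
Hypothesis hE0 : elliptic iota (E0 A B).
Hypothesis hA : A != 0.
Variable F : pcubic k.
Hypothesis hF : elliptic iota F.
Variable psi : P2 algC -> P2 algC.
Hypothesis hpsi : antisymplectic_iso iota (E0 A B) F psi.

Local Notation E := (geom iota (E0 A B)).
Local Notation GF := (geom iota F).

Section Model.
Variables (w a b : algC) (M1 : 'M[algC]_3) (a1 b1 : algC).
Hypothesis hw : w ^+ 2 + w + 1 = 0.
Hypothesis ha : iota A = hesseA a b.
Hypothesis hb : iota B = hesseB a b.
Hypothesis mF : hesse_model GF M1 a1 b1.

Let h := to_weier w a b.
Let g := to_pencil w a b.
Let homE : form E \is 3.-homog. Proof. by case: (elliptic_geom hE0). Qed.
Let smE : smooth_form (form E). Proof. by case: (elliptic_geom hE0). Qed.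
Let homF : form GF \is 3.-homog. Proof. by case: (elliptic_geom hF). Qed.
Let smF : smooth_form (form GF). Proof. by case: (elliptic_geom hF). Qed.
Let mE : hesse_model E h a b. Proof. exact (E0_model hE0 hw ha hb). Qed.

Let u1 : M1 \in unitmx. Proof. by case: mF. Qed.
Let ug : g \in unitmx.
Proof. by have [na nb nh nq] := params_neq0 hE0 hA ha hb; exact: to_pencil_unit. Qed.

Lemma E0_torsion s : act h (tor w s) \in torsion3 E.
Proof. by apply/(model_torsion hw homE smE mE); exists s. Qed.

(** The pairing is w ^ det on both curves, so inverting it amounts to negating
    det. *)
Lemma psi_index : exists f : 'I_3 * 'I_3 -> 'I_3 * 'I_3,
  [/\ forall s, psi (act h (tor w s)) = act M1 (tor w (f s)),
      forall s t, f (s + t) = f s + f t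
    & forall s t, det2 (f s) (f t) = - det2 s t].
Proof.
have [[maps _ _ psiD _] psiW] := hpsi.
have /fin_all_exists [f hf] : forall s, exists t, psi (act h (tor w s)) = act M1 (tor w t).
  by move=> s; apply/(model_torsion hw homF smF mF); apply: maps; exact: E0_torsion.
exists f; split=> [//|s t|s t].
  apply: (model_inj hw mF).
  refine (etrans (esym (hf (s + t))) _).
  refine (etrans (congr1 psi (esym (model_addp hw homE smE mE s t))) _).
  refine (etrans (psiD _ _ (E0_torsion s) (E0_torsion t)) _).
  refine (etrans (congr2 (addp GF) (hf s) (hf t)) _).
  exact (model_addp hw homF smF mF (f s) (f t)).
apply: (wpow_inj hw).
refine (etrans (esym (model_weil hw homF smF mF (f s) (f t))) _).
refine (etrans (congr2 (weil3 GF) (esym (hf s)) (esym (hf t))) _).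
refine (etrans (psiW _ _ (E0_torsion s) (E0_torsion t)) _).
refine (etrans (congr1 GRing.inv (model_weil hw homE smE mE s t)) _).
by apply: (mulIf (wpow_neq0 hw (det2 s t))); rewrite mulVf ?wpow_neq0 // -wpowD // addNr.
Qed.

(** psi o phi^-1 preserves det on indices, so a matrix N permuting the nine
    points induces it. Through the Hesse models, the inverse of N becomes M.
    As the pulled back equation of F vanishes at the nine points, it lies in
    the Hesse pencil, that is, in the span of the equations of F_0 and
    F_oo. *)
Lemma transfer_matrix : exists M (l m : algC),
  [/\ M \in unitmx,
      forall s, act M (psi (act h (tor w s))) = phi iota A B (act h (tor w s)),
      act M (orig GF) = pt010 algC
    & forall v, ev (form GF) v = l * ev (map_mpoly iota (F0_form A B)) (v *m M)
        + m * ev (map_mpoly iota (Finf_form A B)) (v *m M)].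
Proof.
have [na nb nh nq] := params_neq0 hE0 hA ha hb.
have [f [hf fD fdet]] := psi_index.
have [N uN hN] : realizable w (fun s => f (flip s)).
  apply: (realizable_sl2 hw) => [s t|]; first by rewrite flipD fD.
  by rewrite fdet det2_flip opprK; apply: val_inj.
pose M := invmx M1 *m invmx N *m g.
have uM : M \in unitmx by rewrite !unitmx_mul !unitmx_inv u1 uN.
have key s : act M (psi (act h (tor w s))) = phi iota A B (act h (tor w s)).
  refine (etrans (congr1 (act M) (hf s)) _).
  refine (etrans (congr1 (fun t => act M (act M1 (tor w (f t)))) (esym (flipK s))) _).
  refine (etrans (congr1 (fun X => act M (act M1 X)) (esym (hN (flip s)))) _).
  refine (etrans (act_transfer _ u1 uN ug) _).
  exact (esym (phi_torsion hE0 hA hw ha hb s)).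
have hom2 := comp_linear_homog (N *m M1) homF.
have van s : ev (form GF \mPo [tuple \sum_j (N *m M1) j i *: 'X_j | i < 3]) (vorig algC *m transl w s) = 0.
  rewrite ev_comp_linear; apply/eqP.
  have nz := mulmx_nz (_ : N *m M1 \in unitmx) (vtor_neq0 hw s).
  rewrite -(on_curve_pt homF) ?nz ?unitmx_mul ?uN //.
  have -> : pt (vorig algC *m transl w s *m (N *m M1)) = act M1 (tor w (f (flip s))).
    refine (etrans _ (congr1 (act M1) (hN s))).
    refine (etrans _ (esym (act_mul _ uN u1))).
    refine (esym (act_pt _ (vtor_neq0 hw s))).
    by rewrite unitmx_mul uN.
  have /torsion3E [] : act M1 (tor w (f (flip s))) \in torsion3 GF; last by [].
  by apply/(model_torsion hw homF smF mF); exists (f (flip s)).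
have [a' [b' hp]] := cubic_through_tor hw hom2 van.
pose q : algC := 216%:R * a ^+ 3 - b ^+ 3.
pose c0 := 12%:R ^+ 6 * a ^+ 3 * b ^+ 2 * hdisc a b ^+ 3 * q ^+ 2.
pose c1 := 12%:R ^+ 4 * a * b ^+ 2 * hdisc a b * q ^+ 2.
have nc0 : c0 != 0 by rewrite !mulf_neq0 ?expf_neq0 ?pnatr_eq0.
have nc1 : c1 != 0 by rewrite !mulf_neq0 ?expf_neq0 ?pnatr_eq0.
(* The equations of F_0 and F_oo pull back to c0 (- b, 18 a) and c1 (- 9 a^2
   b, b^3 - 54 a^3) in the Hesse pencil; these have determinant b q up to c0
   c1, and l, m solve the linear system by Cramer's rule. *)
pose l := (a' * (b ^+ 3 - 54%:R * a ^+ 3) + 9%:R * a ^+ 2 * b * b') / (c0 * b * q).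
pose m := (- b * b' - 18%:R * a * a') / (c1 * b * q).
exists M, l, m; split=> //.
  have o : orig GF = act M1 (tor w (f 0)).
    have f0 : f 0 = 0 by apply: (addrI (f 0)); rewrite -fD !addr0.
    by rewrite f0; exact (model_orig hw mF).
  refine (etrans (congr1 (act M) (etrans o (esym (hf 0)))) _).
  refine (etrans (key 0) _).
  refine (etrans (congr1 (phi iota A B) (esym (model_orig hw mE))) _).
  have -> : orig E = pt010 algC by exact (map_pt010 iota).
  by rewrite /phi eqxx.
move=> v; pose u := v *m invmx M1 *m invmx N.
have vE : v = u *m (N *m M1) by rewrite mulmxA mulmxKV // mulmxKV.
have vM : v *m M = u *m g by rewrite /M !mulmxA.
have e0 : ev (map_mpoly iota (F0_form A B)) (u *m g) = c0 * ev (form (hesse (- b) (18%:R * a))) u.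
  by refine (etrans _ (pencil0_hesse a b hw u)); rewrite ev_geom_F0 ha hb.
have e1 : ev (map_mpoly iota (Finf_form A B)) (u *m g) =
    c1 * ev (form (hesse (- (9%:R * a ^+ 2 * b)) (b ^+ 3 - 54%:R * a ^+ 3))) u.
  by refine (etrans _ (pencil_inf_hesse a b hw u)); rewrite ev_geom_Finf ha hb.
rewrite vM e0 e1 [in LHS]vE -ev_comp_linear hp !ev_hesse.
have ea : a' = l * c0 * - b + m * c1 * - (9%:R * a ^+ 2 * b).
  by rewrite /l /m /q; field; rewrite nq nc0 nc1 nb.
have eb : b' = l * c0 * (18%:R * a) + m * c1 * (b ^+ 3 - 54%:R * a ^+ 3).
  by rewrite /l /m /q; field; rewrite nq nc0 nc1 nb.
by rewrite ea eb; ring.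
Qed.

(** As psi and phi commute with sigma, both M and its conjugate carry psi (P)
    to phi (P) for all torsion points P. These psi (P) are the nine points of
    a Hesse model of F, so the two matrices differ by a scalar. *)
Lemma transfer_galois (M : 'M[algC]_3) (sigma : {rmorphism algC -> algC}) : M \in unitmx ->
  (forall s, act M (psi (act h (tor w s))) = phi iota A B (act h (tor w s))) ->
  (forall x, sigma (iota x) = iota x) -> exists c, map_mx sigma M = c *: M.
Proof.
move=> uM hM hs.
have [[_ _ surj _ psiG] _] := hpsi.
have hw' := omega_map sigma hw.
have ha' : iota A = hesseA (sigma a) (sigma b) by rewrite -(map_hesseAB sigma a b).1 -ha hs.
have hb' : iota B = hesseB (sigma a) (sigma b) by rewrite -(map_hesseAB sigma a b).2 -hb hs.
have uh : h \in unitmx by case: mE.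
have stab s : map_pt sigma (act h (tor w s)) \in torsion3 E.
  apply/(model_torsion hw' homE smE (E0_model hE0 hw' ha' hb')); exists s.
  refine (etrans (map_act sigma _ uh) _).
  refine (etrans (congr1 (fun N => act N _) (map_to_weier sigma w a b)) _).
  exact (congr1 (act _) (map_tor sigma w s)).
have tE P : P \in torsion3 E -> exists s, P = act h (tor w s).
  by move/(model_torsion hw homE smE mE).
have hM' P : P \in torsion3 E -> act M (psi P) = phi iota A B P.
  by case/tE => s ->; exact (hM s).
have us1 : map_mx sigma M1 \in unitmx by rewrite map_unitmx.
have usM : map_mx sigma M \in unitmx by rewrite map_unitmx.
have fix_tor s : act (map_mx sigma M1 *m map_mx sigma M *m invmx M *m invmx (map_mx sigma M1))
    (tor (sigma w) s) = tor (sigma w) s.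
  apply: (act_fix_conj uM usM us1).
  have ex : act M1 (tor w s) \in torsion3 GF.
    by apply/(model_torsion hw homF smF mF); exists s.
  have [P tP eP] := surj _ ex; have [u eu] := tE _ tP.
  have e1 : act (map_mx sigma M1) (tor (sigma w) s) = psi (map_pt sigma P).
    refine (etrans (congr1 (act _) (esym (map_tor sigma w s))) _).
    refine (etrans (esym (map_act sigma _ u1)) _).
    refine (etrans (congr1 (map_pt sigma) (esym eP)) _).
    exact (esym (psiG sigma hs P tP)).
  have tsP : map_pt sigma P \in torsion3 E by rewrite eu; exact (stab u).
  refine (etrans (congr1 (act (map_mx sigma M)) e1) _).
  refine (etrans _ (congr1 (act M) (esym e1))).
  refine (etrans _ (esym (hM' _ tsP))).
  refine (etrans (congr1 (act _) (psiG sigma hs P tP)) _).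
  refine (etrans (esym (map_act sigma _ uM)) _).
  refine (etrans (congr1 (map_pt sigma) (hM' _ tP)) _).
  exact (esym (phi_galois A B hs P)).
have uR : map_mx sigma M1 *m map_mx sigma M *m invmx M *m invmx (map_mx sigma M1) \in unitmx.
  by rewrite !unitmx_mul !unitmx_inv us1 usM uM.
have [c _ e] := fixes_tor_scalar hw' uR fix_tor.
by exists c; apply: (conj_scalar uM us1 e).
Qed.
End Model.

Lemma Ft_homog t : form (Ft A B t) \is 3.-homog.
Proof.
case: t => [t|]; last exact: Finf_homog.
by rewrite [form _]/=; apply: rpredD; [exact: F0_homog | apply: rpredZ; exact: Finf_homog].
Qed.

(** The transfer matrix is defined over k up to a scalar, and then the two
    coordinates of the equation of F in the pencil are values of forms over
    k. *)
Lemma antisymplectic_member : exists t, isomorphic F (Ft A B t).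
Proof.
have [w hw] := omega_ex.
have [a [b [ha hb]]] := hesse_params (iota A) (iota B).
have [homF homGF smF onF flF] := elliptic_geom hF.
have [M1 [a1 [b1 mF]]] := hesse_model_ex hw homGF smF onF flF.
have [M [l [m [uM hM oM hev]]]] := transfer_matrix hw ha hb mF.
have [M0 [c nc [u0 eM]]] := matrix_descent uM (fun sigma => transfer_galois hw ha hb mF uM hM).
have hF0 := F0_homog A B; have hFi := Finf_homog A B.
have ev0 v0 : iota (ev (form F) v0) = l * c ^+ 3 * iota (ev (F0_form A B) (v0 *m M0))
    + m * c ^+ 3 * iota (ev (Finf_form A B) (v0 *m M0)).
  rewrite -(ev_map iota _ homF) [LHS]hev eM -scalemxAr -map_mxM.
  have hg p : p \is [in k[3], 3.-homog] -> map_mpoly iota p \is 3.-homog.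
    by move=> /homog3E [d ->]; rewrite map_cubic_form cubic_form_homog.
  rewrite !evZ ?hg // !ev_map //; ring.
(* Evaluating at the points that M0 sends to (1 : 0 : 0) and (1 : 1 : 0)
   isolates the two coordinates. *)
have evF0 x y : ev (F0_form A B) (vec3 x y 0) = - x ^+ 3.
  by rewrite F0_cubic ev_cubic /cubic_val !vec3E /=; ring.
have evFi x y : ev (Finf_form A B) (vec3 x y 0) = 3%:R * x * y ^+ 2.
  by rewrite Finf_cubic ev_cubic /cubic_val !vec3E /=; ring.
have [l0 el] : exists l0, l * c ^+ 3 = iota l0.
  exists (- ev (form F) (vec3 1 0 0 *m invmx M0)).
  rewrite rmorphN ev0 mulmxKV // evF0 evFi expr0n /= mulr0 rmorph0 mulr0 addr0.
  by rewrite expr1n rmorphN1 mulrN1 opprK.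
have [m0 em] : exists m0, m * c ^+ 3 = iota m0.
  exists ((ev (form F) (vec3 1 1 0 *m invmx M0) + l0) / 3%:R).
  rewrite fmorph_div rmorphD ev0 mulmxKV // evF0 evFi -el !expr1n !mulr1 rmorphN1 rmorph_nat.
  by field.
have evk v0 : ev (form F) v0 = l0 * ev (F0_form A B) (v0 *m M0) + m0 * ev (Finf_form A B) (v0 *m M0).
  by apply: (fmorph_inj iota); rewrite ev0 el em rmorphD !rmorphM.
have nlm : ~~ ((l0 == 0) && (m0 == 0)).
  apply/negP => /andP[/eqP lz /eqP mz].
  have F_0 : form F = 0.
    apply: (cubic_ext (numfield_two_neq0 k) homF (rpred0 _)) => v; rewrite evk lz mz !mul0r addr0.
    by rewrite /ev meval0.
  have [y] := polar_neq0 smF (val_nz (orig GF)) (eqP onF).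
  case/negP; rewrite /geom /base_change [form _]/= F_0 rmorph0.
  by rewrite /polar big1 // => i _; rewrite linear0 meval0 mul0r.
have o0 : pt (val (orig F) *m M0) = pt010 k.
  apply: (map_pt_inj (f := iota)); rewrite map_pt_ptE map_pt010 map_mxM -val_map_pt.
  by move: oM; rewrite eM; exact: etrans (esym (actZl _ _ nc)).
have iso t d : d != 0 -> (forall v, ev (form (Ft A B t)) (v *m M0) = d * ev (form F) v) ->
    isomorphic F (Ft A B t).
  move=> nd hd; exists M0, d; split=> //.
  apply: (cubic_ext (numfield_two_neq0 k)) => [||v]; last by rewrite ev_comp_linear hd evZl.
    by apply: comp_linear_homog; exact: Ft_homog.
  exact: rpredZ.
have [l00|nl] := eqVneq l0 0.
  rewrite l00 eqxx /= in nlm; exists None; apply: (iso _ m0^-1); first by rewrite invr_eq0.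
  by move=> v; rewrite evk l00 mul0r add0r mulKf.
exists (Some (m0 / l0)); apply: (iso _ l0^-1); first by rewrite invr_eq0.
by move=> v; rewrite [form _]/= evZD evk; field.
Qed.
End Membership.

Theorem theorem5p3 (k : fieldExtType rat) (iota : {rmorphism k -> algC})
    (A B : k) (hE0 : elliptic iota (E0 A B)) (hA : A != 0) :
  [/\ elliptic iota (F0 A B),
      forall t : option k, elliptic iota (Ft A B t) ->
        antisymplectic_iso iota (E0 A B) (Ft A B t) (phi iota A B)
    & forall F : pcubic k, elliptic iota F ->
        (exists psi : P2 algC -> P2 algC,
           antisymplectic_iso iota (E0 A B) F psi) ->
        exists t : option k, isomorphic F (Ft A B t)].
Proof.
split; first exact: F0_elliptic hE0 hA.
  by move=> t; exact: phi_antisymplectic hE0 hA t.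
by move=> F hF [psi hpsi]; exact: antisymplectic_member hE0 hA F hF psi hpsi.
Qed.
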